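(* Let $k\ge 1$ and let $AP_k=\mathrm{End}_{\mathsf{APar}}((\uparrow\downarrow)^k)$. The assignment $\varphi$ on generators given by: $\varphi(e_j)$ is the simple diagram with pairs $\{(j,1),(j+1,1)\}$, $\{(j,0),(j+1,0)\}$ and $\{(r,0),(r,1)\}$ for $r\ne j,j+1$; $\varphi(\tau_j)$ is the simple diagram with pairs $\{(j-1,0),(j+1,1)\}$, $\{(j+1,0),(j-1,1)\}$ and $\{(r,0),(r,1)\}$ for $r\neq j-1,j+1$; $\varphi(x_r)$ is the identity diagram with one dot on the $r$-th string; $\varphi(z_l)$ is the identity diagram with a clockwise circle carrying $l$ dots placed to the left of all strings; defines a surjective homomorphism of $\mathbb{C}$-algebras $\varphi:\mathcal{A}_{2k}^{\mathrm{aff}}\to AP_k$.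
   Context: **Affine partition algebra.** Fix $k\ge1$; $[m]=\{1,\dots,m\}$. $\mathcal{A}_{2k}^{\mathrm{aff}}$ is the unital associative $\mathbb{C}$-algebra with generators $\tau_i$ ($2\le i\le 2k-1$), $e_j$ ($1\le j\le 2k-1$), $x_r$ ($1\le r\le 2k$), $z_l$ ($l\in\mathbb{Z}_{\ge0}$) and the following relations (where no range is given, for all indices for which all generators involved are defined): (1) $\tau_{2i}^2=1-e_{2i}$, $\tau_{2i+1}^2=1-e_{2i}$ for $i\in[k-1]$. (2) $\tau_{2i+1}\tau_{2j}=\tau_{2j}\tau_{2i+1}$ for $j\ne i+1$; $\tau_{2i+1}\tau_{2j+1}=\tau_{2j+1}\tau_{2i+1}$ and $\tau_{2i}\tau_{2j}=\tau_{2j}\tau_{2i}$ for $j\ne i\pm1$; $s_is_{i+1}s_i=s_{i+1}s_is_{i+1}$ for $i\in[k-2]$, where $s_j:=\tau_{2j}\tau_{2j+1}+e_{2j}$. (3) $e_{2i-1}^2=z_0e_{2i-1}$ ($i\in[k]$); and for $i\in[k-1]$: $e_{2i}^2=e_{2i}$, $\tau_{2i+1}e_{2i}=e_{2i}\tau_{2i+1}=0$, $\tau_{2i}e_{2i}=e_{2i}\tau_{2i}=0$, $\tau_{2i}e_{2i-1}e_{2i+1}=\tau_{2i+1}e_{2i-1}e_{2i+1}$, $e_{2i+1}e_{2i-1}\tau_{2i}=e_{2i+1}e_{2i-1}\tau_{2i+1}$. (4) $e_ie_j=e_je_i$ if $|i-j|\ge2$; $\tau_{2i-1}e_{2j-1}=e_{2j-1}\tau_{2i-1}$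 if $j\ne i-1,i$; $\tau_{2i-1}e_{2j}=e_{2j}\tau_{2i-1}$ if $j\ne i$; $\tau_{2i}e_{2j-1}=e_{2j-1}\tau_{2i}$ if $j\neq i,i+1$; $\tau_{2i}e_{2j}=e_{2j}\tau_{2i}$ if $j\ne i-1$. (5) $e_ie_{i+1}e_i=e_i$, $e_{i+1}e_ie_{i+1}=e_{i+1}$ for $i\in[2k-2]$; $\tau_{2i}e_{2i-1}\tau_{2i}=\tau_{2i+1}e_{2i+1}\tau_{2i+1}$ for $i\in[k-1]$; $\tau_{2i}e_{2i-2}\tau_{2i}=\tau_{2i-1}e_{2i}\tau_{2i-1}$ for $2\le i\le k-1$. (6) $x_ix_j=x_jx_i$; $\tau_ix_j=x_j\tau_i$ for $j\ne i-1,i,i+1$; $e_ix_j=x_je_i$ for $j\ne i,i+1$. (7) $\tau_{2i-2}\tau_{2i}\tau_{2i-2}=\tau_{2i}\tau_{2i-2}\tau_{2i}(1-e_{2i-2})$; $\tau_{2i+1}\tau_{2i-1}\tau_{2i+1}=\tau_{2i-1}\tau_{2i+1}\tau_{2i-1}(1-e_{2i})$; $\tau_{2i-1}\tau_{2i}\tau_{2i-1}=\tau_{2i}-e_{2i-2}\tau_{2i}-\tau_{2i}e_{2i-2}$; $\tau_{2i}\tau_{2i-1}\tau_{2i}=\tau_{2i-1}-e_{2i}\tau_{2i-1}-\tau_{2i-1}e_{2i}$. (8) $x_{2i+1}=\tau_{2i}x_{2i-1}\tau_{2i}+e_{2i}e_{2i-1}\tau_{2i}+\tau_{2i}e_{2i-1}e_{2i}-\tau_{2i}$;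 $x_{2i+2}=\tau_{2i+1}x_{2i}\tau_{2i+1}+e_{2i}e_{2i+1}\tau_{2i+1}e_{2i+1}e_{2i}+\tau_{2i+1}$; $x_{2i}=\tau_{2i}x_{2i}\tau_{2i}+e_{2i}e_{2i-1}\tau_{2i}+\tau_{2i}e_{2i-1}e_{2i}$; $x_{2i+1}=\tau_{2i+1}x_{2i+1}\tau_{2i+1}+e_{2i}e_{2i+1}\tau_{2i+1}+\tau_{2i+1}e_{2i+1}e_{2i}$. (9) $e_i(x_i-x_{i+1})=0=(x_i-x_{i+1})e_i$ for $i\in[2k-1]$. (10) $e_1x_1^le_1=z_le_1$ for $l\ge1$; every $z_l$ ($l\ge0$) is central. **Heisenberg category.** $\mathsf{Heis}$ is the strict $\mathbb{C}$-linear monoidal category whose objects are words in the letters $\uparrow,\downarrow$ (tensor product of objects is concatenation, unit is the empty word $\emptyset$). For words $\bm a=a_1\cdots a_n$, $\bm b=b_1\cdots b_m$, consider in the strip $\mathbb{R}\times[0,1]$ the endpoints $(i,1)$, $1\le i\le n$, coloured by $a_i$, and $(j,0)$, $1\le j\le m$, coloured by $b_j$. An $(\bm a,\bm b)$-matching is a partition of the endpoints into pairs such that paired points in the same row have opposite arrows and paired points in different rows have the same arrow. An $(\bm a,\bm b)$-diagram is a finite collection of oriented immersed intervals (strings) and oriented immersed circles (loops) in the strip, up to isotopy rel boundary, such that: the endpoints of the strings induce an $(\bm a,\bm b)$-matching, with the orientation of the string near each endpoint given by the arrow there; there are finitely many intersection points, none triple or tangential; loops do not meet the boundary of the strip and strings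 meet it only in their endpoints. $\mathrm{Hom}_{\mathsf{Heis}}(\bm a,\bm b)$ is the $\mathbb{C}$-vector space spanned by $(\bm a,\bm b)$-diagrams modulo the following local relations (which may be applied in any disc, up to isotopy and rotation): (H1) a strand may be moved across a crossing of two other strands (Reidemeister III), for all orientations; (H2) two strands crossing twice in succession (an empty bigon), one with both ends on the left of the disc and one with both ends on the right, may be pulled apart if both are oriented upwards, or if the left one is oriented upwards and the right one downwards; (H3) in the same picture with the left strand (ends bottom-left, top-left) oriented downwards and the right strand oriented upwards, the double crossing equals (the two uncrossed vertical strands) minus (an arc at the top directed from top-left to top-right together with an arc at the bottom directed from bottom-right to bottom-left); (H4) a left curl (an upward strand with an empty counterclockwise curl on its left) is $0$, and an empty counterclockwise circle equals $1$. The composition $\alpha\beta$ is stacking $\alpha$ on top of $\beta$; tensor product of morphisms is horizontal juxtaposition. A dot on a strand denotes a right curl (for an upward strand, a small clockwise curl on its right; rotated accordingly for other directions). A diagram is simple if it has no loops, no self-intersections, and any two strings intersect at most once. Every matching is induced by a simple diagram, and all simple diagrams inducing it represent the same morphism; so a simple diagram is specified by its matching. **Affine partition category.** $\mathsf{APar}$ is the ($\mathbb{C}$-linear) monoidal subcategory of $\mathsf{Heis}$ generated by the object $\uparrow\downarrow$ and the following morphisms: (a) the endomorphism $\Sigma+E$ of $\uparrow\downarrow\uparrow\downarrow$, where $\Sigma$ is the simple diagram with pairs $\{(1,0),(3,1)\},\{(3,0),(1,1)\},\{(2,0),(4,1)\},\{(4,0),(2,1)\}$ and $E$ is the simple diagram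 with pairs $\{(1,0),(1,1)\},\{(4,0),(4,1)\},\{(2,0),(3,0)\},\{(2,1),(3,1)\}$; (b) the simple diagram in $\mathrm{Hom}(\uparrow\downarrow,\uparrow\downarrow\uparrow\downarrow)$ with pairs $\{(1,1),(1,0)\},\{(2,1),(4,0)\},\{(2,0),(3,0)\}$, and the simple diagram in $\mathrm{Hom}(\uparrow\downarrow\uparrow\downarrow,\uparrow\downarrow)$ with pairs $\{(1,1),(1,0)\},\{(4,1),(2,0)\},\{(2,1),(3,1)\}$; (c) the single arcs in $\mathrm{Hom}(\emptyset,\uparrow\downarrow)$ and in $\mathrm{Hom}(\uparrow\downarrow,\emptyset)$; (d) the endomorphisms of $\uparrow\downarrow$ given by (identity diagram with a dot on the first string) $+$ identity, and (identity diagram with a dot on the second string) $+$ identity; (e) the endomorphisms $T+E$ and $T'+E$ of $\uparrow\downarrow\uparrow\downarrow$, where $T$ is the simple diagram with pairs $\{(1,0),(3,1)\},\{(3,0),(1,1)\},\{(2,0),(2,1)\},\{(4,0),(4,1)\}$ and $T'$ is the simple diagram with pairs $\{(2,0),(4,1)\},\{(4,0),(2,1)\},\{(1,0),(1,1)\},\{(3,0),(3,1)\}$. *)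

(* Defs.v *)
From HB Require Import structures.
From mathcomp Require Import all_boot all_algebra.
From mathcomp Require Import zify.
From mathcomp Require Import boolp reals.
From mathcomp Require Import complex.
From mathcomp Require Import finmap monalg.

Set Implicit Arguments.
Unset Strict Implicit.
Unset Printing Implicit Defensive.

Import GRing.Theory.
Local Open Scope ring_scope.
Local Open Scope quotient_scope.

Section LinearQuotient.
Variables (K : fieldType) (V : lmodType K) (S : V -> Prop).

Inductive spanned : V -> Prop :=
  | spanned_gen v of S v : spanned v
  | spanned0 : spanned 0
  | spanned_lin c u v of spanned u & spanned v : spanned (c *: u + v).

Definition span : {pred V} := fun v => `[< spanned v >].

Lemma spanP v : reflect (spanned v) (v \in span).
Proof. exact: asboolP. Qed.

Lemma span_zmod_closed : zmod_closed span.
Proof.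
split=> [|u v /spanP su /spanP sv]; apply/spanP; first exact: spanned0.
by rewrite addrC -scaleN1r; apply: spanned_lin.
Qed.
HB.instance Definition _ := GRing.isZmodClosed.Build V span span_zmod_closed.

Lemma spanZ c v : v \in span -> c *: v \in span.
Proof.
move=> /spanP sv; apply/spanP; rewrite -[c *: v]addr0.
by apply: spanned_lin => //; exact: spanned0.
Qed.

Definition lquot := Quotient.quot span.
HB.instance Definition _ := Choice.on lquot.

End LinearQuotient.

(** The projection and the operations are sealed to keep unification fast. *)
HB.lock Definition lproj (K : fieldType) (V : lmodType K) (S : V -> Prop) (v : V)
  : lquot S := \pi_(lquot S) v.
HB.lock Definition lquot_opp (K : fieldType) (V : lmodType K) (S : V -> Prop)
  (x : lquot S) : lquot S := lproj S (- repr x).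
HB.lock Definition lquot_add (K : fieldType) (V : lmodType K) (S : V -> Prop)
  (x y : lquot S) : lquot S := lproj S (repr x + repr y).
HB.lock Definition lquot_scale (K : fieldType) (V : lmodType K) (S : V -> Prop)
  (c : K) (x : lquot S) : lquot S := lproj S (c *: repr x).

Section LinearQuotientTheory.
Variables (K : fieldType) (V : lmodType K) (S : V -> Prop).
Local Notation span := (span S).
Local Notation lquot := (lquot S).
Local Notation lproj := (lproj S).

Lemma lproj_eq u v : lproj u = lproj v <-> u - v \in span.
Proof.
rewrite lproj.unlock Quotient.idealrBE; split; first by move=> e; apply/eqP.
by move/eqP.
Qed.

Lemma lproj_repr (x : lquot) : lproj (repr x) = x.
Proof. by rewrite lproj.unlock; exact: reprK. Qed.

Lemma lquotP (P : lquot -> Prop) : (forall v, P (lproj v)) -> forall x, P x.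
Proof. by move=> h x; rewrite -[x]lproj_repr. Qed.

Lemma lproj_reprB v : repr (lproj v) - v \in span.
Proof. by apply/lproj_eq; rewrite lproj_repr. Qed.

Lemma lproj_opp v : lproj (- v) = lquot_opp (lproj v).
Proof.
rewrite lquot_opp.unlock; apply/lproj_eq.
by rewrite opprK addrC lproj_reprB.
Qed.

Lemma lproj_add u v : lproj (u + v) = lquot_add (lproj u) (lproj v).
Proof.
rewrite lquot_add.unlock; apply/esym/lproj_eq.
by rewrite opprD addrACA rpredD ?lproj_reprB.
Qed.

Lemma lproj_scale c v : lproj (c *: v) = lquot_scale c (lproj v).
Proof.
by rewrite lquot_scale.unlock; apply/esym/lproj_eq; rewrite -scalerBr spanZ ?lproj_reprB.
Qed.

Lemma lquot_addA : associative (@lquot_add K V S).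
Proof. by do 3!elim/lquotP=> ?; rewrite -!lproj_add addrA. Qed.
Lemma lquot_addC : commutative (@lquot_add K V S).
Proof. by do 2!elim/lquotP=> ?; rewrite -!lproj_add addrC. Qed.
Lemma lquot_add0 : left_id (lproj 0) (@lquot_add K V S).
Proof. by elim/lquotP=> ?; rewrite -lproj_add add0r. Qed.
Lemma lquot_addN : left_inverse (lproj 0) (@lquot_opp K V S) (@lquot_add K V S).
Proof. by elim/lquotP=> ?; rewrite -lproj_opp -lproj_add addNr. Qed.
HB.instance Definition _ :=
  GRing.isZmodule.Build lquot lquot_addA lquot_addC lquot_add0 lquot_addN.

Lemma lquot_scalerA c d (x : lquot) :
  lquot_scale c (lquot_scale d x) = lquot_scale (c * d) x.
Proof. by elim/lquotP: x => v; rewrite -!lproj_scale scalerA. Qed.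
Lemma lquot_scale1r : left_id 1 (@lquot_scale K V S).
Proof. by elim/lquotP=> v; rewrite -lproj_scale scale1r. Qed.
Lemma lquot_scalerDr : right_distributive (@lquot_scale K V S) (@lquot_add K V S).
Proof.
move=> c; elim/lquotP=> u; elim/lquotP=> v.
by rewrite -lproj_add -!lproj_scale scalerDr lproj_add.
Qed.
Lemma lquot_scalerDl (x : lquot) :
  {morph (@lquot_scale K V S)^~ x : c d / c + d}.
Proof. by elim/lquotP: x => v c d /=; rewrite -!lproj_scale scalerDl lproj_add. Qed.
HB.instance Definition _ := GRing.Zmodule_isLmodule.Build K lquot
  lquot_scalerA lquot_scale1r lquot_scalerDr lquot_scalerDl.

Lemma lproj_is_linear : linear lproj.
Proof. by move=> c u v; rewrite lproj_add lproj_scale. Qed.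
HB.instance Definition _ := GRing.isLinear.Build K V lquot _ lproj lproj_is_linear.

End LinearQuotientTheory.

Section BilinearQuotient.
Variables (K : fieldType) (U V W : lmodType K).
Variables (S : U -> Prop) (T : V -> Prop) (Z : W -> Prop).
Variable B : U -> V -> W.

Definition bilinear_map := (forall v, linear (B^~ v)) /\ (forall u, linear (B u)).

Definition lquot2 (x : lquot S) (y : lquot T) : lquot Z :=
  lproj Z (B (repr x) (repr y)).

Hypothesis Bbil : bilinear_map.
Hypothesis BS : forall u v, S u -> spanned Z (B u v).
Hypothesis BT : forall u v, T v -> spanned Z (B u v).

Lemma lquot2E u v : lquot2 (lproj S u) (lproj T v) = lproj Z (B u v).
Proof.
have lin0 (E F : lmodType K) (f : E -> F) : linear f -> f 0 = 0.
  by move=> lf; have := lf (-1) 0 0; rewrite scaler0 addr0 scaleN1r addNr.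
have linB (E F : lmodType K) (f : E -> F) x y :
    linear f -> f (x - y) = f x - f y.
  by move=> lf; rewrite addrC -scaleN1r lf scaleN1r addrC.
have sU u' v' : spanned S u' -> B u' v' \in span Z.
  move=> su; apply/spanP; elim: {u'} su => [u' /BS //||c x y _ sx _ sy].
    by rewrite (lin0 _ _ _ (Bbil.1 v')); exact: spanned0.
  by rewrite (Bbil.1 v'); exact: spanned_lin.
have sV u' v' : spanned T v' -> B u' v' \in span Z.
  move=> sv; apply/spanP; elim: {v'} sv => [v' /BT //||c x y _ sx _ sy].
    by rewrite (lin0 _ _ _ (Bbil.2 u')); exact: spanned0.
  by rewrite (Bbil.2 u'); exact: spanned_lin.
rewrite /lquot2; set u' := repr _; set v' := repr _; apply/lproj_eq.
have -> : B u' v' - B u v = B (u' - u) v' + B u (v' - v).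
  by rewrite (linB _ _ _ _ _ (Bbil.1 v')) (linB _ _ _ _ _ (Bbil.2 u)) addrA subrK.
apply: rpredD; [apply: sU | apply: sV]; apply/spanP; apply/lproj_eq;
  exact: lproj_repr.
Qed.

End BilinearQuotient.

Section LinearExtension.
Variables (K : fieldType) (T : choiceType) (V : lmodType K).

Definition lext (h : T -> V) (f : {malg K[T]}) : V :=
  \sum_(x <- msupp f) f@_x *: h x.

Lemma lextEw h (f : {malg K[T]}) (D : {fset T}) :
  (msupp f `<=` D)%fset -> lext h f = \sum_(x <- D) f@_x *: h x.
Proof.
move=> le; rewrite /lext [in RHS](big_fsetID _ (mem (msupp f))) /=.
rewrite [X in _ = _ + X]big1_fset ?addr0; last first.
  by move=> x /imfsetP[y /= /andP[_ hy] ->] _; rewrite mcoeff_outdom ?scale0r.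
apply: eq_fbigl => x; apply/idP/imfsetP => [xf|[y /= /andP[_ yf] -> //]].
by exists x => //=; rewrite inE xf (fsubsetP le).
Qed.

Lemma lext_is_linear h : linear (lext h).
Proof.
move=> c f g.
pose D := (msupp f `|` msupp g)%fset.
have sf : (msupp f `<=` D)%fset by rewrite fsubsetUl.
have sg : (msupp g `<=` D)%fset by rewrite fsubsetUr.
have sfg : (msupp (c *: f + g) `<=` D)%fset.
  apply: fsubset_trans (msuppD_le _ _) _; apply: fsetUSS => //.
  exact: msuppZ_le.
rewrite (lextEw h sf) (lextEw h sg) (lextEw h sfg) scaler_sumr -big_split /=.
by apply: eq_bigr => x _; rewrite mcoeffD mcoeffZ scalerDl scalerA.
Qed.
HB.instance Definition _ h :=
  GRing.isLinear.Build K {malg K[T]} V _ (lext h) (lext_is_linear h).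

Lemma lextU h x : lext h << x >> = h x.
Proof.
rewrite (@lextEw h _ [fset x]%fset) ?msuppU_le // big_seq_fset1.
by rewrite mcoeffU eqxx scale1r.
Qed.

Lemma eq_lext h h' : h =1 h' -> lext h =1 lext h'.
Proof. by move=> e f; apply: eq_bigr => x _; rewrite e. Qed.

Lemma lext_lin c h h' f :
  lext (fun x => c *: h x + h' x) f = c *: lext h f + lext h' f.
Proof.
rewrite /lext scaler_sumr -big_split /=; apply: eq_bigr => x _.
by rewrite scalerDr !scalerA mulrC.
Qed.

Lemma malg_ind_lin (P : {malg K[T]} -> Prop) :
  P 0 -> (forall c x g, P g -> P (c *: << x >> + g)) -> forall f, P f.
Proof.
move=> P0 PS f; rewrite [f]monalgE; elim: (finmap.enum_fset _) => [|x s IH].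
  by rewrite big_nil.
rewrite big_cons; have -> : << f@_x *g x >> = f@_x *: << x >> :> {malg K[T]}.
  by apply/malgP => y; rewrite mcoeffZ !mcoeffU mulr_natr.
exact: PS.
Qed.

End LinearExtension.

Section BilinearExtension.
Variables (K : fieldType) (S T : choiceType) (V : lmodType K).
Definition lext2 (h : S -> T -> V) (f : {malg K[S]}) (g : {malg K[T]}) : V :=
  lext (fun x => lext (h x) g) f.

Lemma lext2_bil h : bilinear_map (lext2 h).
Proof.
split=> [g | f] c u v; first exact: linearP.
rewrite /lext2 -lext_lin; apply: eq_lext => x; exact: linearP.
Qed.

Lemma lext2UU h x y : lext2 h << x >> << y >> = h x y.
Proof. by rewrite /lext2 !lextU. Qed.

Lemma lext2Ul h x g : lext2 h << x >> g = lext (h x) g.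
Proof. by rewrite /lext2 lextU. Qed.

Lemma lext2Ur h f y : lext2 h f << y >> = lext (h^~ y) f.
Proof. by rewrite /lext2; apply: eq_lext => x; rewrite lextU. Qed.

End BilinearExtension.

Section PresentedAlgebra.
Variables (K : fieldType) (G : choiceType).
Let free := {malg K[{fmonom G}]}.

Lemma free_scalerAr c (u v : free) : c *: (u * v) = u * (c *: v).
Proof.
have cC (w : free) : c%:MP * w = w * c%:MP.
  rewrite !malgM_def fgmulUg fgmulgU; apply: eq_bigr => k _.
  by rewrite mulrC mul1m mulm1.
by rewrite -!mul_malgC mulrA cC mulrA.
Qed.

Variable rel : free -> Prop.

Inductive in_ideal_gen : free -> Prop :=
  InIdealGen u r v of rel r : in_ideal_gen (u * r * v).

Definition palg := lquot in_ideal_gen.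
HB.instance Definition _ := GRing.Lmodule.on palg.

Definition palg_proj (u : free) : palg := lproj in_ideal_gen u.
HB.instance Definition _ :=
  GRing.isLinear.Build K free palg _ palg_proj (@lproj_is_linear _ _ _).

Let mulf (u v : free) : free := u * v.

Lemma mulf_bil : bilinear_map mulf.
Proof.
split=> u c v w; first by rewrite /mulf mulrDl scalerAl.
by rewrite /mulf mulrDr free_scalerAr.
Qed.

Lemma mulf_idl u v : in_ideal_gen u -> spanned in_ideal_gen (mulf u v).
Proof.
case=> a r b rr; apply: spanned_gen; rewrite /mulf -mulrA; exact: InIdealGen.
Qed.

Lemma mulf_idr u v : in_ideal_gen v -> spanned in_ideal_gen (mulf u v).
Proof.
case=> a r b rr; apply: spanned_gen; rewrite /mulf !mulrA; exact: InIdealGen.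
Qed.

Definition palg_mul : palg -> palg -> palg := lquot2 in_ideal_gen mulf.

Lemma palg_mulE u v : palg_mul (lproj _ u) (lproj _ v) = lproj _ (u * v).
Proof. exact: lquot2E mulf_bil mulf_idl mulf_idr _ _. Qed.

Lemma palg_mulA : associative palg_mul.
Proof. by do 3!elim/lquotP=> ?; rewrite !palg_mulE mulrA. Qed.
Lemma palg_mul1r : left_id (lproj _ 1) palg_mul.
Proof. by elim/lquotP=> ?; rewrite palg_mulE mul1r. Qed.
Lemma palg_mulr1 : right_id (lproj _ 1) palg_mul.
Proof. by elim/lquotP=> ?; rewrite palg_mulE mulr1. Qed.
Lemma palg_mulDl : left_distributive palg_mul +%R.
Proof.
by do 3!elim/lquotP=> ?; rewrite -linearD !palg_mulE mulrDl linearD.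
Qed.
Lemma palg_mulDr : right_distributive palg_mul +%R.
Proof.
by do 3!elim/lquotP=> ?; rewrite -linearD !palg_mulE mulrDr linearD.
Qed.
HB.instance Definition _ := GRing.Zmodule_isPzRing.Build palg
  palg_mulA palg_mul1r palg_mulr1 palg_mulDl palg_mulDr.

Lemma palg_proj_monoid : monoid_morphism palg_proj.
Proof. split=> [|u v]; [exact: erefl | exact: esym (palg_mulE u v)]. Qed.
HB.instance Definition _ :=
  GRing.isMonoidMorphism.Build free palg palg_proj palg_proj_monoid.

Lemma palg_scalerAl c (x y : palg) : c *: (x * y) = (c *: x) * y.
Proof.
elim/lquotP: x => u; elim/lquotP: y => v.
have -> : (lproj _ u : palg) = palg_proj u by [].
have -> : (lproj _ v : palg) = palg_proj v by [].
by rewrite -rmorphM -!linearZ -rmorphM scalerAl.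
Qed.

Lemma palg_scalerAr c (x y : palg) : c *: (x * y) = x * (c *: y).
Proof.
elim/lquotP: x => u; elim/lquotP: y => v.
have -> : (lproj _ u : palg) = palg_proj u by [].
have -> : (lproj _ v : palg) = palg_proj v by [].
by rewrite -rmorphM -!linearZ -rmorphM free_scalerAr.
Qed.

End PresentedAlgebra.

Inductive aff_gen := g_tau of nat | g_e of nat | g_x of nat | g_z of nat.

Definition aff_gen_code (g : aff_gen) : (nat + nat) + (nat + nat) :=
  match g with
  | g_tau i => inl (inl i) | g_e i => inl (inr i)
  | g_x i => inr (inl i) | g_z i => inr (inr i)
  end.
Definition aff_gen_decode (s : (nat + nat) + (nat + nat)) : aff_gen :=
  match s with
  | inl (inl i) => g_tau i | inl (inr i) => g_e i
  | inr (inl i) => g_x i | inr (inr i) => g_z i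
  end.
Lemma aff_gen_codeK : cancel aff_gen_code aff_gen_decode.
Proof. by case. Qed.
HB.instance Definition _ := Countable.copy aff_gen (can_type aff_gen_codeK).

Definition defined_gen (k : nat) (g : aff_gen) : bool :=
  match g with
  | g_tau i => (2 <= i <= 2 * k - 1)%N
  | g_e j => (1 <= j <= 2 * k - 1)%N
  | g_x r => (1 <= r <= 2 * k)%N
  | g_z _ => true
  end.

(** Formal noncommutative polynomials in all symbols [g_tau i], [g_e j], [g_x r],
    [g_z l].  Relations are written with these, and a relation is imposed exactly
    when every generator occurring in it is defined.  All indices are natural
    numbers and subtraction is truncated; a truncated index or bound is harmless
    because index [0] is undefined for [g_tau], [g_e] and [g_x]. *)
Inductive aff_expr :=
  | Gen of aff_gen
  | Zero
  | One
  | Add of aff_expr & aff_expr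
  | Sub of aff_expr & aff_expr
  | Mul of aff_expr & aff_expr.

Declare Scope aff_scope.
Delimit Scope aff_scope with A.
Bind Scope aff_scope with aff_expr.
Notation "0" := Zero : aff_scope.
Notation "1" := One : aff_scope.
Notation "s + t" := (Add s t) : aff_scope.
Notation "s - t" := (Sub s t) : aff_scope.
Notation "s * t" := (Mul s t) : aff_scope.

Definition expr_pow (s : aff_expr) (l : nat) : aff_expr := iter l (Mul s) One.

Fixpoint defined_expr (k : nat) (s : aff_expr) : bool :=
  match s with
  | Gen g => defined_gen k g
  | Zero | One => true
  | Add s t | Sub s t | Mul s t => defined_expr k s && defined_expr k t
  end.

Section AffineRelations.
Local Open Scope nat_scope.

Let tau i := Gen (g_tau i).
Let e i := Gen (g_e i).
Let x i := Gen (g_x i).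
Let z l := Gen (g_z l).
Let s i := (tau (2 * i) * tau (2 * i + 1) + e (2 * i))%A.
Let commute a b (R : aff_expr -> aff_expr -> Prop) := R (a * b)%A (b * a)%A.

Variable k : nat.

Inductive aff_rel : aff_expr -> aff_expr -> Prop :=
  | rel1_even i : 1 <= i <= k - 1 ->
      aff_rel (tau (2 * i) * tau (2 * i)) (1 - e (2 * i))
  | rel1_odd i : 1 <= i <= k - 1 ->
      aff_rel (tau (2 * i + 1) * tau (2 * i + 1)) (1 - e (2 * i))
  | rel2_odd_even i j : j != i + 1 ->
      aff_rel (tau (2 * i + 1) * tau (2 * j)) (tau (2 * j) * tau (2 * i + 1))
  | rel2_odd_odd i j : j != i + 1 -> i != j + 1 ->
      aff_rel (tau (2 * i + 1) * tau (2 * j + 1)) (tau (2 * j + 1) * tau (2 * i + 1))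
  | rel2_even_even i j : j != i + 1 -> i != j + 1 ->
      aff_rel (tau (2 * i) * tau (2 * j)) (tau (2 * j) * tau (2 * i))
  | rel2_braid i : 1 <= i <= k - 2 ->
      aff_rel (s i * s (i + 1) * s i) (s (i + 1) * s i * s (i + 1))
  | rel3_e_odd i : 1 <= i <= k ->
      aff_rel (e (2 * i - 1) * e (2 * i - 1)) (z 0 * e (2 * i - 1))
  | rel3_e_even i : 1 <= i <= k - 1 ->
      aff_rel (e (2 * i) * e (2 * i)) (e (2 * i))
  | rel3_tau_odd_e i : 1 <= i <= k - 1 ->
      aff_rel (tau (2 * i + 1) * e (2 * i)) 0
  | rel3_e_tau_odd i : 1 <= i <= k - 1 ->
      aff_rel (e (2 * i) * tau (2 * i + 1)) 0
  | rel3_tau_even_e i : 1 <= i <= k - 1 ->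
      aff_rel (tau (2 * i) * e (2 * i)) 0
  | rel3_e_tau_even i : 1 <= i <= k - 1 ->
      aff_rel (e (2 * i) * tau (2 * i)) 0
  | rel3_tau_ee i : 1 <= i <= k - 1 ->
      aff_rel (tau (2 * i) * e (2 * i - 1) * e (2 * i + 1))
              (tau (2 * i + 1) * e (2 * i - 1) * e (2 * i + 1))
  | rel3_ee_tau i : 1 <= i <= k - 1 ->
      aff_rel (e (2 * i + 1) * e (2 * i - 1) * tau (2 * i))
              (e (2 * i + 1) * e (2 * i - 1) * tau (2 * i + 1))
  | rel4_ee i j : i + 2 <= j \/ j + 2 <= i ->
      aff_rel (e i * e j) (e j * e i)
  | rel4_odd_odd i j : j != i - 1 -> j != i ->
      aff_rel (tau (2 * i - 1) * e (2 * j - 1)) (e (2 * j - 1) * tau (2 * i - 1))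
  | rel4_odd_even i j : j != i ->
      aff_rel (tau (2 * i - 1) * e (2 * j)) (e (2 * j) * tau (2 * i - 1))
  | rel4_even_odd i j : j != i -> j != i + 1 ->
      aff_rel (tau (2 * i) * e (2 * j - 1)) (e (2 * j - 1) * tau (2 * i))
  | rel4_even_even i j : j != i - 1 ->
      aff_rel (tau (2 * i) * e (2 * j)) (e (2 * j) * tau (2 * i))
  | rel5_up i : 1 <= i <= 2 * k - 2 ->
      aff_rel (e i * e (i + 1) * e i) (e i)
  | rel5_down i : 1 <= i <= 2 * k - 2 ->
      aff_rel (e (i + 1) * e i * e (i + 1)) (e (i + 1))
  | rel5_odd i : 1 <= i <= k - 1 ->
      aff_rel (tau (2 * i) * e (2 * i - 1) * tau (2 * i))
              (tau (2 * i + 1) * e (2 * i + 1) * tau (2 * i + 1))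
  | rel5_even i : 2 <= i <= k - 1 ->
      aff_rel (tau (2 * i) * e (2 * i - 2) * tau (2 * i))
              (tau (2 * i - 1) * e (2 * i) * tau (2 * i - 1))
  | rel6_xx i j : aff_rel (x i * x j) (x j * x i)
  | rel6_tau i j : j != i - 1 -> j != i -> j != i + 1 ->
      aff_rel (tau i * x j) (x j * tau i)
  | rel6_e i j : j != i -> j != i + 1 ->
      aff_rel (e i * x j) (x j * e i)
  | rel7_even i :
      aff_rel (tau (2 * i - 2) * tau (2 * i) * tau (2 * i - 2))
              (tau (2 * i) * tau (2 * i - 2) * tau (2 * i) * (1 - e (2 * i - 2)))
  | rel7_odd i :
      aff_rel (tau (2 * i + 1) * tau (2 * i - 1) * tau (2 * i + 1))
              (tau (2 * i - 1) * tau (2 * i + 1) * tau (2 * i - 1) * (1 - e (2 * i)))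
  | rel7_odd_even i :
      aff_rel (tau (2 * i - 1) * tau (2 * i) * tau (2 * i - 1))
              (tau (2 * i) - e (2 * i - 2) * tau (2 * i)
                 - tau (2 * i) * e (2 * i - 2))
  | rel7_even_odd i :
      aff_rel (tau (2 * i) * tau (2 * i - 1) * tau (2 * i))
              (tau (2 * i - 1) - e (2 * i) * tau (2 * i - 1)
                 - tau (2 * i - 1) * e (2 * i))
  | rel8_a i :
      aff_rel (x (2 * i + 1))
              (tau (2 * i) * x (2 * i - 1) * tau (2 * i)
                 + e (2 * i) * e (2 * i - 1) * tau (2 * i)
                 + tau (2 * i) * e (2 * i - 1) * e (2 * i) - tau (2 * i))
  | rel8_b i :
      aff_rel (x (2 * i + 2))
              (tau (2 * i + 1) * x (2 * i) * tau (2 * i + 1)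
                 + e (2 * i) * e (2 * i + 1) * tau (2 * i + 1)
                     * e (2 * i + 1) * e (2 * i)
                 + tau (2 * i + 1))
  | rel8_c i :
      aff_rel (x (2 * i))
              (tau (2 * i) * x (2 * i) * tau (2 * i)
                 + e (2 * i) * e (2 * i - 1) * tau (2 * i)
                 + tau (2 * i) * e (2 * i - 1) * e (2 * i))
  | rel8_d i :
      aff_rel (x (2 * i + 1))
              (tau (2 * i + 1) * x (2 * i + 1) * tau (2 * i + 1)
                 + e (2 * i) * e (2 * i + 1) * tau (2 * i + 1)
                 + tau (2 * i + 1) * e (2 * i + 1) * e (2 * i))
  | rel9_l i : 1 <= i <= 2 * k - 1 ->
      aff_rel (e i * (x i - x (i + 1))) 0
  | rel9_r i : 1 <= i <= 2 * k - 1 ->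
      aff_rel ((x i - x (i + 1)) * e i) 0
  | rel10_bubble l : 1 <= l ->
      aff_rel (e 1 * expr_pow (x 1) l * e 1) (z l * e 1)
  | rel10_central l g : aff_rel (z l * Gen g) (Gen g * z l).

End AffineRelations.

Section AffinePartitionAlgebra.
Variables (K : fieldType) (k : nat).

Definition aff_gen_sub := {g : aff_gen | defined_gen k g}.
HB.instance Definition _ := Choice.on aff_gen_sub.

Definition free_gen (g : aff_gen) : {malg K[{fmonom aff_gen_sub}]} :=
  if insub g is Some g' then << fmu (g' : aff_gen_sub) >> else 0.

Fixpoint eval_expr (s : aff_expr) : {malg K[{fmonom aff_gen_sub}]} :=
  match s with
  | Gen g => free_gen g
  | Zero => 0
  | One => 1
  | Add s t => eval_expr s + eval_expr t
  | Sub s t => eval_expr s - eval_expr t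
  | Mul s t => eval_expr s * eval_expr t
  end.

Inductive aff_relator : {malg K[{fmonom aff_gen_sub}]} -> Prop :=
  AffRelator s t of aff_rel k s t & defined_expr k s & defined_expr k t :
    aff_relator (eval_expr s - eval_expr t).

Definition affine_partition_algebra := palg aff_relator.
HB.instance Definition _ := GRing.Lmodule.on affine_partition_algebra.
HB.instance Definition _ := GRing.PzRing.on affine_partition_algebra.

Definition aff (g : aff_gen) : affine_partition_algebra := palg_proj _ (free_gen g).

End AffinePartitionAlgebra.

(** A diagram is put in generic position with respect to the height function, so
   that its local maxima, local minima and crossings lie at distinct heights, and
   it is recorded as the list of these events read from top to bottom.  An event
   carries the number of strands to its left.  The orientation of every strand is
   determined by the word at the top together with the orientations of the local
   maxima, as [step] shows.  Planar isotopy rel boundary becomes [isotopic]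
   below. *)

Definition arrow := bool.
Notation Up := (true : arrow) (only parsing).
Notation Down := (false : arrow) (only parsing).
Definition opp_arrow (c : arrow) : arrow := ~~ c.
Definition word := seq arrow.

(** [Max c i]: a local maximum whose left leg carries the letter [c].
    [Min i]: a local minimum joining strands [i] and [i + 1].
    [Cross i]: a crossing of strands [i] and [i + 1].  Strands count from 0.
    A circle whose local maximum is [Max Up i] goes up on its left side, so it is
    clockwise; with [Max Down i] it is counterclockwise. *)
Inductive event := Max of arrow & nat | Min of nat | Cross of nat.

Definition event_code (s : event) : (arrow * nat) + (nat + nat) :=
  match s with
  | Max c i => inl (c, i) | Min i => inr (inl i) | Cross i => inr (inr i)
  end.
Definition event_decode (s : (arrow * nat) + (nat + nat)) : event :=
  match s with
  | inl (c, i) => Max c i | inr (inl i) => Min i | inr (inr i) => Cross i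
  end.
Lemma event_codeK : cancel event_code event_decode.
Proof. by case. Qed.
HB.instance Definition _ := Countable.copy event (can_type event_codeK).

Definition events := seq event.

(** The word met by a horizontal line just below an event, given the word just
    above it; [None] if the event cannot occur there. *)
Definition step (w : word) (s : event) : option word :=
  match s with
  | Max c i =>
      if (i <= size w)%N then Some (take i w ++ [:: c; opp_arrow c] ++ drop i w)
      else None
  | Min i =>
      if drop i w is x :: y :: t then
        if y == opp_arrow x then Some (take i w ++ t) else None
      else None
  | Cross i =>
      if drop i w is x :: y :: t then Some (take i w ++ [:: y; x] ++ t) else None
  end.

Fixpoint run (w : word) (d : events) : option word :=
  if d is s :: d' then (if step w s is Some w' then run w' d' else None)
  else Some w.

Definition shift_event (n : nat) (s : event) : event :=
  match s with
  | Max c i => Max c (n + i) | Min i => Min (n + i) | Cross i => Cross (n + i)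
  end.
Definition shift (n : nat) (d : events) : events := map (shift_event n) d.

(** [a] is the word at the top and [b] the word at the bottom. *)
Definition diagram (a b : word) := {d : events | run a d == Some b}.
HB.instance Definition _ a b := Choice.on (diagram a b).

Lemma run_cat w d d' :
  run w (d ++ d') = if run w d is Some w' then run w' d' else None.
Proof.
by elim: d w => [|s d IH] w //=; case: (step w s) => [w'|] //; apply: IH.
Qed.

Lemma step_frame u t w w' s : step w s = Some w' ->
  step (u ++ w ++ t) (shift_event (size u) s) = Some (u ++ w' ++ t).
Proof.
have dropE i : drop (size u + i) (u ++ w ++ t) = drop i (w ++ t).
  by rewrite drop_cat ltnNge leq_addr /= addKn.
have takeE i : take (size u + i) (u ++ w ++ t) = u ++ take i (w ++ t).
  by rewrite take_cat ltnNge leq_addr /= addKn.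
case: s => [c i|i|i] /=; rewrite ?dropE ?takeE.
- case: leqP => // le [<-]; rewrite !size_cat ifT; last by lia.
  rewrite take_cat drop_cat; case: ltnP le => [lt _|ge le].
    by rewrite -!catA.
  have -> : i = size w by lia.
  by rewrite subnn take0 drop0 take_size drop_size -!catA.
- rewrite take_cat drop_cat; case: ltnP => [lt|ge]; last by rewrite drop_oversize.
  case: (drop i w) => [|x [|y l]] //=; case: eqP => // _ [<-].
  by rewrite -!catA.
- rewrite take_cat drop_cat; case: ltnP => [lt|ge]; last by rewrite drop_oversize.
  by case: (drop i w) => [|x [|y l]] //= [<-]; rewrite -!catA.
Qed.

Lemma run_frame u t w w' d : run w d = Some w' ->
  run (u ++ w ++ t) (shift (size u) d) = Some (u ++ w' ++ t).
Proof.
elim: d w => [|s d IH] w /=; first by case=> ->.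
by case E : (step w s) => [v|] //; rewrite (step_frame u t E); apply: IH.
Qed.

Lemma shift0 d : shift 0 d = d.
Proof. by rewrite /shift map_id_in // => -[]. Qed.

Lemma run_frame0 t w w' d : run w d = Some w' -> run (w ++ t) d = Some (w' ++ t).
Proof. by move/(run_frame [::] t); rewrite shift0. Qed.

Lemma run_frame1 u w w' d : run w d = Some w' ->
  run (u ++ w) (shift (size u) d) = Some (u ++ w').
Proof. by move/(run_frame u [::]); rewrite !cats0. Qed.

(** Reading a diagram with [n] endpoints at the top, each strand is labelled by the
   string it belongs to; a local minimum identifies two labels. *)

Record tracing := Tracing {
  tr_top : seq nat; tr_cur : seq nat; tr_crossings : seq (nat * nat);
  tr_loops : nat; tr_fresh : nat }.

Definition trace_step (t : tracing) (s : event) : tracing :=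
  let: Tracing top cur xs loops fresh := t in
  match s with
  | Max _ i =>
      Tracing top (take i cur ++ [:: fresh; fresh] ++ drop i cur) xs loops fresh.+1
  | Min i =>
      let x := nth 0%N cur i in
      let y := nth 0%N cur i.+1 in
      let f := fun z => if z == y then x else z in
      Tracing (map f top) (map f (take i cur ++ drop i.+2 cur))
        [seq (f p.1, f p.2) | p <- xs] (loops + (x == y)) fresh
  | Cross i =>
      let x := nth 0%N cur i in
      let y := nth 0%N cur i.+1 in
      Tracing top (take i cur ++ [:: y; x] ++ drop i.+2 cur) ((x, y) :: xs) loops fresh
  end.

Definition trace (n : nat) (d : events) : tracing :=
  foldl trace_step (Tracing (iota 0 n) (iota 0 n) [::] 0 n) d.

(** No loop, no self-intersection, and no two strings meet twice. *)
Definition simple (n : nat) (d : events) : bool :=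
  let t := trace n d in
  [&& tr_loops t == 0%N, all (fun p => p.1 != p.2) (tr_crossings t)
    & uniq [seq (minn p.1 p.2, maxn p.1 p.2) | p <- tr_crossings t]].

(** The endpoint [(i, h)] with [i] counted from 1 and [h = 1] for the top row. *)
Definition endpoint := (nat * nat)%type.
Definition string_of (n : nat) (d : events) (p : endpoint) : nat :=
  let t := trace n d in
  nth 0%N (if p.2 == 1%N then tr_top t else tr_cur t) p.1.-1.
Definition endpoints (n m : nat) : seq endpoint :=
  [seq (i, 1%N) | i <- iota 1 n] ++ [seq (i, 0%N) | i <- iota 1 m].

(** The strings of [d] pair the [n] top and [m] bottom endpoints exactly as [P]. *)
Definition induces (n m : nat) (d : events) (P : rel endpoint) : bool :=
  all (fun p => all (fun q => (p != q) ==>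
      ((string_of n d p == string_of n d q) == (P p q || P q p)))
    (endpoints n m)) (endpoints n m).

Definition ud (k : nat) : word := flatten (nseq k [:: Up; Down]).

Definition pairs (P : seq (endpoint * endpoint)) : rel endpoint :=
  fun p q => (p, q) \in P.

Definition Sigma_diag : events := [:: Cross 1; Cross 0; Cross 2; Cross 1].
Definition E_diag : events := [:: Min 1; Max Down 1].
Definition split_diag : events := [:: Max Down 1].
Definition merge_diag : events := [:: Min 1].
Definition cap_diag : events := [:: Max Up 0].
Definition cup_diag : events := [:: Min 0].
Definition T_diag : events := [:: Cross 0; Cross 1; Cross 0].
Definition T'_diag : events := [:: Cross 1; Cross 2; Cross 1].

(** [d] is a simple diagram with top word [a], bottom word [b] and strings [P]. *)
Definition is_simple_diagram (a b : word) (d : events) (P : rel endpoint) : bool :=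
  [&& run a d == Some b, simple (size a) d & induces (size a) (size b) d P].

Local Open Scope nat_scope.

Lemma Sigma_diagP : is_simple_diagram (ud 2) (ud 2) Sigma_diag
  (pairs [:: ((1, 0), (3, 1)); ((3, 0), (1, 1)); ((2, 0), (4, 1)); ((4, 0), (2, 1))]).
Proof. by vm_compute. Qed.

Lemma E_diagP : is_simple_diagram (ud 2) (ud 2) E_diag
  (pairs [:: ((1, 0), (1, 1)); ((4, 0), (4, 1)); ((2, 0), (3, 0)); ((2, 1), (3, 1))]).
Proof. by vm_compute. Qed.

Lemma split_diagP : is_simple_diagram (ud 1) (ud 2) split_diag
  (pairs [:: ((1, 1), (1, 0)); ((2, 1), (4, 0)); ((2, 0), (3, 0))]).
Proof. by vm_compute. Qed.

Lemma merge_diagP : is_simple_diagram (ud 2) (ud 1) merge_diag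
  (pairs [:: ((1, 1), (1, 0)); ((4, 1), (2, 0)); ((2, 1), (3, 1))]).
Proof. by vm_compute. Qed.

Lemma cap_diagP :
  is_simple_diagram [::] (ud 1) cap_diag (pairs [:: ((1, 0), (2, 0))]).
Proof. by vm_compute. Qed.

Lemma cup_diagP :
  is_simple_diagram (ud 1) [::] cup_diag (pairs [:: ((1, 1), (2, 1))]).
Proof. by vm_compute. Qed.

Lemma T_diagP : is_simple_diagram (ud 2) (ud 2) T_diag
  (pairs [:: ((1, 0), (3, 1)); ((3, 0), (1, 1)); ((2, 0), (2, 1)); ((4, 0), (4, 1))]).
Proof. by vm_compute. Qed.

Lemma T'_diagP : is_simple_diagram (ud 2) (ud 2) T'_diag
  (pairs [:: ((2, 0), (4, 1)); ((4, 0), (2, 1)); ((1, 0), (1, 1)); ((3, 0), (3, 1))]).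
Proof. by vm_compute. Qed.

Definition e_diag (k j : nat) : events :=
  [:: Min j.-1; Max (nth Up (ud k) j.-1) j.-1].

Definition e_pairs (j : nat) : rel endpoint := fun p q =>
  [|| (p == (j, 1)) && (q == (j.+1, 1)), (p == (j, 0)) && (q == (j.+1, 0))
    | [&& p.1 != j, p.1 != j.+1, p.2 == 0, q.1 == p.1 & q.2 == 1]].

(** Strings [j - 1] and [j + 1] change places and string [j] crosses both. *)
Definition tau_diag (j : nat) : events :=
  [:: Cross (j - 2); Cross (j - 1); Cross (j - 2)].

Definition tau_pairs (j : nat) : rel endpoint := fun p q =>
  [|| (p == (j.-1, 0)) && (q == (j.+1, 1)), (p == (j.+1, 0)) && (q == (j.-1, 1))
    | [&& p.1 != j.-1, p.1 != j.+1, p.2 == 0, q.1 == p.1 & q.2 == 1]].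

Lemma size_ud k : size (ud k) = 2 * k.
Proof. by elim: k => //= k ->; lia. Qed.

Lemma nth_ud k i : i < 2 * k -> nth Up (ud k) i = ~~ odd i.
Proof.
elim: k i => [|k IH] [|[|i]] //= lt; rewrite IH; last by lia.
by rewrite negbK.
Qed.

Lemma all_endpointsP n m (P : rel endpoint) :
  (forall p q, 0 < p.1 -> 0 < q.1 -> p.2 < 2 -> q.2 < 2 ->
     p.1 <= (if p.2 == 1 then n else m) -> q.1 <= (if q.2 == 1 then n else m) ->
     P p q) ->
  all (fun p => all (P p) (endpoints n m)) (endpoints n m).
Proof.
move=> H; have mem p : p \in endpoints n m ->
    [/\ 0 < p.1, p.2 < 2 & p.1 <= (if p.2 == 1 then n else m)].
  rewrite mem_cat => /orP[] h; case: (mapP h) => i; rewrite mem_iota => /andP[? ?] -> /=;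
    by split=> //; lia.
by apply/allP => p /mem[? ? ?]; apply/allP => q /mem[? ? ?]; apply: H.
Qed.

Lemma e_diagP k j : 1 <= j <= 2 * k - 1 ->
  is_simple_diagram (ud k) (ud k) (e_diag k j) (e_pairs j).
Proof.
case: j => [//|j] /andP[_ ltj]; have {}ltj : j.+1 < 2 * k by lia.
have dropE : drop j (ud k) = ~~ odd j :: odd j :: drop j.+2 (ud k).
  rewrite (drop_nth Up) ?size_ud; last by lia.
  rewrite (drop_nth Up) ?size_ud //.
  by rewrite !nth_ud /= ?negbK //; lia.
apply/and3P; split.
- rewrite /e_diag /= dropE /= /opp_arrow negbK eqxx /=.
  rewrite size_cat size_take size_drop size_ud !ifT; try lia.
  rewrite nth_ud; last by lia.
  rewrite take_size_cat ?drop_size_cat ?size_take ?size_ud ?ifT //; try lia.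
  by apply/eqP; congr Some; rewrite -[RHS](cat_take_drop j) dropE ?negbK.
- rewrite /simple /trace /= !nth_iota ?size_ud //; last by lia.
  by rewrite !add0n; lia.
- rewrite /induces size_ud; apply: all_endpointsP => -[i h] [i' h'] /= i0 i0' h2 h2' le le'.
  set n := 2 * k in ltj le le' *.
  have top i1 : 0 < i1 -> i1 <= n -> string_of n (e_diag k j.+1) (i1, 1) =
      if i1 == j.+2 then j else i1.-1.
    move=> g0 len; rewrite /string_of /trace /=.
    rewrite (nth_map 0) ?size_iota ?nth_iota ?add0n; try lia.
    by case: ifP; case: ifP; lia.
  have bot i1 : 0 < i1 -> i1 <= n -> string_of n (e_diag k j.+1) (i1, 0) =
      if (i1 == j.+1) || (i1 == j.+2) then n else i1.-1.
    move=> g0 len; rewrite /string_of /trace /=.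
    have st : size (take j (iota 0 n)) = j by rewrite size_takel ?size_iota; lia.
    rewrite !nth_iota ?add0n; try lia.
    rewrite map_cat take_size_cat ?drop_size_cat ?size_map //.
    rewrite nth_cat size_map st; case: ltnP => h0.
      rewrite (nth_map 0) ?st // nth_take // nth_iota; last by lia.
      by do 2 case: ifP; lia.
    case E1 : (i1.-1 - j) => [|[|r]] /=; try by case: ifP; lia.
    rewrite (nth_map 0) ?size_drop ?size_iota ?nth_drop ?nth_iota; try lia.
    by do 2 case: ifP; lia.
  have {}le : i <= n by case: ifP le.
  have {}le' : i' <= n by case: ifP le'.
  apply/implyP => ne; apply/eqP; rewrite /e_pairs.
  case: h h2 ne => [|[|//]] _; case: h' h2' => [|[|//]] _; rewrite !xpair_eqE /= => ne;
    rewrite ?top ?bot //; do ?case: ifP; lia.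
Qed.

Lemma run_cons w s d :
  run w (s :: d) = if step w s is Some w' then run w' d else None.
Proof. by []. Qed.

Lemma step_cross (l r : word) x y :
  step (l ++ [:: x, y & r]) (Cross (size l)) = Some (l ++ [:: y, x & r]).
Proof. by rewrite /= drop_size_cat // take_size_cat. Qed.

Lemma trace_cross top l r x y xs p f :
  trace_step (Tracing top (l ++ [:: x, y & r]) xs p f) (Cross (size l)) =
  Tracing top (l ++ [:: y, x & r]) ((x, y) :: xs) p f.
Proof.
rewrite /= take_size_cat // !nth_cat ltnn subnn ltnNge leqnSn subSnn /=.
by rewrite -[in drop _ _]cat1s -[[:: x] ++ _]/([:: x] ++ ([:: y] ++ r)) !catA
  drop_size_cat // !size_cat /= !addn1.
Qed.

Lemma iota_split3 n i : i.+2 < n -> iota 0 n =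
  take i (iota 0 n) ++ [:: i, i.+1, i.+2 & drop i.+3 (iota 0 n)].
Proof.
move=> lt; rewrite -[LHS](cat_take_drop i) (drop_nth 0) ?size_iota; last by lia.
rewrite (drop_nth 0) ?size_iota; last by lia.
rewrite (drop_nth 0) ?size_iota ?nth_iota //; lia.
Qed.

Lemma trace_tau n i : i.+2 < n ->
  trace n [:: Cross i; Cross i.+1; Cross i] = Tracing (iota 0 n)
    (take i (iota 0 n) ++ [:: i.+2, i.+1, i & drop i.+3 (iota 0 n)])
    [:: (i.+1, i.+2); (i, i.+2); (i, i.+1)] 0 n.
Proof.
move=> lt; rewrite /trace [X in foldl _ (Tracing _ X _ _ _)](iota_split3 lt).
have : size (take i (iota 0 n)) = i by rewrite size_takel ?size_iota; lia.
move: (take i _) (drop i.+3 _) => l r sl.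
set t0 := Tracing _ _ _ _ _.
rewrite (_ : foldl _ _ _ = trace_step (trace_step (trace_step t0 (Cross (size l)))
  (Cross (size (rcons l i.+1)))) (Cross (size l))); last by rewrite size_rcons sl.
by rewrite trace_cross -cat_rcons trace_cross cat_rcons trace_cross.
Qed.

Lemma tau_diagP k j : 2 <= j <= 2 * k - 1 ->
  is_simple_diagram (ud k) (ud k) (tau_diag j) (tau_pairs j).
Proof.
case: j => [|[|i]] // /andP[_ lti]; have {}lti : i.+2 < 2 * k by lia.
have -> : tau_diag i.+2 = [:: Cross i; Cross i.+1; Cross i].
  by rewrite /tau_diag subn2 subn1.
apply/and3P; split.
- have sl : size (take i (ud k)) = i by rewrite size_takel ?size_ud; lia.
  have dE : drop i (ud k) = [:: ~~ odd i, odd i, ~~ odd i & drop i.+3 (ud k)].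
    rewrite (drop_nth Up) ?size_ud; last by lia.
    rewrite (drop_nth Up) ?size_ud; last by lia.
    rewrite (drop_nth Up) ?size_ud //.
    by rewrite !nth_ud /= ?negbK //; lia.
  rewrite -{1}(cat_take_drop i (ud k)) -[X in _ == Some X](cat_take_drop i) dE.
  move: (take i _) (drop i.+3 _) sl => l r sl.
  have -> : [:: Cross i; Cross i.+1; Cross i] =
     [:: Cross (size l); Cross (size (rcons l (odd i))); Cross (size l)].
    by rewrite size_rcons sl.
  rewrite run_cons step_cross -cat_rcons run_cons step_cross cat_rcons.
  by rewrite run_cons step_cross.
- rewrite /simple size_ud trace_tau //=; rewrite !inE !xpair_eqE; lia.
- rewrite /induces size_ud; apply: all_endpointsP => -[a h] [b h'] /= a0 b0 h2 h2' le le'.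
  set n := 2 * k in lti le le' *.
  have top c : 0 < c -> c <= n ->
      string_of n [:: Cross i; Cross i.+1; Cross i] (c, 1) = c.-1.
    by move=> g0 len; rewrite /string_of trace_tau //= nth_iota; lia.
  have bot c : 0 < c -> c <= n ->
      string_of n [:: Cross i; Cross i.+1; Cross i] (c, 0) =
      if c == i.+1 then i.+2 else if c == i.+3 then i else c.-1.
    move=> g0 len; rewrite /string_of trace_tau //=.
    have st : size (take i (iota 0 n)) = i by rewrite size_takel ?size_iota; lia.
    rewrite nth_cat st; case: ltnP => h0.
      by rewrite nth_take // nth_iota; [do 2 ?case: ifP|]; lia.
    case E1 : (c.-1 - i) => [|[|[|m]]] /=; try by do 2 ?case: ifP; lia.
    by rewrite nth_drop nth_iota; [do 2 ?case: ifP|]; lia.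
  have {}le : a <= n by case: ifP le.
  have {}le' : b <= n by case: ifP le'.
  apply/implyP => ne; apply/eqP; rewrite /tau_pairs.
  case: h h2 ne => [|[|//]] _; case: h' h2' => [|[|//]] _; rewrite !xpair_eqE /= => ne;
    rewrite ?top ?bot //; do ?case: ifP; lia.
Qed.

Local Close Scope nat_scope.

(** A dot on strand [i], whose letter is [c]: a clockwise curl, on the right of
    an upward strand and, rotating by a half turn, on the left of a downward one. *)
Definition dot (c : arrow) (i : nat) : events :=
  if c then [:: Max Up i.+1; Cross i; Min i.+1] else [:: Max Up i; Cross i.+1; Min i].

(** The identity with a dot on the string [r], counted from 1. *)
Definition x_diag (k r : nat) : events := dot (nth Up (ud k) r.-1) r.-1.

(** A clockwise circle to the left of everything, with [l] dots placed on its
    upward half. *)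
Definition z_diag (l : nat) : events :=
  Max Up 0 :: flatten (nseq l (dot Up 0)) ++ [:: Min 0].

Lemma run_dot (l r : word) c : run (l ++ c :: r) (dot c (size l)) = Some (l ++ c :: r).
Proof.
have : run [:: c] (dot c 0) = Some [:: c] by case: c.
move/(run_frame l r); congr (run _ _ = _).
by case: c; rewrite /= !addn0 !addn1.
Qed.

Lemma run_x_diag k r : (1 <= r <= 2 * k)%N -> run (ud k) (x_diag k r) = Some (ud k).
Proof.
case: r => // r lt; have sl : size (take r (ud k)) = r by rewrite size_takel ?size_ud; lia.
have := run_dot (take r (ud k)) (drop r.+1 (ud k)) (nth Up (ud k) r).
by rewrite -drop_nth ?size_ud ?cat_take_drop ?sl.
Qed.

Lemma run_z_diag w l : run w (z_diag l) = Some w.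
Proof.
rewrite /z_diag run_cons /= take0 drop0 run_cat.
suff -> : run [:: Up, opp_arrow Up & w] (flatten (nseq l (dot Up 0))) =
    Some [:: Up, opp_arrow Up & w] by rewrite /= ?take0.
by elim: l.
Qed.

(** The elementary moves generating planar isotopy rel boundary of generic
    diagrams: exchanging the heights of two horizontally separated parts,
    creating or cancelling a local maximum next to a local minimum, and moving a
    local extremum past a crossing that it takes part in.  No orientation is
    imposed in the last two families beyond what is needed for the pictures to
    exist. *)
Inductive isotopic : word -> events -> events -> Prop :=
  | iso_exchange w v w' v' d d' :
      run w d = Some v -> run w' d' = Some v' ->
      isotopic (w ++ w') (d ++ shift (size v) d') (shift (size w) d' ++ d)
  | iso_zigzag_l c : isotopic [:: c] [:: Max c 0; Min 1] [::]
  | iso_zigzag_r c : isotopic [:: c] [:: Max (opp_arrow c) 1; Min 0] [::]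
  | iso_max_cross c x : isotopic [:: x] [:: Max c 1; Cross 0] [:: Max c 0; Cross 1]
  | iso_min_cross c x :
      isotopic [:: c; x; opp_arrow c] [:: Cross 0; Min 1] [:: Cross 1; Min 0].

Section Heisenberg.
Variable K : fieldType.

(** [skein w L R]: the local relation [L = R] between linear combinations of
    diagrams in a disc whose boundary word at the top is [w].  Rotated versions of
    these relations, such as the double crossing of two downward strands, follow
    by rotating the disc with planar isotopy. *)
Inductive skein : word -> seq (K * events) -> seq (K * events) -> Prop :=
  | skein_isotopy w d d' : isotopic w d d' -> skein w [:: (1, d)] [:: (1, d')]
  | skein_triple x y z :
      skein [:: x; y; z] [:: (1, [:: Cross 0; Cross 1; Cross 0])]
                         [:: (1, [:: Cross 1; Cross 0; Cross 1])]
  | skein_up_up :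
      skein [:: Up; Up] [:: (1, [:: Cross 0; Cross 0])] [:: (1, [::])]
  | skein_up_down :
      skein [:: Up; Down] [:: (1, [:: Cross 0; Cross 0])] [:: (1, [::])]
  | skein_down_up :
      skein [:: Down; Up] [:: (1, [:: Cross 0; Cross 0])]
                          [:: (1, [::]); (-1, [:: Min 0; Max Down 0])]
  | skein_left_curl :
      skein [:: Up] [:: (1, [:: Max Down 0; Cross 1; Min 0])] [::]
  | skein_circle :
      skein [::] [:: (1, [:: Max Down 0; Min 0])] [:: (1, [::])].

Definition cls a b (d : events) : {malg K[diagram a b]} :=
  if insub d is Some D then << (D : diagram a b) >> else 0.

Definition lincomb a b (C : events -> events) (L : seq (K * events)) :
    {malg K[diagram a b]} :=
  \sum_(cd <- L) cd.1 *: cls a b (C cd.2).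

(** A local relation applied in a disc: above the disc is [p], level with it are
    strands [u] on its left and [t] on its right, and below it is [q]. *)
Inductive heis_rel a b : {malg K[diagram a b]} -> Prop :=
  HeisRel p q u w t L R :
    run a p = Some (u ++ w ++ t) -> skein w L R ->
    let C d := p ++ shift (size u) d ++ q in
    heis_rel (lincomb a b C L - lincomb a b C R).

Definition Heis (a b : word) := lquot (@heis_rel a b).
HB.instance Definition _ a b := GRing.Lmodule.on (Heis a b).

Lemma clsT a b d (e : run a d == Some b) :
  cls a b d = << (exist _ d e : diagram a b) >>.
Proof. by rewrite /cls insubT. Qed.

Lemma clsF a b d : run a d != Some b -> cls a b d = 0.
Proof. by move=> ne; rewrite /cls insubN. Qed.

Lemma cls_val a b (D : diagram a b) : cls a b (val D) = << D >>.
Proof. by rewrite /cls valK. Qed.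

Lemma isotopic_run w d d' : isotopic w d d' -> exists v, run w d = Some v /\ run w d' = Some v.
Proof.
case=> [{}w v w' v' {}d {}d' e e'|c|c|c x|c x].
- exists (v ++ v'); rewrite !run_cat (run_frame0 w' e) (run_frame1 _ e').
  by rewrite (run_frame1 _ e') (run_frame0 v' e).
- by exists [:: c]; rewrite /= /opp_arrow negbK eqxx.
- by exists [:: c]; rewrite /= /opp_arrow !negbK eqxx.
- by exists [:: c; x; opp_arrow c].
- by exists [:: x]; rewrite /= eqxx.
Qed.

Lemma skein_run w L R : skein w L R ->
  exists v, {in L ++ R, forall cd, run w cd.2 = Some v}.
Proof.
case=> [{}w d d' /isotopic_run[v [e e']]|x y z|||||];
  [exists v | exists [:: z; y; x] | exists [:: Up; Up] | exists [:: Up; Down]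
  | exists [:: Down; Up] | exists [:: Up] | exists [::]];
  move=> cd; rewrite !inE -?orbA.
- by case/orP => /eqP ->.
- by case/orP => /eqP ->.
- by case/orP => /eqP ->.
- by case/orP => /eqP ->.
- by case/or3P => /eqP ->.
- by move/eqP->.
- by case/orP => /eqP ->.
Qed.

Lemma lincomb_typed a b C L b' :
  {in L, forall cd, run a (C cd.2) = Some b'} -> b' != b -> lincomb a b C L = 0.
Proof.
move=> h ne; rewrite /lincomb big_seq big1 // => cd /h e.
by rewrite clsF ?scaler0 // e; apply: contra ne => /eqP[->].
Qed.

Lemma heis_rel_frame a b a' b' P Q x y (v : {malg K[diagram a b]}) :
  run a' P = Some (x ++ a ++ y) -> run (x ++ b ++ y) Q = Some b' ->
  heis_rel v ->
  spanned (@heis_rel a' b')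
    (lext (fun D => cls a' b' (P ++ shift (size x) (val D) ++ Q)) v).
Proof.
move=> eP eQ [p q u w t L R ep sk C].
have [w' ew'] := skein_run sk.
pose h (D : diagram a b) := cls a' b' (P ++ shift (size x) (val D) ++ Q).
rewrite -/h.
case eb : (run (u ++ w' ++ t) q) => [b1|]; last first.
  have l0 (M : seq (K * events)) : {subset M <= L ++ R} -> lincomb a b C M = 0.
    move=> sM; rewrite /lincomb big_seq big1 // => cd /sM/ew' e.
    by rewrite clsF ?scaler0 // /C /= run_cat ep run_cat (run_frame _ _ e) eb.
  rewrite !l0 ?subr0 ?linear0; first exact: spanned0.
    by move=> cd h1; rewrite mem_cat h1 orbT.
  by move=> cd h1; rewrite mem_cat h1.
have rC (M : seq (K * events)) : {subset M <= L ++ R} -> {in M, forall cd, run a (C cd.2) = Some b1}.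
  by move=> sM cd /sM/ew' e; rewrite /C /= run_cat ep run_cat (run_frame _ _ e) eb.
have sL : {subset L <= L ++ R} by move=> cd h1; rewrite mem_cat h1.
have sR : {subset R <= L ++ R} by move=> cd h1; rewrite mem_cat h1 orbT.
have [e|ne] := eqVneq b1 b; last first.
  rewrite (lincomb_typed (rC _ sL) ne) (lincomb_typed (rC _ sR) ne).
  by rewrite subr0 linear0; exact: spanned0.
subst b1.
pose C' d := (P ++ shift (size x) p) ++ shift (size (x ++ u)) d ++ (shift (size x) q ++ Q).
have shift_shift n m d : shift n (shift m d) = shift (n + m) d.
  by rewrite /shift -map_comp; apply: eq_map => -[c i|i|i] /=; rewrite addnA.
have lE (M : seq (K * events)) : {subset M <= L ++ R} -> lext h (lincomb a b C M) = lincomb a' b' C' M.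
  move=> sM; rewrite /lincomb linear_sum /= big_seq [in RHS]big_seq.
  apply: eq_bigr => cd /(rC _ sM) /eqP e; rewrite linearZ /= (clsT e) lextU.
  rewrite /h /= /C /C' size_cat -shift_shift /shift !map_cat -!catA.
  by [].
rewrite linearB /= !lE //; apply: spanned_gen.
apply: (@HeisRel a' b' (P ++ shift (size x) p) (shift (size x) q ++ Q)
          (x ++ u) w (t ++ y) L R _ sk).
by rewrite run_cat eP (run_frame x y ep) -!catA.
Qed.

Definition comp_diagram a b c (D : diagram a b) (E : diagram b c) :=
  cls a c (val D ++ val E).

Definition tensor_diagram a b c d (D : diagram a b) (E : diagram c d) :=
  cls (a ++ c) (b ++ d) (val D ++ shift (size b) (val E)).

End Heisenberg.

(** The class of a diagram; only meant for [d] with [run a d = Some b]. *)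
HB.lock Definition mor (K : fieldType) a b (d : events) : Heis K a b :=
  lproj _ (cls K a b d).

(** [comp f g] is [f] stacked on top of [g]. *)
HB.lock Definition comp (K : fieldType) a b c (f : Heis K a b) (g : Heis K b c) :
    Heis K a c :=
  lquot2 (@heis_rel K a c) (lext2 (@comp_diagram K a b c)) f g.

HB.lock Definition tensor (K : fieldType) a b c d
    (f : Heis K a b) (g : Heis K c d) : Heis K (a ++ c) (b ++ d) :=
  lquot2 (@heis_rel K (a ++ c) (b ++ d)) (lext2 (@tensor_diagram K a b c d)) f g.

Section HeisenbergTheory.
Variable K : fieldType.
Local Notation Heis := (Heis K).
Local Notation mor := (@mor K).
Local Notation cls := (@cls K).

Definition idm a : Heis a a := mor a a [::].

Lemma spanned_lext (T : choiceType) (V : lmodType K) (Z : V -> Prop)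
    (h h' : T -> V) f :
  h =1 h' -> spanned Z (lext h f) -> spanned Z (lext h' f).
Proof. by move=> /eq_lext ->. Qed.

Lemma spanned_lext2r (S T : choiceType) (V : lmodType K) (Z : V -> Prop)
    (h : S -> T -> V) f g :
  (forall y, spanned Z (lext (h^~ y) f)) -> spanned Z (lext2 h f g).
Proof.
move=> H; elim/malg_ind_lin: g => [|c x g IH].
  have -> : lext2 h f 0 = 0.
    by have := (lext2_bil h).2 f (-1) 0 0; rewrite scaler0 addr0 scaleN1r addNr.
  exact: spanned0.
by rewrite (lext2_bil h).2 lext2Ur; apply: spanned_lin.
Qed.

Lemma spanned_lext2l (S T : choiceType) (V : lmodType K) (Z : V -> Prop)
    (h : S -> T -> V) f g :
  (forall x, spanned Z (lext (h x) g)) -> spanned Z (lext2 h f g).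
Proof.
move=> H; elim/malg_ind_lin: f => [|c x f IH].
  have -> : lext2 h 0 g = 0.
    by have := (lext2_bil h).1 g (-1) 0 0; rewrite scaler0 addr0 scaleN1r addNr.
  exact: spanned0.
by rewrite (lext2_bil h).1 lext2Ul; apply: spanned_lin.
Qed.

Lemma compE a b c f g :
  comp (lproj (@heis_rel K a b) f) (lproj (@heis_rel K b c) g) =
  lproj _ (lext2 (@comp_diagram K a b c) f g).
Proof.
rewrite comp.unlock; apply: lquot2E => [|u v ru|u v rv]; first exact: lext2_bil.
- apply: spanned_lext2r => -[e ee].
  have e1 : run a [::] = Some ([::] ++ a ++ [::]) by rewrite cats0.
  have e2 : run ([::] ++ b ++ [::]) e = Some c by rewrite cats0; apply/eqP.
  apply: spanned_lext (heis_rel_frame e1 e2 ru) => -[d ed].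
  by rewrite /comp_diagram /= shift0.
- apply: spanned_lext2l => -[d ed].
  have e1 : run a d = Some ([::] ++ b ++ [::]) by rewrite cats0; apply/eqP.
  have e2 : run ([::] ++ c ++ [::]) [::] = Some c by rewrite cats0.
  apply: spanned_lext (heis_rel_frame e1 e2 rv) => -[e ee].
  by rewrite /comp_diagram /= shift0 cats0.
Qed.

Lemma tensorE a b c d f g :
  tensor (lproj (@heis_rel K a b) f) (lproj (@heis_rel K c d) g) =
  lproj _ (lext2 (@tensor_diagram K a b c d) f g).
Proof.
rewrite tensor.unlock; apply: lquot2E => [|u v ru|u v rv]; first exact: lext2_bil.
- apply: spanned_lext2r => -[e ee].
  have e1 : run (a ++ c) [::] = Some ([::] ++ a ++ c) by [].
  have e2 : run ([::] ++ b ++ c) (shift (size b) e) = Some (b ++ d).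
    exact: run_frame1 (eqP ee).
  apply: spanned_lext (heis_rel_frame e1 e2 ru) => -[d' ed].
  by rewrite /tensor_diagram /= shift0.
- apply: spanned_lext2l => -[d' ed].
  have e1 : run (a ++ c) d' = Some (b ++ c ++ [::]).
    by rewrite cats0; exact: run_frame0 (eqP ed).
  have e2 : run (b ++ d ++ [::]) [::] = Some (b ++ d) by rewrite cats0.
  apply: spanned_lext (heis_rel_frame e1 e2 rv) => -[e ee].
  by rewrite /tensor_diagram /= cats0.
Qed.

Lemma comp_mor a b c d e : run a d = Some b -> run b e = Some c ->
  comp (mor a b d) (mor b c e) = mor a c (d ++ e).
Proof.
move=> /eqP ed /eqP ee.
by rewrite !mor.unlock compE (clsT K ed) (clsT K ee) lext2UU.
Qed.

Lemma tensor_mor a b c d x y : run a x = Some b -> run c y = Some d ->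
  tensor (mor a b x) (mor c d y) = mor (a ++ c) (b ++ d) (x ++ shift (size b) y).
Proof.
move=> /eqP ex /eqP ey.
by rewrite !mor.unlock tensorE (clsT K ex) (clsT K ey) lext2UU.
Qed.

Lemma Heis_ind a b (P : Heis a b -> Prop) :
  P 0 -> (forall c d f, run a d = Some b -> P f -> P (c *: mor a b d + f)) ->
  forall f, P f.
Proof.
move=> P0 PS; elim/lquotP; elim/malg_ind_lin => [|c [d e] f IH].
  by rewrite linear0.
by rewrite linearP /=; have := PS c d _ (eqP e) IH; rewrite mor.unlock clsT.
Qed.

Lemma comp_linl a b c (g : Heis b c) : linear (@comp K a b c ^~ g).
Proof.
move=> k; elim/lquotP=> u; elim/lquotP=> v; elim/lquotP: g => g.
by rewrite -linearP !compE (lext2_bil _).1 linearP.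
Qed.

Lemma comp_linr a b c (f : Heis a b) : linear (@comp K a b c f).
Proof.
move=> k; elim/lquotP=> u; elim/lquotP=> v; elim/lquotP: f => f.
by rewrite -linearP !compE (lext2_bil _).2 linearP.
Qed.

HB.instance Definition _ a b c (f : Heis a b) :=
  GRing.isLinear.Build K (Heis b c) (Heis a c) _ (@comp K a b c f) (comp_linr f).

Lemma comp0l a b c (g : Heis b c) : comp (0 : Heis a b) g = 0.
Proof. by have := comp_linl g (-1) (0 : Heis a b) 0; rewrite scaler0 addr0 scaleN1r addNr. Qed.

Lemma comp_Pl a b c k (f f' : Heis a b) (g : Heis b c) :
  comp (k *: f + f') g = k *: comp f g + comp f' g.
Proof. exact: comp_linl. Qed.

Lemma comp_Pr a b c k (f : Heis a b) (g g' : Heis b c) :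
  comp f (k *: g + g') = k *: comp f g + comp f g'.
Proof. exact: comp_linr. Qed.

Lemma comp0r a b c (f : Heis a b) : comp f (0 : Heis b c) = 0.
Proof. exact: linear0. Qed.

Lemma compA a b c d (f : Heis a b) (g : Heis b c) (h : Heis c d) :
  comp f (comp g h) = comp (comp f g) h.
Proof.
elim/Heis_ind: f => [|k x f ex IHf]; first by rewrite !comp0l.
rewrite 3!comp_Pl IHf; congr (_ + _); congr (_ *: _).
elim/Heis_ind: g {IHf} => [|l y g ey IHg]; first by rewrite comp0l !comp0r comp0l.
rewrite comp_Pl 2!comp_Pr comp_Pl IHg; congr (_ + _); congr (_ *: _).
elim/Heis_ind: h {IHg} => [|m z h ez IHh]; first by rewrite !comp0r.
rewrite 3!comp_Pr IHh; congr (_ + _); congr (_ *: _).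
by rewrite !comp_mor ?catA // run_cat ?ex ?ey.
Qed.

Lemma comp_idl a b (f : Heis a b) : comp (idm a) f = f.
Proof.
elim/Heis_ind: f => [|k x f ex IHf]; first by rewrite comp0r.
by rewrite comp_Pr IHf comp_mor.
Qed.

Lemma comp_idr a b (f : Heis a b) : comp f (idm b) = f.
Proof.
elim/Heis_ind: f => [|k x f ex IHf]; first by rewrite comp0l.
by rewrite comp_Pl IHf comp_mor ?cats0.
Qed.

Definition EndHeis (a : word) := Heis a a.
HB.instance Definition _ a := GRing.Lmodule.on (EndHeis a).

Lemma comp_Dl a : left_distributive (@comp K a a a) +%R.
Proof. by move=> f g h; have := comp_linl h 1 f g; rewrite !scale1r. Qed.
Lemma comp_Dr a : right_distributive (@comp K a a a) +%R.
Proof. by move=> f g h; have := comp_linr f 1 g h; rewrite !scale1r. Qed.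

HB.instance Definition _ a := GRing.Zmodule_isPzRing.Build (EndHeis a)
  (@compA a a a a) (@comp_idl a a) (@comp_idr a a) (@comp_Dl a) (@comp_Dr a).

Inductive APar : forall a b, Heis a b -> Prop :=
  | APar_unit : APar (idm [::])
  | APar_id : APar (idm (ud 1))
  | APar_comp a b c (f : Heis a b) (g : Heis b c) :
      APar f -> APar g -> APar (comp f g)
  | APar_tensor a b c d (f : Heis a b) (g : Heis c d) :
      APar f -> APar g -> APar (tensor f g)
  | APar_lin a b (c : K) (f g : Heis a b) :
      APar f -> APar g -> APar (c *: f + g)
  | APar_Sigma : APar (mor (ud 2) (ud 2) Sigma_diag + mor (ud 2) (ud 2) E_diag)
  | APar_split : APar (mor (ud 1) (ud 2) split_diag)
  | APar_merge : APar (mor (ud 2) (ud 1) merge_diag)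
  | APar_cap : APar (mor [::] (ud 1) cap_diag)
  | APar_cup : APar (mor (ud 1) [::] cup_diag)
  | APar_dot_up : APar (mor (ud 1) (ud 1) (dot Up 0) + idm (ud 1))
  | APar_dot_down : APar (mor (ud 1) (ud 1) (dot Down 1) + idm (ud 1))
  | APar_T : APar (mor (ud 2) (ud 2) T_diag + mor (ud 2) (ud 2) E_diag)
  | APar_T' : APar (mor (ud 2) (ud 2) T'_diag + mor (ud 2) (ud 2) E_diag).

Lemma APar_ud k : APar (idm (ud k)).
Proof.
elim: k => [|k IH]; first exact: APar_unit.
have := APar_tensor APar_id IH.
by rewrite (tensor_mor (b := ud 1) (d := ud k)).
Qed.

Definition APar_end k : {pred EndHeis (ud k)} := fun f => `[< APar f >].

Lemma APar_end_subring k : subring_closed (@APar_end k).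
Proof.
split=> [|f g /asboolP Af /asboolP Ag|f g /asboolP Af /asboolP Ag]; apply/asboolP.
- exact: APar_ud.
- by rewrite addrC -scaleN1r; apply: APar_lin.
- exact: APar_comp.
Qed.
HB.instance Definition _ k :=
  GRing.isSubringClosed.Build (EndHeis (ud k)) (@APar_end k) (APar_end_subring k).

Lemma APar_end_subsemimod k : GRing.subsemimod_closed (@APar_end k).
Proof.
split=> [|c f /asboolP Af].
  by split=> [|f g Af Ag]; [exact: rpred0 | exact: rpredD].
apply/asboolP; have A0 : APar (0 : Heis (ud k) (ud k)).
  by rewrite -(subrr f) -scaleN1r addrC; apply: APar_lin.
by rewrite -[c *: f]addr0; apply: APar_lin.
Qed.

Definition AP k := {f : EndHeis (ud k) | APar_end f}.
HB.instance Definition _ k := [isSub of AP k for @sval _ _].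
HB.instance Definition _ k := [Choice of AP k by <:].
HB.instance Definition _ k := GRing.SubChoice_isSubPzRing.Build
  (EndHeis (ud k)) (@APar_end k) (AP k) (subringClosedP _).
HB.instance Definition _ k := GRing.SubZmodule_isSubLmodule.Build K
  (EndHeis (ud k)) (@APar_end k) (AP k) (@APar_end_subsemimod k).

Lemma comp_scalel a b c k (f : Heis a b) (g : Heis b c) :
  comp (k *: f) g = k *: comp f g.
Proof. by rewrite -[k *: f]addr0 comp_Pl comp0l addr0. Qed.

Lemma comp_scaler a b c k (f : Heis a b) (g : Heis b c) :
  comp f (k *: g) = k *: comp f g.
Proof. by rewrite -[k *: g]addr0 comp_Pr comp0r addr0. Qed.

Lemma AP_scalerAl k c (x y : AP k) : c *: (x * y) = (c *: x) * y.
Proof. by apply/val_inj/esym/comp_scalel. Qed.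

Lemma AP_scalerAr k c (x y : AP k) : c *: (x * y) = x * (c *: y).
Proof. by apply/val_inj/esym/comp_scaler. Qed.

End HeisenbergTheory.

(* Main.v *)
Require Import Defs.
From HB Require Import structures.
From mathcomp Require Import all_boot all_algebra.
From mathcomp Require Import zify boolp reals complex finmap monalg.

(** The relations of the affine partition algebra are local: each is verified once
    on few strands, by a certificate listing skein moves which a small reflective
    checker replays, and is then placed anywhere in a wider diagram.

    For surjectivity it is shown that the image is the whole endomorphism algebra of
    [ud k] in the Heisenberg category, so that nothing about the affine partition
    category is needed beyond containing the images of the generators.  Write
    [P n] for the word of [n] letters [Up] followed by [n] letters [Down].
    - Morphisms between words [P n] are spanned by diagrams all of whose horizontal
      sections are words [P m] ([cpath_span]): as the identity of [Down; Up] factors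
      through [Up; Down] and the empty word, inversions can be removed.
    - The diagram [Yd n] sorts [ud n] into [P n].  Let [low] be the morphisms from
      [ud k] to [P n] of the form [a] on [n]-th cups on [Yd n], with [a] in the image.
      Crossings, dots and small caps and cups slide through [Yd n], turning into
      generators.  A diagram passing through wider words than [P k] is reduced by
      the coset decomposition of the degenerate affine Hecke algebra of its widest
      section, after which the innermost cap and cup close up to a bubble, a curl
      or a cup over a cap.  Hence [low] is closed under composition with all
      morphisms between words [P n] ([low_closed]).
    - The bigon relation telescopes the identity of [ud n] into [Yd n] followed by
      its inverse sorting [Xd n], plus terms containing some [e_2j] ([telescope]).
      By induction every morphism from [ud k] to [ud n] is an element of the image
      followed by cups, and the case [n = k] is the claim. *)

Set Implicit Arguments.
Unset Strict Implicit.
Unset Printing Implicit Defensive.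

Import GRing.Theory.
Local Open Scope ring_scope.

(** A bigon can be removed when its left strand points up and its right one down; in the opposite
    case this costs a cup over a cap. So sorting [ud n] into [P n] and back is the identity only up
    to terms that factor through [ud (n - 1)], whereas unsorting [P n] and sorting it again is the
    identity on the nose. This asymmetry makes sorted words the right intermediate objects and is
    where the generators [e_2j] come from. The main obstacle is that a diagram between words of
    length at most [2 * k] may pass through arbitrarily long words, on which no generator acts.
    Instead of a normal form for such diagrams, a subspace is closed under elementary moves: [low]
    is kept up to width [k] and is extended above it by whatever caps and Hecke elements generate
    ([family]); the coset decomposition then shows that a cup leading back down produces nothing
    new. Only spanning statements are used, never linear independence of diagrams. A dot is a right
    curl, so the term -1 in the Hecke relation and in the bubble slide has the same origin as the
    correction of the bigon. *)

Definition combo := seq (int * events).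

Definition neg_combo (L : combo) : combo := [seq (- cd.1, cd.2) | cd <- L].
Definition scale_combo (c : int) (L : combo) : combo := [seq (c * cd.1, cd.2) | cd <- L].
Definition frame_combo (p : events) (n : nat) (q : events) (L : combo) : combo :=
  [seq (cd.1, p ++ shift n cd.2 ++ q) | cd <- L].

Lemma shift_shift n m d : shift n (shift m d) = shift (n + m) d.
Proof. by rewrite /shift -map_comp; apply: eq_map => -[c i|i|i] /=; rewrite addnA. Qed.

Lemma shift_cat n d d' : shift n (d ++ d') = shift n d ++ shift n d'.
Proof. exact: map_cat. Qed.

(** * Linear combinations of diagrams and their equality in every disc *)

Section Calculus.
Variable K : fieldType.
Local Notation mor := (mor K).

Definition mc a b (L : combo) : Heis K a b := \sum_(cd <- L) cd.1%:~R *: mor a b cd.2.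

Lemma mc_cat a b L L' : mc a b (L ++ L') = mc a b L + mc a b L'.
Proof. by rewrite /mc big_cat. Qed.

Lemma mc_cons a b cd L : mc a b (cd :: L) = cd.1%:~R *: mor a b cd.2 + mc a b L.
Proof. by rewrite /mc big_cons. Qed.

Lemma mc_nil a b : mc a b [::] = 0.
Proof. by rewrite /mc big_nil. Qed.

Lemma mc1 a b d : mc a b [:: (1, d)] = mor a b d.
Proof. by rewrite mc_cons mc_nil addr0 scale1r. Qed.

Lemma mc_scale a b c L : mc a b (scale_combo c L) = c%:~R *: mc a b L.
Proof.
rewrite /mc big_map scaler_sumr; apply: eq_bigr => cd _ /=.
by rewrite intrM scalerA.
Qed.

Lemma mc_neg a b L : mc a b (neg_combo L) = - mc a b L.
Proof.
rewrite /mc big_map -sumrN; apply: eq_bigr => cd _ /=.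
by rewrite intrN scaleNr.
Qed.

(** Equality of two linear combinations in every disc with boundary word [w] at
    the top. *)
Definition eqv (w : word) (L R : combo) : Prop :=
  forall a b p q u t, run a p = Some (u ++ w ++ t) ->
    mc a b (frame_combo p (size u) q L) = mc a b (frame_combo p (size u) q R).

Lemma lproj_lincomb a b C (L : seq (K * events)) :
  lproj (@heis_rel K a b) (lincomb a b C L) = \sum_(cd <- L) cd.1 *: mor a b (C cd.2).
Proof.
rewrite /lincomb linear_sum; apply: eq_bigr => cd _ /=.
by rewrite linearZ mor.unlock.
Qed.

Lemma skein_eqv w (L R : combo) :
  skein w [seq (cd.1%:~R : K, cd.2) | cd <- L] [seq (cd.1%:~R : K, cd.2) | cd <- R] ->
  eqv w L R.
Proof.
move=> sk a b p q u t e.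
have /spanP/lproj_eq := spanned_gen (@HeisRel K a b p q u w t _ _ e sk).
by rewrite !lproj_lincomb /mc !big_map.
Qed.

Lemma eqv_refl w L : eqv w L L. Proof. by []. Qed.
Lemma eqv_sym w L R : eqv w L R -> eqv w R L.
Proof. by move=> h a b p q u t /h ->. Qed.
Lemma eqv_trans w L M R : eqv w L M -> eqv w M R -> eqv w L R.
Proof. by move=> h h' a b p q u t e; rewrite (h _ _ _ _ _ _ e) (h' _ _ _ _ _ _ e). Qed.

Lemma frame_combo_cat p n q L L' :
  frame_combo p n q (L ++ L') = frame_combo p n q L ++ frame_combo p n q L'.
Proof. exact: map_cat. Qed.

Lemma frame_combo_scale p n q c L :
  frame_combo p n q (scale_combo c L) = scale_combo c (frame_combo p n q L).
Proof. by rewrite /frame_combo /scale_combo -!map_comp. Qed.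

Lemma frame_combo_neg p n q L :
  frame_combo p n q (neg_combo L) = neg_combo (frame_combo p n q L).
Proof. by rewrite /frame_combo /neg_combo -!map_comp. Qed.

Lemma frame_frame p n q p' n' q' L :
  frame_combo p n q (frame_combo p' n' q' L) =
  frame_combo (p ++ shift n p') (n + n') (shift n q' ++ q) L.
Proof.
rewrite /frame_combo -map_comp; apply: eq_map => cd /=.
by rewrite !shift_cat shift_shift -!catA.
Qed.

Lemma eqv_cat w L R L' R' : eqv w L R -> eqv w L' R' -> eqv w (L ++ L') (R ++ R').
Proof. by move=> h h' a b p q u t e; rewrite !frame_combo_cat !mc_cat (h _ _ _ _ _ _ e) (h' _ _ _
  _ _ _ e). Qed.

Lemma eqv_scale w c L R : eqv w L R -> eqv w (scale_combo c L) (scale_combo c R).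
Proof. by move=> h a b p q u t e; rewrite !frame_combo_scale !mc_scale (h _ _ _ _ _ _ e). Qed.

Lemma eqv_frame w0 p q u w t L R : run w0 p = Some (u ++ w ++ t) ->
  eqv w L R -> eqv w0 (frame_combo p (size u) q L) (frame_combo p (size u) q R).
Proof.
move=> e h a b p' q' u' t' e'; rewrite !frame_frame -size_cat.
by apply: h (t ++ t') _; rewrite run_cat e' (run_frame _ _ e) -!catA.
Qed.

Lemma eqv_mc w v L R : eqv w L R -> mc w v L = mc w v R.
Proof.
have fr M : frame_combo [::] (size ([::] : word)) [::] M = M.
  rewrite /frame_combo -[RHS]map_id; apply: eq_map => -[c d] /=.
  by rewrite shift0 cats0.
move=> /(_ w v [::] [::] [::] [::]); rewrite /= cats0 !fr; exact.
Qed.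

(** * Checking skein computations *)

(** A word, a diagram below it and the combination that may replace it. *)
Definition rule : Type := (word * events * combo)%type.

Definition sound (r : rule) : Prop := eqv r.1.1 [:: (1, r.1.2)] r.2.

Definition event_pos (s : event) : nat :=
  match s with Max _ i | Min i | Cross i => i end.
Definition event_in (s : event) : nat := if s is Max _ _ then 0%N else 2.
Definition move_event (i : nat) (s : event) : event :=
  match s with Max c _ => Max c i | Min _ => Min i | Cross _ => Cross i end.

(** [use r n i d] applies [r] to the events of [d] from the [n]-th on, on the
    strands from the [i]-th on. *)
Definition use (w : word) (r : rule) (n i : nat) (d : events) : option combo :=
  let: (l, D, R) := r in
  if run w (take n d) is Some v then
    let e := drop n d in
    if [&& (i <= size v)%N, take (size l) (drop i v) == l &
        take (size D) e == shift i D]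
    then Some (frame_combo (take n d) i (drop (size D) e) R) else None
  else None.

(** The word is cut just after the strands that [s] consumes. If [s'] lies beyond what [s] leaves of
    the left piece, the two events are an instance of [iso_exchange]. *)
Definition exchange_right (w : word) (s s' : event) : option events :=
  let m := (event_pos s + event_in s)%N in
  let w1 := take m w in let w2 := drop m w in
  if run w1 [:: s] is Some v then
    if (size v <= event_pos s')%N then
      let s2 := move_event (event_pos s' - size v) s' in
      if run w2 [:: s2] is Some _
      then Some [:: move_event (size w1 + (event_pos s' - size v)) s'; s] else None
    else None
  else None.

Definition exchange_left (w : word) (s s' : event) : option events :=
  let m := (event_pos s' + event_in s')%N in
  let w1 := take m w in let w2 := drop m w in
  if run w1 [:: s'] is Some v then
    if (size w1 <= event_pos s)%N then
      let s1 := move_event (event_pos s - size w1) s in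
      if run w2 [:: s1] is Some _
      then Some [:: s'; move_event (size v + (event_pos s - size w1)) s] else None
    else None
  else None.

Definition exchange (ex : word -> event -> event -> option events) (w : word)
    (n : nat) (d : events) : option combo :=
  if run w (take n d) is Some v then
    if drop n d is s :: s' :: q then
      if ex v s s' is Some e then Some [:: (1, take n d ++ e ++ q)] else None
    else None
  else None.

Fixpoint first_some (T : Type) (s : seq (option T)) : option T :=
  if s is x :: s' then (if x is Some _ then x else first_some s') else None.

(** [At n] applies at the [n]-th event the first rule of the table that fits,
    or else exchanges it with the next one; [Left n] exchanges them so that the
    upper one passes to the left; [Use] applies a given rule; [Skip] sets the
    first term aside; [Split] adds and subtracts a diagram. *)
Inductive instr :=
  At of nat | Left of nat | Use of rule & nat & nat | Skip | Split of int & events.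

Definition at_pos (r : rule) (n : nat) (d : events) : nat :=
  (event_pos (head (Min 0) (drop n d)) - event_pos (head (Min 0) r.1.2))%N.

Definition exec1 (tbl : seq rule) (w : word) (s : instr) (d : events) : option combo :=
  match s with
  | At n => first_some ([seq use w r n (at_pos r n d) d | r <- tbl & r.1.2 != [::]] ++
              [:: exchange exchange_right w n d; exchange exchange_left w n d])
  | Left n => exchange exchange_left w n d
  | Use r n i => if r \in tbl then use w r n i d else None
  | _ => None
  end.

Fixpoint exec (tbl : seq rule) (w : word) (P : seq instr) (todo done : combo) :
    option combo :=
  match P, todo with
  | [::], _ => Some (todo ++ done)
  | Split c d :: P', _ => exec tbl w P' [:: (c, d), (- c, d) & todo] done
  | Skip :: P', cd :: todo' => exec tbl w P' todo' (cd :: done)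
  | s :: P', (c, d) :: todo' =>
      if exec1 tbl w s d is Some L then exec tbl w P' (scale_combo c L ++ todo') done
      else None
  | _, [::] => None
  end.

Fixpoint add_term (c : int) (d : events) (L : combo) : combo :=
  if L is (c', d') :: L' then
    (if d' == d then (c + c', d) :: L' else (c', d') :: add_term c d L')
  else [:: (c, d)].
Definition collect (L : combo) : combo := foldr (fun cd => add_term cd.1 cd.2) [::] L.
Definition null (L : combo) : bool := all (fun cd => cd.1 == 0) (collect L).

(** Moving [R] to the left lets one certificate rewrite both sides until everything cancels, so
    moves on the right side need not be inverted. *)
Definition check (tbl : seq rule) (w : word) (P : seq instr) (L R : combo) : bool :=
  if exec tbl w P (L ++ neg_combo R) [::] is Some M then null M else false.

Lemma frame_null a b p n q L : null L -> mc a b (frame_combo p n q L) = 0.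
Proof.
have fa c d M : mc a b (frame_combo p n q (add_term c d M)) =
    c%:~R *: mor a b (p ++ shift n d ++ q) + mc a b (frame_combo p n q M).
  elim: M => [|[c' d'] M IH] /=; first by rewrite mc_cons.
  case: eqP => [->|_]; rewrite !mc_cons /=; first by rewrite intrD scalerDl addrA.
  by rewrite IH addrCA.
have fc M : mc a b (frame_combo p n q (collect M)) = mc a b (frame_combo p n q M).
  by elim: M => //= -[c d] M IH; rewrite fa IH mc_cons.
rewrite -fc /null => /allP h; rewrite /mc big_map big_seq big1 // => cd /h /eqP ->.
by rewrite scale0r.
Qed.

Lemma eqv_isotopic w d d' : isotopic w d d' -> eqv w [:: (1, d)] [:: (1, d')].
Proof. by move=> h; apply: skein_eqv; rewrite /=; apply: skein_isotopy. Qed.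

Lemma use_sound w r n i d L : sound r -> use w r n i d = Some L -> eqv w [:: (1, d)] L.
Proof.
case: r => [[l D] R] s; rewrite /use; case E : (run w (take n d)) => [v|] //.
case: and3P => // -[le /eqP e1 /eqP e2] [<-].
have sz : size (take i v) = i by rewrite size_takel.
have ev : run w (take n d) = Some (take i v ++ l ++ drop (size l) (drop i v)).
  rewrite E; congr Some; rewrite -[LHS](cat_take_drop i); congr (_ ++ _).
  by rewrite -[LHS](cat_take_drop (size l)) e1.
have := eqv_frame (drop (size D) (drop n d)) ev s.
by rewrite sz /frame_combo /= -e2 !cat_take_drop.
Qed.

Lemma run1 w s v : run w [:: s] = Some v -> step w s = Some v.
Proof. by rewrite /=; case: (step w s) => // x [->]. Qed.

Lemma shift_move n i s : (n <= event_pos s)%N -> i = (event_pos s - n)%N ->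
  shift n [:: move_event i s] = [:: s].
Proof. by case: s => [c j|j|j] /= le ->; rewrite subnKC. Qed.

Lemma shift_move' n i s : shift n [:: move_event i s] = [:: move_event (n + i) s].
Proof. by case: s. Qed.

Lemma exchange_right_sound w s s' e :
  exchange_right w s s' = Some e -> eqv w [:: (1, [:: s; s'])] [:: (1, e)].
Proof.
rewrite /exchange_right; set m := (_ + _)%N.
case E1 : (run _ _) => [v|] //; case: leqP => // le.
case E2 : (run _ _) => [v'|] // [<-].
have := eqv_isotopic (iso_exchange E1 E2); rewrite cat_take_drop.
by rewrite shift_move // shift_move'.
Qed.

Lemma exchange_left_sound w s s' e :
  exchange_left w s s' = Some e -> eqv w [:: (1, [:: s; s'])] [:: (1, e)].
Proof.
rewrite /exchange_left; set m := (_ + _)%N.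
case E1 : (run _ _) => [v|] //; case: leqP => // le.
case E2 : (run _ _) => [v'|] // [<-].
have := eqv_isotopic (iso_exchange E1 E2); rewrite cat_take_drop.
by rewrite shift_move' shift_move // => /eqv_sym.
Qed.

Lemma exchange_sound ex w n d L :
  (forall w s s' e, ex w s s' = Some e -> eqv w [:: (1, [:: s; s'])] [:: (1, e)]) ->
  exchange ex w n d = Some L -> eqv w [:: (1, d)] L.
Proof.
move=> h; rewrite /exchange; case E : (run w (take n d)) => [v|] //.
case D : (drop n d) => [|s [|s' q]] //; case X : (ex v s s') => [e|] // [<-].
have ev : run w (take n d) = Some ([::] ++ v ++ [::]) by rewrite cats0.
have := eqv_frame q ev (h _ _ _ _ X).
rewrite /frame_combo /=; have -> : take n d ++ shift 0 [:: s; s'] ++ q = d.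
  by rewrite shift0 -[RHS](cat_take_drop n) D.
by rewrite shift0.
Qed.

Lemma first_someP (T : Type) (P : T -> Prop) (s : seq (option T)) x :
  foldr (fun o Q => (forall y, o = Some y -> P y) /\ Q) True s -> first_some s = Some x -> P x.
Proof. by elim: s => //= -[y|] s IH [h1 h2]; [move=> e; apply: h1 | apply: IH]. Qed.

Section Soundness.
Variable tbl : seq rule.
Hypothesis tblP : forall r, r \in tbl -> sound r.

Lemma exec1_sound w s d L : exec1 tbl w s d = Some L -> eqv w [:: (1, d)] L.
Proof.
case: s => [n|n|r n i||c e] //=.
- apply: first_someP; rewrite foldr_cat /=.
  set Q := (_ /\ _); have : Q.
    by split; [|split=> //] => M; apply: exchange_sound;
      [apply: exchange_right_sound|apply: exchange_left_sound].
  elim: (tbl) tblP => [|r s IH] hs hQ //=; case: eqP => _ /=.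
    by apply: IH => // r' h; apply: hs; rewrite inE h orbT.
  split; last by apply: IH => // r' h; apply: hs; rewrite inE h orbT.
  by move=> M; apply: use_sound; apply: hs; rewrite inE eqxx.
- by apply: exchange_sound; apply: exchange_left_sound.
- by case: ifP => // h; apply: use_sound; apply: tblP.
Qed.

Lemma exec_sound w P todo done L : exec tbl w P todo done = Some L -> eqv w (todo ++ done) L.
Proof.
elim: P todo done => [|s P IH] todo done /=; first by case=> <-.
have ex1 c d todo' : (if exec1 tbl w s d is Some M
    then exec tbl w P (scale_combo c M ++ todo') done else None) = Some L ->
    eqv w (((c, d) :: todo') ++ done) L.
  case X : (exec1 tbl w s d) => [M|] // /IH; apply: eqv_trans.
  apply: eqv_cat => //; rewrite -cat1s; apply: eqv_cat => //.
  by have /(eqv_scale c) := exec1_sound X; rewrite /= mulr1.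
case: s ex1 => [n|n|r n i||c e] ex1; try by case: todo => [|[c d] todo] //; apply: ex1.
  case: todo => [|cd todo] // /IH; apply: eqv_trans.
  move=> a b p q u t _.
  by rewrite /frame_combo /= !map_cat /= mc_cons !mc_cat mc_cons addrCA.
move=> /IH; apply: eqv_trans => a b p q u t _; rewrite /frame_combo /= !mc_cons /=.
by rewrite addrA -scalerDl intrN subrr scale0r add0r.
Qed.

Lemma check_sound w P L R : check tbl w P L R -> eqv w L R.
Proof.
rewrite /check; case X : (exec _ _ _ _ _) => [M|] // n a b p q u t e.
have := exec_sound X; rewrite cats0 => /(_ a b p q u t e).
rewrite (frame_null _ _ _ _ _ n) frame_combo_cat mc_cat frame_combo_neg mc_neg => /eqP.
by rewrite subr_eq0 => /eqP.
Qed.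

End Soundness.
End Calculus.

(** * Rules for the checker *)

Definition mono (w : word) (d d' : events) : rule := (w, d, [:: (1, d')]).

Definition zig_l c := mono [:: c] [:: Max c 0; Min 1] [::].
Definition zig_r c := mono [:: c] [:: Max (~~ c) 1; Min 0] [::].
Definition zag_l c := mono [:: c] [::] [:: Max c 0; Min 1].
Definition zag_r c := mono [:: c] [::] [:: Max (~~ c) 1; Min 0].
Definition max_left c x := mono [:: x] [:: Max c 1; Cross 0] [:: Max c 0; Cross 1].
Definition max_right c x := mono [:: x] [:: Max c 0; Cross 1] [:: Max c 1; Cross 0].
Definition min_left c x := mono [:: c; x; ~~ c] [:: Cross 0; Min 1] [:: Cross 1; Min 0].
Definition min_right c x := mono [:: c; x; ~~ c] [:: Cross 1; Min 0] [:: Cross 0; Min 1].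
Definition triple x y z :=
  mono [:: x; y; z] [:: Cross 0; Cross 1; Cross 0] [:: Cross 1; Cross 0; Cross 1].
Definition triple' x y z :=
  mono [:: x; y; z] [:: Cross 1; Cross 0; Cross 1] [:: Cross 0; Cross 1; Cross 0].
(** Only a downward strand on the left of an upward one has a correction term. The case of two
    downward strands is not a defining relation and is derived in [bigon_down]. *)
Definition bigon x y : rule :=
  ([:: x; y], [:: Cross 0; Cross 0],
   if ~~ x && y then [:: (1, [::]); (-1, [:: Min 0; Max Down 0])] else [:: (1, [::])]).
Definition bigon' x y : rule :=
  ([:: x; y], [::],
   if ~~ x && y then [:: (1, [:: Cross 0; Cross 0]); (1, [:: Min 0; Max Down 0])]
   else [:: (1, [:: Cross 0; Cross 0])]).
Definition left_curl : rule := ([:: Up], [:: Max Down 0; Cross 1; Min 0], [::]).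
Definition circle := mono [::] [:: Max Down 0; Min 0] [::].
Definition max_curl : rule := ([::], [:: Max Down 0; Cross 0], [::]).
Definition min_curl : rule := ([:: Up; Down], [:: Cross 0; Min 0], [::]).

Definition bools := [:: true; false].
Definition isotopies : seq rule :=
  [seq f c | f <- [:: zig_l; zig_r; zag_l; zag_r], c <- bools] ++
  flatten [seq [seq f c x | c <- bools, x <- bools] |
           f <- [:: max_left; max_right; min_left; min_right]] ++
  flatten [seq flatten [seq [seq f x y z | y <- bools, z <- bools] | x <- bools] |
           f <- [:: triple; triple']].
(** These come directly from [skein], possibly read backwards; derived rules are added in
    [all_moves] once the checker has proved them from these. *)
Definition moves : seq rule :=
  [:: bigon Up Up; bigon Up Down; bigon Down Up; bigon' Up Up; bigon' Up Down;
      left_curl; circle] ++ isotopies.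

Section Moves.
Variable K : fieldType.
Local Notation sound := (sound K).

Lemma sound_isotopic w d d' : isotopic w d d' ->
  sound (mono w d d') /\ sound (mono w d' d).
Proof. by move=> /(eqv_isotopic K) h; split=> //; apply: eqv_sym. Qed.

Lemma moves_sound r : r \in moves -> sound r.
Proof.
have zl c := sound_isotopic (iso_zigzag_l c).
have zr c := sound_isotopic (iso_zigzag_r c).
have mx c x := sound_isotopic (iso_max_cross c x).
have mn c x := sound_isotopic (iso_min_cross c x).
have tr x y z : sound (triple x y z) by apply: skein_eqv; apply: skein_triple.
have tr' x y z : sound (triple' x y z) by apply: eqv_sym; apply: tr.
have uu : sound (bigon Up Up) by apply: skein_eqv; apply: skein_up_up.
have ud : sound (bigon Up Down) by apply: skein_eqv; apply: skein_up_down.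
have all_in (T : eqType) (s : seq T) (P : T -> Prop) :
    foldr (fun x Q => P x /\ Q) True s -> forall x, x \in s -> P x.
  elim: s => //= y s IH [Py /IH h] x; rewrite inE => /orP[/eqP->|] //; exact: h.
have du : sound (bigon Down Up).
  by apply: skein_eqv; rewrite /= mulrN1z; apply: skein_down_up.
have lc : sound left_curl by apply: skein_eqv; apply: skein_left_curl.
have ci : sound circle by apply: skein_eqv; apply: skein_circle.
have uu' : sound (bigon' Up Up) by apply: eqv_sym; apply: uu.
have ud' : sound (bigon' Up Down) by apply: eqv_sym; apply: ud.
apply: all_in; do ?[apply: conj; first by [exact: uu | exact: ud | exact: du
  | exact: uu' | exact: ud' | exact: lc | exact: ci | exact: tr | exact: tr'
  | exact: (zl _).1 | exact: (zl _).2 | exact: (zr _).1 | exact: (zr _).2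
  | exact: (mx _ _).1 | exact: (mx _ _).2 | exact: (mn _ _).1 | exact: (mn _ _).2]].
exact: I.
Qed.

(** Rotation by a half turn: zigzags are inserted on both strands, the two crossings are pushed
    through the bends onto the upward parts, the upward bigon is removed there and the zigzags are
    straightened. *)
Lemma bigon_down : sound (bigon Down Down).
Proof.
apply: (@check_sound K _ moves_sound _
  [:: Use (zag_r Down) 2 1; Use (zag_r Down) 4 0; At 3; At 1; At 2; At 3; At 4; At 3;
      At 0; At 1; At 2; At 3; At 4; At 3; At 2; At 1; At 0; At 0]).
by vm_compute.
Qed.

(** A zigzag inserted on the left leg turns the crossed cap into a cap followed by a left curl,
    which is zero. *)
Lemma max_curl_sound : sound max_curl.
Proof.
apply: (@check_sound K _ moves_sound _ [:: Use (zag_r Down) 1 0; At 2; At 1; At 0; At 1]).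
by vm_compute.
Qed.

Lemma min_curl_sound : sound min_curl.
Proof.
apply: (@check_sound K _ moves_sound _ [:: Use (zag_l Down) 0 1; Left 1; At 0; Left 2; At 0]).
by vm_compute.
Qed.

Definition all_moves : seq rule :=
  [:: bigon Down Down; bigon' Down Down; bigon' Down Up; max_curl; min_curl] ++ moves.

Lemma all_moves_sound r : r \in all_moves -> sound r.
Proof.
rewrite mem_cat => /orP[|/moves_sound //]; rewrite !inE.
case/or4P=> [/eqP->|/eqP->|/eqP->|/orP[/eqP->|/eqP->]].
- exact: bigon_down.
- exact/eqv_sym/bigon_down.
- apply: (@check_sound K _ moves_sound _ [:: Skip; At 0]); by vm_compute.
- exact: max_curl_sound.
- exact: min_curl_sound.
Qed.

Definition skein_check := check_sound all_moves_sound.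
End Moves.

(** Free of [k]: in every [ud k], strand [j] counted from 1 points up exactly when [j] is odd. *)
Definition gen_diag (g : aff_gen) : events :=
  match g with
  | g_tau i => tau_diag i
  | g_e j => [:: Min j.-1; Max (odd j) j.-1]
  | g_x r => dot (odd r) r.-1
  | g_z l => z_diag l
  end.

Definition combo_mul (L M : combo) : combo := [seq (x.1 * y.1, x.2 ++ y.2) | x <- L, y <- M].

Fixpoint expr_combo (s : aff_expr) : combo :=
  match s with
  | Gen g => [:: (1, gen_diag g)]
  | Zero => [::]
  | One => [:: (1, [::])]
  | Add s t => expr_combo s ++ expr_combo t
  | Defs.Sub s t => expr_combo s ++ neg_combo (expr_combo t)
  | Mul s t => combo_mul (expr_combo s) (expr_combo t)
  end.

(** * The relations of the algebra on at most three pairs of strands *)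

Section LocalRelations.
Variable K : fieldType.
Local Notation tau i := (Gen (g_tau i)).
Local Notation e i := (Gen (g_e i)).
Local Notation x i := (Gen (g_x i)).
Local Open Scope aff_scope.

Definition local_rel (m : nat) (s t : aff_expr) : Prop :=
  eqv K (ud m) (expr_combo s) (expr_combo t).

Ltac skein P := apply: (@skein_check K _ P); vm_compute.

Lemma tau_even_sq : local_rel 2 (tau 2 * tau 2) (1 - e 2).
Proof.
by skein [:: At 2; At 1; At 0; Skip; At 1; At 0; At 1; At 2; Left 0; Skip; Skip; Left 0; Skip].
Qed.

Lemma tau_odd_sq : local_rel 2 (tau 3 * tau 3) (1 - e 2).
Proof.
by skein [:: At 2; At 1; At 0; Skip; Left 0; Skip; Skip; Left 0; Skip].
Qed.

Lemma tau_tau_comm : local_rel 2 (tau 3 * tau 2) (tau 2 * tau 3).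
Proof.
by skein [:: At 2; At 4; At 1; Skip; At 0; At 2; Skip].
Qed.

Lemma e_even_idem : local_rel 2 (e 2 * e 2) (e 2).
Proof.
by skein [:: At 1; Left 0; Skip; Left 0; Skip].
Qed.

(** The cup of [e 2] closes the last crossing of [tau 3] to a curl. The next three products vanish
    for the same kind of reason. *)
Lemma tau_odd_e : local_rel 2 (tau 3 * e 2) (0).
Proof.
by skein [:: At 2].
Qed.

Lemma e_tau_odd : local_rel 2 (e 2 * tau 3) (0).
Proof.
by skein [:: At 1].
Qed.

Lemma tau_even_e : local_rel 2 (tau 2 * e 2) (0).
Proof.
by skein [:: At 0; At 2].
Qed.

Lemma e_tau_even : local_rel 2 (e 2 * tau 2) (0).
Proof.
by skein [:: At 1; At 2; At 1].
Qed.

Lemma tau_e_e : local_rel 2 (tau 2 * e 1 * e 3) (tau 3 * e 1 * e 3).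
Proof.
by skein [:: At 0; At 2; At 1; At 1; At 0; Left 3; At 2; At 1; At 0; Skip; At 4; At 3; At 2; At
1; Left 2; At 1; At 0; Left 3; At 2; At 1; At 0; Skip].
Qed.

Lemma e_e_tau : local_rel 2 (e 3 * e 1 * tau 2) (e 3 * e 1 * tau 3).
Proof.
by skein [:: At 4; At 3; At 4; Left 0; At 1; At 0; Left 0; At 2; At 1; At 3; At 2; Skip; At 1;
At 2; At 3; At 4; At 0; Left 1; Left 0; At 2; At 1; At 3; At 2; Skip].
Qed.

Lemma e121 : local_rel 2 (e 1 * e 2 * e 1) (e 1).
Proof.
by skein [:: At 1; At 1; Left 0; Skip; Left 0; Skip].
Qed.

Lemma e212 : local_rel 2 (e 2 * e 1 * e 2) (e 2).
Proof.
by skein [:: At 1; At 1; Left 0; Skip; Left 0; Skip].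
Qed.

Lemma e232 : local_rel 2 (e 2 * e 3 * e 2) (e 2).
Proof.
by skein [:: At 1; At 1; Left 0; Skip; Left 0; Skip].
Qed.

Lemma e323 : local_rel 2 (e 3 * e 2 * e 3) (e 3).
Proof.
by skein [:: At 1; At 1; Left 0; Skip; Left 0; Skip].
Qed.

Lemma tau_e_tau_odd : local_rel 2 (tau 2 * e 1 * tau 2) (tau 3 * e 3 * tau 3).
Proof.
by skein [:: At 0; At 2; At 1; At 3; At 2; At 3; Left 1; At 0; At 2; At 1; Skip; At 2; At 1; At
2; At 3; Left 1; At 0; At 2; At 1; Skip].
Qed.

Lemma tau_e_tau_even : local_rel 3 (tau 4 * e 2 * tau 4) (tau 3 * e 4 * tau 3).
Proof.
by skein [:: At 0; At 2; At 3; At 4; At 6; At 1; At 0; At 1; At 2; At 1; At 0; At 3; At 2; At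
4; Skip; At 2; At 3; At 4; Left 2; At 3; At 2; At 1; At 4; At 3; At 2; At 1; At 0; Skip].
Qed.

Lemma tau424 : local_rel 3 (tau 2 * tau 4 * tau 2) (tau 4 * tau 2 * tau 4 * (1 - e 2)).
Proof.
by skein [:: At 2; At 3; At 4; At 5; Skip; At 6; At 7; At 4; At 3; At 2; At 1; At 0; At 1; At
0; At 3; Skip; At 0; At 2; At 3; At 4; At 5; At 7; At 1; At 0; At 4; At 2; At 1; At 5; At 4; At
2; Skip; At 0; At 2; At 3; At 4; At 5; At 7; At 2; At 6; At 5; At 4; At 3; At 2; At 1; At 3;
Skip].
Qed.

Lemma tau535 : local_rel 3 (tau 5 * tau 3 * tau 5) (tau 3 * tau 5 * tau 3 * (1 - e 4)).
Proof.
by skein [:: At 0; At 2; At 3; At 4; At 5; At 7; At 1; At 0; At 4; At 2; At 1; At 5; At 4; At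
2; Skip; At 6; At 5; At 4; At 3; At 2; At 1; At 0; At 0; At 3; Skip; At 2; At 3; At 4; At 5;
Skip; At 2; At 3; At 4; At 5; At 6; At 5; At 4; At 3; At 2; At 1; At 3; Skip].
Qed.

Lemma tau343 : local_rel 3 (tau 3 * tau 4 * tau 3) (tau 4 - e 2 * tau 4 - tau 4 * e 2).
Proof.
by skein [:: At 0; At 2; At 3; At 5; At 1; At 2; Skip; At 1; At 2; At 2; At 1; At 2; At 0; At
3; At 2; At 1; At 0; Skip; At 1; At 0; At 1; At 2; At 1; At 0; At 2; At 3; At 2; Left 1; At 0;
Skip; Skip; Left 0; At 2; At 1; Skip; At 2; At 1; At 2; At 0; At 3; At 2; At 1; At 0; Skip].
Qed.

Lemma tau434 : local_rel 3 (tau 4 * tau 3 * tau 4) (tau 3 - e 4 * tau 3 - tau 3 * e 4).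
Proof.
by skein [:: At 2; At 4; At 3; At 1; At 2; At 0; Skip; At 4; At 5; At 1; At 2; At 0; At 3; At
2; At 1; At 0; Skip; At 3; At 2; At 1; At 0; At 0; At 1; At 2; At 3; Skip; Skip; Left 0; At 1;
At 2; At 3; At 1; At 0; At 1; At 0; Skip; At 3; At 2; At 1; At 0; Skip].
Qed.

Lemma x3_even : local_rel 2 (x 3) (tau 2 * x 1 * tau 2 + e 2 * e 1 * tau 2 + tau 2 * e 1 * e 2 -
  tau 2).
Proof.
(* The diagram that is added and subtracted carries, between two outer crossings, a dot and a
   removable bigon of upward strands; its two copies are then rewritten separately. *)
by skein [:: At 0; Skip; At 0; At 2; At 3; At 4; At 5; At 7; Split (1) [:: Cross 1; Max Up 2;
Cross 1; Min 2; Cross 0; Cross 0; Cross 1]; At 1; At 3; At 2; At 1; Use (bigon' Up Up) 2 2; At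
3; At 5; At 4; At 1; At 2; Skip; At 5; At 3; At 2; At 1; At 0; Skip; At 4; At 1; At 0; Use
(bigon' Down Down) 1 2; At 2; At 4; At 3; At 0; At 1; At 2; At 3; Skip; At 2; At 1; At 0; Left
1; At 0; Skip; At 4; At 2; At 1; At 1; Skip; Skip; At 1; At 2; At 1; At 2; Left 0; At 1; Skip;
At 4; At 0; At 2; At 1; Left 1; At 0; Skip; Skip].
Qed.

Lemma x4_odd : local_rel 2 (x 4) (tau 3 * x 2 * tau 3 + e 2 * e 3 * tau 3 * e 3 * e 2 + tau 3).
Proof.
by skein [:: At 1; Skip; At 0; At 2; At 3; At 4; At 5; At 7; At 1; At 4; At 2; At 1; At 2; At
4; At 3; At 0; At 3; At 1; At 0; At 1; At 3; At 2; At 1; Skip; At 4; At 2; At 1; At 0; Skip; At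
6; At 5; At 4; At 3; At 2; At 1; At 0; Left 0; At 2; At 1; At 3; At 2; At 1; At 0; Skip; At 1;
At 6; At 1; At 2; Left 0; At 1; At 3; At 2; At 1; At 0; Skip; Skip].
Qed.

Lemma x2_even : local_rel 2 (x 2) (tau 2 * x 2 * tau 2 + e 2 * e 1 * tau 2 + tau 2 * e 1 * e 2).
Proof.
by skein [:: At 1; Skip; At 0; At 2; At 6; At 5; At 3; At 2; At 3; At 5; At 4; At 1; At 2; At
3; At 4; At 1; At 0; Use (bigon' Up Up) 1 2; At 2; At 4; At 3; At 0; At 1; At 2; At 3; At 0; At
1; Skip; At 2; At 1; At 0; Left 1; At 0; Skip; At 4; At 2; At 1; At 0; Left 0; At 1; Skip; At
1; At 2; At 1; At 2; Left 0; At 1; Skip; At 4; At 0; At 2; At 1; Left 1; At 0; Skip].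
Qed.

Lemma x3_odd : local_rel 2 (x 3) (tau 3 * x 3 * tau 3 + e 2 * e 3 * tau 3 + tau 3 * e 3 * e 2).
Proof.
by skein [:: At 0; Skip; At 2; At 5; At 3; At 2; At 3; At 5; At 4; At 1; At 2; At 3; At 4; At
1; At 0; Use (bigon' Down Down) 1 2; At 2; At 4; At 3; At 0; At 1; At 2; At 3; Skip; At 2; At
1; At 0; Left 1; At 0; Skip; At 4; At 2; At 1; At 1; Skip; At 1; At 1; At 2; Left 0; At 1;
Skip; At 4; At 2; At 1; Left 1; At 0; Skip].
Qed.

Lemma e1_x : local_rel 1 (e 1 * (x 1 - x 2)) (0).
Proof.
by skein [:: Left 0; At 1; At 2; At 1; At 3; Skip; Left 0; At 1; At 2; At 1; At 0; At 3; Skip].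
Qed.

Lemma x_e1 : local_rel 1 ((x 1 - x 2) * e 1) (0).
Proof.
by skein [:: At 0; Left 3; At 2; At 1; Skip; At 1; At 2; At 1; At 0; Left 3; At 2; At 1; Skip].
Qed.

Lemma e2_x : local_rel 2 (e 2 * (x 2 - x 3)) (0).
Proof.
by skein [:: At 1; At 2; At 3; At 2; Left 0; At 1; Skip; At 1; At 2; At 3; At 2; Left 0; At 1;
Skip].
Qed.

Lemma x_e2 : local_rel 2 ((x 2 - x 3) * e 2) (0).
Proof.
by skein [:: At 0; At 2; At 1; At 0; Left 1; At 0; Skip; At 0; At 2; At 1; At 0; Left 1; At 0;
Skip].
Qed.

Lemma braid : local_rel 3 ((tau 2 * tau 3 + e 2) * (tau 4 * tau 5 + e 4) * (tau 2 * tau 3 + e 2))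
  ((tau 4 * tau 5 + e 4) * (tau 2 * tau 3 + e 2) * (tau 4 * tau 5 + e 4)).
Proof.
by skein [:: At 0; At 2; At 4; At 6; At 8; At 10; At 7; At 6; At 8; At 7; Skip; At 0; At 2; At
4; At 6; At 3; At 7; At 6; At 5; At 4; At 3; At 2; At 4; At 3; At 2; Skip; At 0; At 2; At 6; At
8; At 3; At 4; At 5; At 1; At 2; At 3; At 4; Left 2; At 3; At 2; At 1; At 4; At 3; At 2; At 1;
At 0; Skip; At 0; At 2; At 3; At 4; At 5; At 2; At 4; At 6; At 8; At 1; At 2; At 3; At 4; At 5;
At 2; At 3; At 4; At 5; At 0; At 1; At 2; Skip; At 2; At 4; At 1; At 2; At 3; At 4; At 5; At 4;
At 6; At 1; At 2; At 3; At 1; At 2; At 3; Left 1; Left 0; At 2; At 1; Skip; At 0; At 2; At 4;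
At 6; At 8; At 10; At 3; At 2; At 4; At 3; At 7; At 5; At 4; At 3; At 1; At 0; At 7; At 6; At
5; At 3; At 2; At 1; At 9; At 8; At 6; At 5; At 4; At 2; At 10; At 8; At 7; At 6; At 4; At 3;
Skip; At 0; At 2; At 4; At 6; At 3; At 4; At 7; At 6; At 5; At 1; At 4; At 3; At 2; At 4; At 3;
At 2; Skip; At 0; At 2; At 6; At 8; At 3; At 4; At 5; At 2; At 3; At 4; At 5; At 1; At 0; At 1;
At 2; At 1; At 0; At 3; At 2; At 4; Skip; At 0; At 2; At 3; At 4; At 5; At 2; At 4; At 6; At 8;
At 1; At 2; At 3; At 4; At 5; At 3; At 4; At 0; At 1; At 2; Skip; At 2; At 4; At 1; At 2; At 3;
At 4; At 5; At 4; At 6; At 1; At 2; At 3; At 1; At 2; At 3; At 0; Left 1; Left 0; Left 2; Left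
1; At 0; Skip].
Qed.

End LocalRelations.

(** * Replacing diagrams in context, and subspaces of morphisms *)

Section Tools.
Variable K : fieldType.
Local Notation Heis := (Heis K).
Local Notation mor := (mor K).
Local Notation eqv := (eqv K).
Local Notation comp := (@Defs.comp K _ _ _).

Definition sim (w : word) (d d' : events) : Prop := eqv w [:: (1, d)] [:: (1, d')].

Lemma sim_refl w d : sim w d d. Proof. exact: eqv_refl. Qed.
Lemma sim_sym w d d' : sim w d d' -> sim w d' d. Proof. exact: eqv_sym. Qed.
Lemma sim_trans w d1 d2 d3 : sim w d1 d2 -> sim w d2 d3 -> sim w d1 d3.
Proof. exact: eqv_trans. Qed.

Lemma sim_frame w0 p q u w t d d' : run w0 p = Some (u ++ w ++ t) -> sim w d d' ->
  sim w0 (p ++ shift (size u) d ++ q) (p ++ shift (size u) d' ++ q).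
Proof. by move=> e s; apply: (eqv_frame q e s). Qed.

Lemma sim_in w0 p q w d d' : run w0 p = Some w -> sim w d d' ->
  sim w0 (p ++ d ++ q) (p ++ d' ++ q).
Proof.
move=> e s; have e' : run w0 p = Some ([::] ++ w ++ [::]) by rewrite cats0.
by have := sim_frame q e' s; rewrite /= !shift0.
Qed.

Lemma sim_catr w d d' q : sim w d d' -> sim w (d ++ q) (d' ++ q).
Proof. by move=> s; apply: (@sim_in _ [::]). Qed.

Lemma sim_catl w w' p d d' : run w p = Some w' -> sim w' d d' -> sim w (p ++ d) (p ++ d').
Proof. by move=> e s; have := sim_in [::] e s; rewrite !cats0. Qed.

Lemma sim_widen u w t d d' : sim w d d' ->
  sim (u ++ w ++ t) (shift (size u) d) (shift (size u) d').
Proof.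
move=> s; have e : run (u ++ w ++ t) [::] = Some (u ++ w ++ t) by [].
by have := sim_frame [::] e s; rewrite /= !cats0.
Qed.

Lemma sim_widenr w t d d' : sim w d d' -> sim (w ++ t) d d'.
Proof. by move/(@sim_widen [::] _ t); rewrite /= !shift0. Qed.

Lemma sim_mor w v d d' : sim w d d' -> mor w v d = mor w v d'.
Proof. by move/(eqv_mc v); rewrite !mc1. Qed.

Lemma sim_exchange w1 m w2 d1 d2 v1 v2 : run w1 d1 = Some v1 -> run w2 d2 = Some v2 ->
  sim (w1 ++ m ++ w2) (d1 ++ shift (size v1 + size m) d2) (shift (size w1 + size m) d2 ++ d1).
Proof.
move=> e1 e2; have := eqv_isotopic K (iso_exchange e1 (run_frame1 m e2)).
by rewrite !shift_shift.
Qed.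

Lemma sim_exchange0 w1 w2 d1 d2 v1 v2 : run w1 d1 = Some v1 -> run w2 d2 = Some v2 ->
  sim (w1 ++ w2) (d1 ++ shift (size v1) d2) (shift (size w1) d2 ++ d1).
Proof. by move=> e1 e2; have := @sim_exchange w1 [::] w2 _ _ _ _ e1 e2; rewrite !addn0. Qed.

Lemma eqv_mor a b p q u w t (L R : combo) : eqv w L R -> run a p = Some (u ++ w ++ t) ->
  mc K a b (frame_combo p (size u) q L) = mc K a b (frame_combo p (size u) q R).
Proof. by move=> h e; apply: h e. Qed.

(** [ctx p q t f] puts strands [t] on the right of [f], [p] above and [q] below. *)
Definition ctx a b (p q : events) (t : word) w v (f : Heis w v) : Heis a b :=
  comp (mor a (w ++ t) p) (comp (tensor f (idm K t)) (mor (v ++ t) b q)).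

Lemma tensor_linl a b c d (g : Heis c d) : linear (fun f : Heis a b => tensor f g).
Proof.
move=> k; elim/lquotP=> u; elim/lquotP=> v; elim/lquotP: g => g.
by rewrite -linearP !tensorE (lext2_bil _).1 linearP.
Qed.

Lemma ctx_lin a b p q t w v : linear (@ctx a b p q t w v).
Proof. by move=> c f g; rewrite /ctx tensor_linl comp_Pl comp_Pr. Qed.
HB.instance Definition _ a b p q t w v := GRing.isLinear.Build K (Heis w v) (Heis a b) _
  (@ctx a b p q t w v) (@ctx_lin a b p q t w v).

Lemma ctx_mor a b p q t w v d : run a p = Some (w ++ t) -> run w d = Some v ->
  run (v ++ t) q = Some b -> ctx a b p q t (mor w v d) = mor a b (p ++ d ++ q).
Proof.
move=> ep ed eq; have ed' := run_frame0 t ed.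
rewrite /ctx /idm tensor_mor // /= cats0 !comp_mor //.
by rewrite run_cat ed'.
Qed.

(** * Subspaces *)
Definition subspace (V : lmodType K) (S : V -> Prop) :=
  S 0 /\ forall c f g, S f -> S g -> S (c *: f + g).

Lemma subspaceD (V : lmodType K) (S : V -> Prop) f g : subspace S -> S f -> S g -> S (f + g).
Proof. by move=> [_ h] Sf Sg; rewrite -[f]scale1r; apply: h. Qed.
Lemma subspaceZ (V : lmodType K) (S : V -> Prop) c f : subspace S -> S f -> S (c *: f).
Proof. by move=> [h0 h] Sf; rewrite -[_ *: _]addr0; apply: h. Qed.
Lemma subspaceN (V : lmodType K) (S : V -> Prop) f : subspace S -> S f -> S (- f).
Proof. by move=> h Sf; rewrite -scaleN1r; apply: subspaceZ. Qed.
Lemma subspaceB (V : lmodType K) (S : V -> Prop) f g : subspace S -> S f -> S g -> S (f - g).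
Proof. by move=> h Sf Sg; apply: subspaceD => //; apply: subspaceN. Qed.
Lemma subspace_sum (V : lmodType K) (S : V -> Prop) (I : eqType) (r : seq I) (F : I -> V) :
  subspace S -> (forall i, i \in r -> S (F i)) -> S (\sum_(i <- r) F i).
Proof.
move=> h; elim: r => [|i r IH] hr; first by rewrite big_nil; exact: h.1.
rewrite big_cons; apply: subspaceD => //; first by apply: hr; rewrite inE eqxx.
by apply: IH => j hj; apply: hr; rewrite inE hj orbT.
Qed.

Lemma spanned_subspace (V : lmodType K) (S : V -> Prop) : subspace (spanned S).
Proof. by split; [exact: spanned0 | move=> c f g; exact: spanned_lin]. Qed.

(** Mostly used with [T] the preimage of a subspace under composition with a fixed morphism, so that
    a claim about a span need only be checked on spanning diagrams. *)
Lemma spanned_sub (V : lmodType K) (S T : V -> Prop) f :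
  subspace T -> (forall g, S g -> T g) -> spanned S f -> T f.
Proof. by move=> [h0 h] ST; elim=> [g /ST //||c u v _ hu _ hv] //; apply: h. Qed.

Lemma subspace_compl a b c (T : Heis a c -> Prop) (g : Heis b c) :
  subspace T -> subspace (fun f : Heis a b => T (comp f g)).
Proof. by move=> [h0 h]; split=> [|k u v Tu Tv]; [rewrite comp0l | rewrite comp_Pl; apply: h]. Qed.

Lemma subspace_compr a b c (T : Heis a c -> Prop) (f : Heis a b) :
  subspace T -> subspace (fun g : Heis b c => T (comp f g)).
Proof. by move=> [h0 h]; split=> [|k u v Tu Tv]; [rewrite comp0r | rewrite comp_Pr; apply: h]. Qed.

Lemma Heis_subspace a b (T : Heis a b -> Prop) : subspace T ->
  (forall d, run a d = Some b -> T (mor a b d)) -> forall f, T f.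
Proof. by move=> [h0 h] hd; elim/Heis_ind=> // c d f e Tf; apply: h => //; apply: hd. Qed.
End Tools.
Arguments sim_widen {K} u {w} t {d d'} _.
Arguments sim_widenr {K w} t {d d'} _.
Arguments sim_frame {K w0 p} q {u w t d d'} _ _.
Arguments sim_in {K w0 p} q {w d d'} _ _.
Arguments sim_catr {K w d d'} q _.
Arguments sim_catl {K w w' p d d'} _ _.
Arguments sim_exchange {K w1} m {w2 d1 d2 v1 v2} _ _.
Arguments sim_exchange0 {K w1 w2 d1 d2 v1 v2} _ _.
Arguments sim_mor {K w} v {d d'} _.
Arguments eqv_mor {K a} b {p} q {u w t L R} _ _.

(** * Sorted words, inversions and two kinds of paths *)

Definition P (n : nat) : word := nseq n Up ++ nseq n Down.

Lemma size_P n : size (P n) = (n + n)%N.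
Proof. by rewrite size_cat !size_nseq. Qed.

Lemma cat_eq_split (T : Type) (a b u r : seq T) : a ++ b = u ++ r ->
  (exists m, u = a ++ m /\ b = m ++ r) \/ (exists m, a = u ++ m /\ r = m ++ b).
Proof.
elim: a u => [|x a IH] [|y u] /= e.
- by left; exists [::].
- by left; exists (y :: u).
- by right; exists (x :: a).
- case: e => -> /IH[[m [-> ->]]|[m [-> ->]]]; [left|right]; by exists m.
Qed.

Lemma step_cross_cat u x y r : step (u ++ x :: y :: r) (Cross (size u)) = Some (u ++ y :: x :: r).
Proof. exact: step_cross. Qed.

Lemma step_max_cat c u r :
  step (u ++ r) (Max c (size u)) = Some (u ++ c :: ~~ c :: r).
Proof. by rewrite /= size_cat leq_addr take_size_cat // drop_size_cat. Qed.

Lemma step_min_cat c u r : step (u ++ c :: ~~ c :: r) (Min (size u)) = Some (u ++ r).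
Proof. by rewrite /= drop_size_cat // take_size_cat // /opp_arrow eqxx. Qed.

Lemma step_crossP w i w' : step w (Cross i) = Some w' ->
  exists u x y r, [/\ w = u ++ x :: y :: r, w' = u ++ y :: x :: r & i = size u].
Proof.
rewrite /=; case E : (drop i w) => [|x [|y r]] // [<-].
have lt : (i < size w)%N by rewrite ltnNge; apply/negP => /drop_oversize; rewrite E.
exists (take i w), x, y, r; rewrite -E cat_take_drop size_takel //; exact: ltnW.
Qed.

Lemma step_minP w i w' : step w (Min i) = Some w' ->
  exists u c r, [/\ w = u ++ c :: ~~ c :: r, w' = u ++ r & i = size u].
Proof.
rewrite /=; case E : (drop i w) => [|x [|y r]] //; case: eqP => // e [<-].
have lt : (i < size w)%N by rewrite ltnNge; apply/negP => /drop_oversize; rewrite E.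
exists (take i w), x, r; rewrite -[~~ x]/(opp_arrow x) -e -E cat_take_drop size_takel //; exact:
  ltnW.
Qed.

Lemma step_maxP w c i w' : step w (Max c i) = Some w' ->
  exists u r, [/\ w = u ++ r, w' = u ++ c :: ~~ c :: r & i = size u].
Proof.
by rewrite /=; case: leqP => // le [<-]; exists (take i w), (drop i w);
  rewrite cat_take_drop size_takel.
Qed.

(** Pairs of a [Down] somewhere before an [Up]. This is the measure for the inductions of the
    straightening. *)
Fixpoint inversions (w : word) : nat :=
  if w is c :: w' then (if c then 0 else count_mem Up w') + inversions w' else 0.

Definition balanced (w : word) : bool := count_mem Up w == count_mem Down w.

Lemma inversions_swap u r :
  (inversions (u ++ Up :: Down :: r) < inversions (u ++ Down :: Up :: r))%N.
Proof. elim: u => [|[] u IH] /=; rewrite ?count_cat /=; lia. Qed.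

Lemma inversions_del u r : (inversions (u ++ r) < inversions (u ++ Down :: Up :: r))%N.
Proof. elim: u => [|[] u IH] /=; rewrite ?count_cat /=; lia. Qed.

Lemma sorted_or_inversion w :
  (exists a b, w = nseq a Up ++ nseq b Down) \/ (exists u r, w = u ++ Down :: Up :: r).
Proof.
elim: w => [|[] w [[a [b ->]]|[u [r ->]]]].
- by left; exists 0%N, 0%N.
- by left; exists a.+1, b.
- by right; exists (Up :: u), r.
- case: a => [|a]; first by left; exists 0%N, b.+1.
  by right; exists [::], (nseq a Up ++ nseq b Down).
- by right; exists (Down :: u), r.
Qed.

Lemma balanced_split w : balanced w ->
  (exists n, w = P n) \/ (exists u r, w = u ++ Down :: Up :: r).
Proof.
move=> bw; case: (sorted_or_inversion w) bw => [[a [b ->]]|]; last by right.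
rewrite /balanced !count_cat !count_nseq /= !mul1n !mul0n addn0 => /eqP ->.
by left; exists b.
Qed.

Lemma P_no_inversion n u r : P n <> u ++ Down :: Up :: r.
Proof.
have inv0 : inversions (P n) = 0%N.
  rewrite /P; elim: {1}n => [|m IH] //=; elim: n => //= n ->.
  by rewrite count_nseq /= mul0n.
by move=> e; have := inversions_del u r; rewrite -e inv0.
Qed.

(** Diagrams whose every event creates an inversion, either by a crossing or by a cap whose left leg
    points down. *)
Inductive tpath (w : word) : events -> word -> Prop :=
  | tpath_nil : tpath w [::] w
  | tpath_cross t u r : tpath w t (u ++ Up :: Down :: r) ->
      tpath w (rcons t (Cross (size u))) (u ++ Down :: Up :: r)
  | tpath_max t u r : tpath w t (u ++ r) ->
      tpath w (rcons t (Max Down (size u))) (u ++ Down :: Up :: r).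

Inductive cpath (n : nat) : events -> nat -> Prop :=
  | cpath_nil : cpath n [::] n
  | cpath_up d m i : cpath n d m -> (i.+1 < m)%N -> cpath n (rcons d (Cross i)) m
  | cpath_down d m i : cpath n d m -> (i.+1 < m)%N -> cpath n (rcons d (Cross (m + i))) m
  | cpath_max d m : cpath n d m -> cpath n (rcons d (Max Up m)) m.+1
  | cpath_min d m : cpath n d m.+1 -> cpath n (rcons d (Min m)) m.

Lemma run_rcons w d s : run w (rcons d s) = if run w d is Some v then step v s else None.
Proof. by rewrite -cats1 run_cat; case: (run w d) => //= v; case: (step v s). Qed.

Lemma tpath_run w t v : tpath w t v -> run w t = Some v.
Proof.
by elim=> [|{}t u r _ IH|{}t u r _ IH] //; rewrite run_rcons IH ?step_cross_cat ?step_max_cat.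
Qed.

Lemma tpath_balanced w t v : tpath w t v -> balanced w -> balanced v.
Proof.
move=> h bw; elim: h => // {}t u r _; rewrite /balanced !count_cat /= => /eqP; lia.
Qed.

Lemma balanced_P n : balanced (P n).
Proof. by rewrite /balanced !count_cat !count_nseq /= !mul1n !mul0n addn0. Qed.

(** The last event of a nonempty [tpath] leaves an inversion, and [P m] has none. This removes the
    second half of the normal form when the target is sorted. *)
Lemma tpath_P n t m : tpath (P n) t (P m) -> t = [::] /\ n = m.
Proof.
move e : (P m) => w h; case: h e => [|{}t u r _ e|{}t u r _ e].
- by move=> e; split=> //; have := congr1 size e; rewrite !size_P; lia.
- by case: (P_no_inversion e).
- by case: (P_no_inversion e).
Qed.

Lemma nseq_split (T : Type) n i (x : T) : (i <= n)%N -> nseq n x = nseq i x ++ nseq (n - i) x.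
Proof. by move=> le; rewrite -nseqD subnKC. Qed.

Lemma step_P_up m i : (i.+1 < m)%N -> step (P m) (Cross i) = Some (P m).
Proof.
move=> lt; rewrite /P (@nseq_split _ m i); last by lia.
have [j ->] : exists j, (m - i)%N = j.+2 by exists (m - i - 2)%N; lia.
have := @step_cross_cat (nseq i Up) Up Up (nseq j Up ++ nseq m Down).
by rewrite size_nseq -!catA.
Qed.

Lemma step_P_down m i : (i.+1 < m)%N -> step (P m) (Cross (m + i)) = Some (P m).
Proof.
move=> lt; rewrite /P (@nseq_split _ m i Down); last by lia.
have [j ->] : exists j, (m - i)%N = j.+2 by exists (m - i - 2)%N; lia.
have := @step_cross_cat (nseq m Up ++ nseq i Down) Down Down (nseq j Down).
by rewrite size_cat !size_nseq -!catA.
Qed.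

Lemma P_succ m : P m.+1 = nseq m Up ++ Up :: Down :: nseq m Down.
Proof. by rewrite /P -addn1 nseqD -catA addn1. Qed.

Lemma step_P_max m : step (P m) (Max Up m) = Some (P m.+1).
Proof. by have := @step_max_cat Up (nseq m Up) (nseq m Down); rewrite size_nseq P_succ. Qed.

Lemma step_P_min m : step (P m.+1) (Min m) = Some (P m).
Proof. by have := @step_min_cat Up (nseq m Up) (nseq m Down); rewrite size_nseq P_succ. Qed.

Lemma cpath_run n c m : cpath n c m -> run (P n) c = Some (P m).
Proof.
elim=> // [d {}m i _ IH lt|d {}m i _ IH lt|d {}m _ IH|d {}m _ IH]; rewrite run_rcons IH.
- exact: step_P_up.
- exact: step_P_down.
- exact: step_P_max.
- exact: step_P_min.
Qed.

Lemma cpath_cat n c m c' l : cpath n c m -> cpath m c' l -> cpath n (c ++ c') l.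
Proof.
move=> h; elim=> [|d {}m' i _ IH lt|d m' i _ IH lt|d m' _ IH|d m' _ IH];
  rewrite ?cats0 // -rcons_cat.
- exact: cpath_up.
- exact: cpath_down.
- exact: cpath_max.
- exact: cpath_min.
Qed.

(** * Straightening: morphisms out of a sorted word *)

Section Straightening.
Variable K : fieldType.
Local Notation Heis := (Heis K).
Local Notation mor := (mor K).
Local Notation comp := (@Defs.comp K _ _ _).
Local Notation eqv := (eqv K).
Local Notation sim := (sim K).

(** Normal form: first run through sorted words only, then only create inversions. [adm] below says
    that appending a diagram preserves the span of these; that every diagram is admissible is shown
    event by event. *)
Definition good n w : Heis (P n) w -> Prop :=
  spanned (fun g => exists c m t,
    [/\ cpath n c m, tpath (P m) t w & g = mor (P n) w (c ++ t)]).

Definition adm w d w' := forall n (f : Heis (P n) w), good f -> good (comp f (mor w w' d)).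

Lemma good_path n c m t w : cpath n c m -> tpath (P m) t w -> good (mor (P n) w (c ++ t)).
Proof. by move=> hc ht; apply: spanned_gen; exists c, m, t. Qed.

Lemma good_precomp n c m w (f : Heis (P m) w) : cpath n c m -> good f ->
  good (comp (mor (P n) (P m) c) f).
Proof.
move=> hc; apply: (@spanned_sub _ _ _ (fun f => good (comp _ f))).
  by apply: subspace_compr; exact: spanned_subspace.
move=> _ [c' [l [t [hc' ht ->]]]].
rewrite comp_mor ?(cpath_run hc) // ?run_cat ?(cpath_run hc') ?(tpath_run ht) //.
by rewrite catA; apply: good_path ht; apply: cpath_cat hc'.
Qed.

(** The sorted half of a normal form stays above and is put back by [good_precomp], so only the
    inversion-creating half has to meet [d]. *)
Lemma admP w d w' : run w d = Some w' ->
  (forall m t, tpath (P m) t w -> good (mor (P m) w' (t ++ d))) -> adm w d w'.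
Proof.
move=> rd h n f; apply: (@spanned_sub _ _ _ (fun f => good (comp f _))).
  by apply: subspace_compl; exact: spanned_subspace.
move=> _ [c [m [t [hc ht ->]]]].
have rc := cpath_run hc; have rt := tpath_run ht.
have rtd : run (P m) (t ++ d) = Some w' by rewrite run_cat rt.
rewrite comp_mor ?run_cat ?rc // -catA -(comp_mor K rc rtd).
by apply: good_precomp => //; apply: h.
Qed.

Lemma adm_nil w : adm w [::] w.
Proof. by move=> n f gf; rewrite -[mor _ _ _]/(idm K w) comp_idr. Qed.

Lemma adm_cat w d w1 d' w2 : run w d = Some w1 -> run w1 d' = Some w2 ->
  adm w d w1 -> adm w1 d' w2 -> adm w (d ++ d') w2.
Proof. by move=> r r' a a' n f gf; rewrite -(comp_mor K r r') Defs.compA; apply: a'; apply: a. Qed.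

Lemma adm_sim w d d' w' : sim w d d' -> adm w d' w' -> adm w d w'.
Proof. by move=> s a n f gf; rewrite (sim_mor w' s); apply: a. Qed.

Lemma adm_eqv u w t q w' d L : eqv w [:: (1, d)] L ->
  (forall cd, cd \in L -> adm (u ++ w ++ t) (shift (size u) cd.2 ++ q) w') ->
  adm (u ++ w ++ t) (shift (size u) d ++ q) w'.
Proof.
move=> e h n f gf; have er : run (u ++ w ++ t) [::] = Some (u ++ w ++ t) by [].
have := eqv_mor w' q e er; rewrite /= mc1 => ->.
rewrite /mc big_map linear_sum; apply: subspace_sum => [|cd /h a]; first exact: spanned_subspace.
by rewrite linearZ; apply: subspaceZ; [exact: spanned_subspace | exact: a].
Qed.

(** Every path from a sorted word ends in a balanced word, so at an unbalanced word no path exists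
    and there is nothing to check. *)
Lemma adm_balanced w d w' : (balanced w -> adm w d w') -> adm w d w'.
Proof.
case bw : (balanced w); first exact.
move=> _ n f; apply: (@spanned_sub _ _ _ (fun f => good (comp f _))).
  by apply: subspace_compl; exact: spanned_subspace.
move=> g [c [m [t [_ ht _]]]].
by have := tpath_balanced ht (balanced_P m); rewrite bw.
Qed.

Lemma adm_cross_ud u r :
  adm (u ++ Up :: Down :: r) [:: Cross (size u)] (u ++ Down :: Up :: r).
Proof.
apply: admP => [|m t ht]; first by rewrite run_cons step_cross_cat.
rewrite cats1 -[rcons _ _]cat0s; apply: good_path; [exact: cpath_nil | exact: tpath_cross].
Qed.

Lemma adm_max_down u r : adm (u ++ r) [:: Max Down (size u)] (u ++ Down :: Up :: r).
Proof.
apply: admP => [|m t ht]; first by rewrite run_cons step_max_cat.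
rewrite cats1 -[rcons _ _]cat0s; apply: good_path; [exact: cpath_nil | exact: tpath_max].
Qed.

Lemma inversion_split (u0 r0 u r : word) :
  u0 ++ Down :: Up :: r0 = u ++ Down :: Up :: r ->
  [\/ u0 = u /\ r0 = r,
      exists m, u = u0 ++ Down :: Up :: m /\ r0 = m ++ Down :: Up :: r |
      exists m, u0 = u ++ Down :: Up :: m /\ r = m ++ Down :: Up :: r0].
Proof.
case/cat_eq_split=> -[m [-> e]].
- case: m e => [[->]|x [|y m]] //=; first by rewrite cats0; constructor 1.
  by case=> <- <- ->; constructor 2; exists m.
- case: m e => [[->]|x [|y m]] //=; first by rewrite cats0; constructor 1.
  by case=> <- <- ->; constructor 3; exists m.
Qed.

Lemma run_shift u w w' r d : run w d = Some w' ->
  run (u ++ w ++ r) (shift (size u) d) = Some (u ++ w' ++ r).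
Proof. exact: run_frame. Qed.

Lemma mor_exchange a b t q u w1 m w2 r d1 d2 v1 v2 :
  run a t = Some (u ++ w1 ++ m ++ w2 ++ r) ->
  run w1 d1 = Some v1 -> run w2 d2 = Some v2 ->
  mor a b (t ++ shift (size u) d1 ++ shift (size u + (size v1 + size m)) d2 ++ q) =
  mor a b (t ++ shift (size u + (size w1 + size m)) d2 ++ shift (size u) d1 ++ q).
Proof.
move=> rt r1 r2; have rt' : run a t = Some (u ++ (w1 ++ m ++ w2) ++ r) by rewrite -!catA.
have := sim_mor b (sim_frame q rt' (sim_exchange (K := K) m r1 r2)).
by rewrite !shift_cat !shift_shift -!catA.
Qed.

Lemma good_adm n w d w' t : run (P n) t = Some w -> run w d = Some w' ->
  good (mor (P n) w t) -> adm w d w' -> good (mor (P n) w' (t ++ d)).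
Proof. by move=> rt rd gt ad; rewrite -(comp_mor K rt rd); apply: ad. Qed.

(** Induction along the path above. If its last event created the very inversion on which [s] acts,
    the two events together are covered by [hX] or [hM]; otherwise the inversions are disjoint, [s]
    is exchanged with that event and meets a shorter path. *)
Lemma adm_inversion s v : run [:: Down; Up] [:: s] = Some v ->
  (forall u r, adm (u ++ [:: Up; Down] ++ r) (shift (size u) [:: Cross 0; s]) (u ++ v ++ r)) ->
  (forall u r, adm (u ++ r) (shift (size u) [:: Max Down 0; s]) (u ++ v ++ r)) ->
  forall u r, adm (u ++ [:: Down; Up] ++ r) (shift (size u) [:: s]) (u ++ v ++ r).
Proof.
move=> rs hX hM u r; apply: admP => [|m t]; first exact: run_shift.
pose IH t w := forall u r, u ++ [:: Down; Up] ++ r = w ->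
  good (mor (P m) (u ++ v ++ r) (t ++ shift (size u) [:: s])).
have far c v0 : run v0 [:: c] = Some [:: Down; Up] ->
    (forall u r, adm (u ++ v0 ++ r) (shift (size u) [:: c]) (u ++ [:: Down; Up] ++ r)) ->
    (forall u r, adm (u ++ v0 ++ r) (shift (size u) [:: c; s]) (u ++ v ++ r)) ->
    forall t u r, tpath (P m) t (u ++ v0 ++ r) -> IH t (u ++ v0 ++ r) ->
    IH (t ++ shift (size u) [:: c]) (u ++ [:: Down; Up] ++ r).
  move=> rc ac acs {}t u0 r0 ht ih {}u {}r.
  have rt := tpath_run ht; have gt := good_path (cpath_nil m) ht.
  have rcs : run v0 [:: c; s] = Some v by rewrite -cat1s run_cat rc.
  case/esym/inversion_split => [[eu er]|[m' [eu er]]|[m' [eu er]]]; subst.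
  + rewrite -catA -shift_cat; apply: good_adm rt _ gt _; first exact: run_shift.
    exact: acs.
  + move: (ih (u0 ++ v0 ++ m') r); rewrite -!catA => /(_ erefl) g.
    have rd : run (u0 ++ v0 ++ m' ++ [:: Down; Up] ++ r) (shift (size (u0 ++ v0 ++ m')) [:: s]) =
        Some (u0 ++ v0 ++ m' ++ v ++ r).
      by have := run_shift (u0 ++ v0 ++ m') r rs; rewrite -!catA.
    have rtd : run (P m) (t ++ shift (size (u0 ++ v0 ++ m')) [:: s]) =
        Some (u0 ++ v0 ++ m' ++ v ++ r) by rewrite run_cat rt.
    have := good_adm rtd (run_shift u0 (m' ++ v ++ r) rc) g (ac u0 _).
    have := @mor_exchange (P m) (u0 ++ [:: Down; Up] ++ m' ++ v ++ r) t [::]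
      u0 v0 m' [:: Down; Up] r _ _ _ _ rt rc rs.
    by rewrite !cats0 -!catA !size_cat /= => <-.
  + move: (ih u (m' ++ v0 ++ r0)); rewrite -!catA => /(_ erefl) g.
    have rd := run_shift u (m' ++ v0 ++ r0) rs; rewrite -!catA in rt.
    have rtd : run (P m) (t ++ shift (size u) [:: s]) = Some (u ++ v ++ m' ++ v0 ++ r0).
      by rewrite run_cat rt.
    have rc' : run (u ++ v ++ m' ++ v0 ++ r0) (shift (size (u ++ v ++ m')) [:: c]) =
        Some (u ++ v ++ m' ++ [:: Down; Up] ++ r0).
      by have := run_shift (u ++ v ++ m') r0 rc; rewrite -!catA.
    have ac' : adm (u ++ v ++ m' ++ v0 ++ r0) (shift (size (u ++ v ++ m')) [:: c])
        (u ++ v ++ m' ++ [:: Down; Up] ++ r0).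
      by have := ac (u ++ v ++ m') r0; rewrite -!catA.
    have := good_adm rtd rc' g ac'.
    have := @mor_exchange (P m) (u ++ v ++ m' ++ [:: Down; Up] ++ r0) t [::]
      u [:: Down; Up] m' v0 r0 _ _ _ _ rt rs rc.
    by rewrite !cats0 -!catA !size_cat /= => ->.
move e : (u ++ _) => w ht.
suff : IH t w by apply.
have sE i c : shift i [:: c] = [:: shift_event i c] by [].
elim: ht {u r e} => [|{}t u r ht ih|{}t u r ht ih].
- by move=> u r /esym/P_no_inversion.
- have := far (Cross 0) [:: Up; Down] erefl _ hX t u r ht ih.
  by rewrite sE /= addn0 cats1; apply=> u' r'; rewrite /= ?addn0; apply: adm_cross_ud.
- have := far (Max Down 0) [::] erefl _ hM t u r ht ih.
  by rewrite sE /= addn0 cats1; apply=> u' r'; rewrite /= ?addn0; apply: adm_max_down.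
Qed.

(** After the crossing that created the inversion this is a removable bigon; after the cap that
    created it, a curl, hence zero. *)
Lemma adm_cross_du u r :
  adm (u ++ [:: Down; Up] ++ r) (shift (size u) [:: Cross 0]) (u ++ [:: Up; Down] ++ r).
Proof.
apply: (@adm_inversion (Cross 0) [:: Up; Down]) => // {}u {}r.
  have e : eqv [:: Up; Down] [:: (1, [:: Cross 0; Cross 0])] [:: (1, [::])].
    by apply: (skein_check K (P := [:: At 0])); vm_compute.
  have := @adm_eqv u _ r [::] (u ++ [:: Up; Down] ++ r) _ _ e.
  by rewrite !cats0; apply=> cd; rewrite inE => /eqP -> /=; exact: adm_nil.
have e : eqv [::] [:: (1, [:: Max Down 0; Cross 0])] [::].
  by apply: (skein_check K (P := [:: At 0])); vm_compute.
have := @adm_eqv u _ r [::] (u ++ [:: Up; Down] ++ r) _ _ e.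
by rewrite cats0; apply.
Qed.

(** Here the crossing gives a curl, hence zero, and the cap gives a counterclockwise circle, hence
    1. *)
Lemma adm_min_du u r : adm (u ++ [:: Down; Up] ++ r) (shift (size u) [:: Min 0]) (u ++ r).
Proof.
apply: (@adm_inversion (Min 0) [::]) => // {}u {}r.
  have e : eqv [:: Up; Down] [:: (1, [:: Cross 0; Min 0])] [::].
    by apply: (skein_check K (P := [:: At 0])); vm_compute.
  have := @adm_eqv u _ r [::] (u ++ r) _ _ e.
  by rewrite cats0; apply.
have e : eqv [::] [:: (1, [:: Max Down 0; Min 0])] [:: (1, [::])].
  by apply: (skein_check K (P := [:: At 0])); vm_compute.
have := @adm_eqv u _ r [::] (u ++ r) _ _ e.
by rewrite !cats0; apply=> cd; rewrite inE => /eqP -> /=; exact: adm_nil.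
Qed.

Lemma shift1 n s : shift n [:: s] = [:: shift_event n s]. Proof. by []. Qed.

Lemma adm_cross_ud' u r :
  adm (u ++ [:: Up; Down] ++ r) (shift (size u) [:: Cross 0]) (u ++ [:: Down; Up] ++ r).
Proof. by rewrite shift1 /= addn0; apply: adm_cross_ud. Qed.

Lemma adm_max_down' u r :
  adm (u ++ r) (shift (size u) [:: Max Down 0]) (u ++ [:: Down; Up] ++ r).
Proof. by rewrite shift1 /= addn0; apply: adm_max_down. Qed.

(** The bigon relation factors the identity of [Down; Up] through [Up; Down] and
    the empty word. *)
Lemma adm_insert u r d w' : run (u ++ [:: Down; Up] ++ r) d = Some w' ->
  adm (u ++ [:: Up; Down] ++ r) (shift (size u) [:: Cross 0] ++ d) w' ->
  adm (u ++ r) (shift (size u) [:: Max Down 0] ++ d) w' ->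
  adm (u ++ [:: Down; Up] ++ r) d w'.
Proof.
move=> rd aX aM.
have e : eqv [:: Down; Up] [:: (1, [::])] (bigon' Down Up).2.
  by apply: (skein_check K (P := [:: Skip; At 0])); vm_compute.
apply: (adm_eqv (u := u) (t := r) (q := d) e) => cd.
have r1 := run_shift u r (erefl : run [:: Down; Up] [:: Cross 0] = Some [:: Up; Down]).
have r2 := run_shift u r (erefl : run [:: Down; Up] [:: Min 0] = Some [::]).
have r3 := run_shift u r (erefl : run [:: Up; Down] [:: Cross 0] = Some [:: Down; Up]).
have r4 := run_shift u r (erefl : run [::] [:: Max Down 0] = Some [:: Down; Up]).
rewrite !inE => /orP[] /eqP -> /=.
  by refine (adm_cat r1 _ (@adm_cross_du u r) aX); rewrite run_cat r3.
by refine (adm_cat r2 _ (@adm_min_du u r) aM); rewrite run_cat r4.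
Qed.

Lemma adm_far_left a v v' m r d : run v d = Some v' ->
  (forall x, x = [:: Up; Down] \/ x = [::] ->
     adm (a ++ v ++ m ++ x ++ r) (shift (size a) d) (a ++ v' ++ m ++ x ++ r)) ->
  adm (a ++ v ++ m ++ [:: Down; Up] ++ r) (shift (size a) d)
      (a ++ v' ++ m ++ [:: Down; Up] ++ r).
Proof.
move=> rd h.
have key c x : run x [:: c] = Some [:: Down; Up] -> x = [:: Up; Down] \/ x = [::] ->
    (forall u, adm (u ++ x ++ r) (shift (size u) [:: c]) (u ++ [:: Down; Up] ++ r)) ->
    adm ((a ++ v ++ m) ++ x ++ r) (shift (size (a ++ v ++ m)) [:: c] ++ shift (size a) d)
      (a ++ v' ++ m ++ [:: Down; Up] ++ r).
  move=> rc hx ac; rewrite -!catA.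
  have s := sim_exchange (K := K) m rd rc.
  have {s} s := sim_sym (sim_widen a r s).
  rewrite -!catA !shift_cat !shift_shift !size_cat in s *.
  apply: (adm_sim s).
  have r1 := run_shift a (m ++ x ++ r) rd.
  have r2 := run_shift (a ++ v' ++ m) r rc; rewrite -!catA !size_cat in r2.
  apply: adm_cat r1 r2 (h x hx) _.
  by have := ac (a ++ v' ++ m); rewrite -!catA !size_cat.
have rw := run_shift a (m ++ [:: Down; Up] ++ r) rd.
have := @adm_insert (a ++ v ++ m) r (shift (size a) d) (a ++ v' ++ m ++ [:: Down; Up] ++ r).
rewrite -!catA; apply=> //.
  have := key (Cross 0) [:: Up; Down] erefl (or_introl erefl) (fun u => @adm_cross_ud' u r).
  by rewrite -!catA.
have := key (Max Down 0) [::] erefl (or_intror erefl) (fun u => @adm_max_down' u r).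
by rewrite -!catA.
Qed.

Lemma adm_far_right u m v v' r d : run v d = Some v' ->
  (forall x, x = [:: Up; Down] \/ x = [::] ->
     adm (u ++ x ++ m ++ v ++ r) (shift (size (u ++ x ++ m)) d) (u ++ x ++ m ++ v' ++ r)) ->
  adm (u ++ [:: Down; Up] ++ m ++ v ++ r) (shift (size (u ++ [:: Down; Up] ++ m)) d)
      (u ++ [:: Down; Up] ++ m ++ v' ++ r).
Proof.
move=> rd h.
have rw x : run (u ++ x ++ m ++ v ++ r) (shift (size (u ++ x ++ m)) d) =
    Some (u ++ x ++ m ++ v' ++ r).
  by have := run_shift (u ++ x ++ m) r rd; rewrite -!catA.
have key c x : run x [:: c] = Some [:: Down; Up] -> x = [:: Up; Down] \/ x = [::] ->
    (forall r, adm (u ++ x ++ r) (shift (size u) [:: c]) (u ++ [:: Down; Up] ++ r)) ->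
    adm (u ++ x ++ m ++ v ++ r)
      (shift (size u) [:: c] ++ shift (size (u ++ [:: Down; Up] ++ m)) d)
      (u ++ [:: Down; Up] ++ m ++ v' ++ r).
  move=> rc hx ac.
  have s := sim_exchange (K := K) m rc rd.
  have {s} s := sim_widen u r s.
  rewrite -!catA !shift_cat !shift_shift in s.
  rewrite !size_cat; apply: (adm_sim s).
  have := rw x; rewrite !size_cat => r1.
  have r2 := run_shift u (m ++ v' ++ r) rc.
  apply: adm_cat r1 r2 _ (ac _).
  by have := h x hx; rewrite !size_cat.
apply: adm_insert => //.
- exact: key (Cross 0) [:: Up; Down] erefl (or_introl erefl) (@adm_cross_ud' u).
- exact: key (Max Down 0) [::] erefl (or_intror erefl) (@adm_max_down' u).
Qed.

End Straightening.

Section Straightening2.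
Variable K : fieldType.
Local Notation Heis := (Heis K).
Local Notation mor := (mor K).
Local Notation eqv := (eqv K).
Local Notation adm := (@adm K).

(** The events already known to be admissible in every word: crossings of opposite strands, and cups
    and caps whose left leg points down. *)
Definition free_move (w : word) (s : event) : bool :=
  match s with
  | Cross i => nth Up w i != nth Up w i.+1
  | Min i => ~~ nth Up w i
  | Max c _ => ~~ c
  end.

Lemma nth_mid (T : Type) (z : T) u x r : nth z (u ++ x :: r) (size u) = x.
Proof. by rewrite nth_cat ltnn subnn. Qed.

Lemma nth_mid1 (T : Type) (z : T) u x y r : nth z (u ++ x :: y :: r) (size u).+1 = y.
Proof. by rewrite nth_cat ltnNge leqnSn subSnn. Qed.

Lemma adm_free a l r s l' : free_move l s -> step l s = Some l' ->
  adm (a ++ l ++ r) (shift (size a) [:: s]) (a ++ l' ++ r).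
Proof.
case: s => [c i|i|i] h.
- case/step_maxP => u [t [-> -> ->]]; case: c h => // _.
  have := @adm_max_down K (a ++ u) (t ++ r).
  by rewrite size_cat -!catA.
- case/step_minP => u [c [t [e -> ei]]]; subst; move: h; rewrite /= nth_mid => h.
  case: c h => // _; have := @adm_min_du K (a ++ u) (t ++ r).
  by rewrite !shift1 size_cat -!catA /= addn0.
- case/step_crossP => u [x [y [t [e -> ei]]]]; subst; move: h; rewrite /= nth_mid nth_mid1.
  case: x y => [] [] // _.
    have := @adm_cross_ud K (a ++ u) (t ++ r).
    by rewrite size_cat -!catA.
  have := @adm_cross_du K (a ++ u) (t ++ r).
  by rewrite !shift1 size_cat -!catA /= addn0.
Qed.

Fixpoint adm_steps (a r l : word) (d : events) : Prop :=
  if d is s :: d' then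
    if step l s is Some l' then
      (free_move l s \/ adm (a ++ l ++ r) (shift (size a) [:: s]) (a ++ l' ++ r)) /\
      adm_steps a r l' d'
    else False
  else True.

Lemma adm_steps_adm a r l d l' : run l d = Some l' -> adm_steps a r l d ->
  adm (a ++ l ++ r) (shift (size a) d) (a ++ l' ++ r).
Proof.
elim: d l => [|s d IH] l /=; first by case=> -> _; exact: adm_nil.
case E : (step l s) => [l1|] // rd [h hd].
have r1 : run l [:: s] = Some l1 by rewrite /= E.
have r1' := run_shift a r r1; have r2 := run_shift a r rd.
refine (adm_cat r1' r2 _ (IH _ rd hd)).
by case: h => // h; apply: adm_free.
Qed.

Lemma adm_eqv_steps a r l d l' L : eqv l [:: (1, d)] L ->
  (forall cd, cd \in L -> run l cd.2 = Some l' /\ adm_steps a r l cd.2) ->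
  adm (a ++ l ++ r) (shift (size a) d) (a ++ l' ++ r).
Proof.
move=> e h; have := @adm_eqv K a l r [::] (a ++ l' ++ r) d L e.
rewrite cats0; apply=> cd /h[rc hc]; rewrite cats0; exact: adm_steps_adm.
Qed.

Lemma adm_cpath m s m' : cpath m [:: s] m' -> adm (P m) [:: s] (P m').
Proof.
move=> h; apply: admP => [|n t /tpath_P[-> ->]]; first exact: cpath_run.
rewrite cat0s -[X in mor _ _ X]cats0.
apply: good_path h (tpath_nil _).
Qed.

Lemma nth_P n j : nth Down (P n) j = (j < n)%N.
Proof.
rewrite nth_cat size_nseq; case: ltnP => h; first by rewrite nth_nseq h.
by rewrite nth_nseq if_same.
Qed.

(** The bigon relation, solved for the identity of [Down; Up], carries the crossing to the left of
    the downward strand. Besides one crossing on [Up; Up; Down], a word with fewer inversions, only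
    free moves occur. The next lemmas treat the other events meeting an inversion in the same
    way. *)
Lemma adm_duu a r :
  adm (a ++ [:: Up; Up; Down] ++ r) (shift (size a) [:: Cross 0]) (a ++ [:: Up; Up; Down] ++ r) ->
  adm (a ++ [:: Down; Up; Up] ++ r) (shift (size a) [:: Cross 1]) (a ++ [:: Down; Up; Up] ++ r).
Proof.
move=> h; apply: (@adm_eqv_steps _ _ _ _ _
  [:: (1, [:: Cross 0; Cross 1; Cross 0; Cross 1; Cross 0]);
      (1, [:: Cross 0; Min 1; Max Down 0]); (1, [:: Min 0; Max Down 1; Cross 0])]).
  apply: (skein_check K (P := [:: Skip; At 0; At 2; At 1; Skip; At 0; At 1; At 0; Skip;
    At 1; At 0; At 1; Left 0; Skip; At 1; At 0; Skip; At 1; Left 0; Skip])).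
  by vm_compute.
by move=> cd; rewrite !inE => /or3P[] /eqP -> /=; split=> //; do ?split; auto.
Qed.

Lemma adm_ddu a r :
  adm (a ++ [:: Up; Down; Down] ++ r) (shift (size a) [:: Cross 1])
    (a ++ [:: Up; Down; Down] ++ r) ->
  adm (a ++ [:: Down; Down; Up] ++ r) (shift (size a) [:: Cross 0])
    (a ++ [:: Down; Down; Up] ++ r).
Proof.
move=> h; apply: (@adm_eqv_steps _ _ _ _ _
  [:: (1, [:: Cross 1; Cross 0; Cross 1; Cross 0; Cross 1]);
      (1, [:: Cross 1; Min 0; Max Down 1]); (1, [:: Min 1; Max Down 0; Cross 1])]).
  apply: (skein_check K (P := [:: Skip; At 0; At 2; At 1; Skip; At 1; At 0; Skip; At 1; At 0;
    At 0; At 1; Skip; At 0; At 1; At 0; Skip; At 0; At 1; Skip])).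
  by vm_compute.
by move=> cd; rewrite !inE => /or3P[] /eqP -> /=; split=> //; do ?split; auto.
Qed.

Lemma adm_dud a r :
  adm (a ++ [:: Up; Down; Down] ++ r) (shift (size a) [:: Cross 1])
    (a ++ [:: Up; Down; Down] ++ r) ->
  adm (a ++ [:: Up; Down; Down] ++ r) (shift (size a) [:: Min 0]) (a ++ [:: Down] ++ r) ->
  adm (a ++ [:: Down; Up; Down] ++ r) (shift (size a) [:: Min 1]) (a ++ [:: Down] ++ r).
Proof.
move=> h h'; apply: (@adm_eqv_steps _ _ _ _ _
  [:: (1, [:: Cross 0; Cross 1; Min 0]); (1, [:: Min 0])]).
  apply: (skein_check K (P := [:: Skip; At 1; At 0; Skip; At 1; Skip; Skip])).
  by vm_compute.
by move=> cd; rewrite !inE => /orP[] /eqP -> /=; split=> //; do ?split; auto.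
Qed.

Lemma adm_udu a r :
  adm (a ++ [:: Up; Up; Down] ++ r) (shift (size a) [:: Cross 0])
    (a ++ [:: Up; Up; Down] ++ r) ->
  adm (a ++ [:: Up; Up; Down] ++ r) (shift (size a) [:: Min 1]) (a ++ [:: Up] ++ r) ->
  adm (a ++ [:: Up; Down; Up] ++ r) (shift (size a) [:: Min 0]) (a ++ [:: Up] ++ r).
Proof.
move=> h h'; apply: (@adm_eqv_steps _ _ _ _ _
  [:: (1, [:: Cross 1; Cross 0; Min 1]); (1, [:: Min 1])]).
  apply: (skein_check K (P := [:: Skip; At 1; At 0; Skip; At 1; Skip; Skip])).
  by vm_compute.
by move=> cd; rewrite !inE => /orP[] /eqP -> /=; split=> //; do ?split; auto.
Qed.

Lemma adm_max_over_down a r :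
  adm (a ++ [:: Up; Down; Down] ++ r) (shift (size a) [:: Cross 1])
    (a ++ [:: Up; Down; Down] ++ r) ->
  adm (a ++ [:: Down] ++ r) (shift (size a) [:: Max Up 0]) (a ++ [:: Up; Down; Down] ++ r) ->
  adm (a ++ [:: Down] ++ r) (shift (size a) [:: Max Up 1]) (a ++ [:: Down; Up; Down] ++ r).
Proof.
move=> h h'; apply: (@adm_eqv_steps _ _ _ _ _
  [:: (1, [:: Max Up 0; Cross 1; Cross 0]); (1, [:: Max Down 0])]).
  apply: (skein_check K (P := [:: Skip; At 0; At 1; Skip; At 0; Skip; Skip])).
  by vm_compute.
by move=> cd; rewrite !inE => /orP[] /eqP -> /=; split=> //; do ?split; auto.
Qed.

Lemma adm_max_over_up a r :
  adm (a ++ [:: Up; Up; Down] ++ r) (shift (size a) [:: Cross 0])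
    (a ++ [:: Up; Up; Down] ++ r) ->
  adm (a ++ [:: Up] ++ r) (shift (size a) [:: Max Up 1]) (a ++ [:: Up; Up; Down] ++ r) ->
  adm (a ++ [:: Up] ++ r) (shift (size a) [:: Max Up 0]) (a ++ [:: Up; Down; Up] ++ r).
Proof.
move=> h h'; apply: (@adm_eqv_steps _ _ _ _ _
  [:: (1, [:: Max Up 1; Cross 0; Cross 1]); (1, [:: Max Down 1])]).
  apply: (skein_check K (P := [:: Skip; At 0; At 1; Skip; At 0; Skip; Skip])).
  by vm_compute.
by move=> cd; rewrite !inE => /orP[] /eqP -> /=; split=> //; do ?split; auto.
Qed.

(** Induction on the number of inversions, for parallel strands. In a sorted word the crossing
    extends a [cpath]. Otherwise some inversion is either disjoint from the crossing, and is
    factored away, or shares one strand with it, which is the case of [adm_duu] or [adm_ddu]. *)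
Lemma adm_cross N w i w' : (inversions w < N)%N -> step w (Cross i) = Some w' ->
  adm w [:: Cross i] w'.
Proof.
elim: N w i w' => // N IH w i w' lt /step_crossP[a [x [y [b [ew ew' ei]]]]].
have [exy|nxy] := eqVneq x y; last first.
  have := @adm_free a [:: x; y] b (Cross 0) [:: y; x] nxy erefl.
  by rewrite shift1 /= addn0 ew ew' ei.
apply: adm_balanced => bw; subst y; have {ew'} ew' : w' = w by rewrite ew ew'.
case: (balanced_split bw) => [[n en]|[u [r er]]].
  rewrite ew' en; apply: adm_cpath.
  have hx : x = (i < n)%N by rewrite -nth_P -en ew ei nth_mid.
  have hx' : x = (i.+1 < n)%N by rewrite -nth_P -en ew ei nth_mid1.
  have := congr1 size ew; rewrite en size_P size_cat /= -ei => hs.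
  case: (ltnP i.+1 n) => h; first exact: (@cpath_up n [::] n i (cpath_nil n)).
  have -> : i = (n + (i - n))%N by lia.
  apply: (@cpath_down n [::] n (i - n)); [exact: cpath_nil | lia].
have inv u1 r1 y : w = u1 ++ [:: Down; Up] ++ r1 -> y = [:: Up; Down] \/ y = [::] ->
    (inversions (u1 ++ y ++ r1) < N)%N.
  move=> e [] ->; rewrite -ltnS; apply: leq_trans lt; rewrite ltnS e;
    [exact: inversions_swap | exact: inversions_del].
have i0 : [:: Cross i] = shift (size a) [:: Cross 0] by rewrite shift1 /= addn0 ei.
rewrite ew' i0 {ew' w'}.
have stepX a1 l1 r1 j : (j.+1 < size l1)%N -> nth Up l1 j = nth Up l1 j.+1 ->
    (inversions (a1 ++ l1 ++ r1) < N)%N ->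
    adm (a1 ++ l1 ++ r1) (shift (size a1) [:: Cross j]) (a1 ++ l1 ++ r1).
  move=> hj hn hi; rewrite shift1 /=; apply: IH => //.
  have : step l1 (Cross j) = Some l1.
    rewrite -[l1 in step l1 _](cat_take_drop j) (drop_nth Up) ?(drop_nth Up hj); last exact: ltnW.
    have sj : size (take j l1) = j by rewrite size_takel // ltnW // ltnW.
    by have := step_cross_cat (take j l1) (nth Up l1 j) (nth Up l1 j.+1) (drop j.+2 l1);
      rewrite sj => ->; rewrite -hn {2}hn -(drop_nth Up hj) -drop_nth ?cat_take_drop // ltnW.
  move=> st; have := @run_shift a1 l1 l1 r1 [:: Cross j].
  by rewrite run_cons st => /(_ erefl)/run1.
have e0 : a ++ x :: x :: b = u ++ Down :: Up :: r by rewrite -ew er.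
case/cat_eq_split: e0 => -[m [eu e]].
- case: m eu e => [|z [|z' m]] eu /= e.
  + by case: e => ->.
  + case: e => ex ez eb; subst z x b.
    rewrite ew; apply: adm_ddu; apply: (stepX a [:: Up; Down; Down]) => //.
    apply: ltn_trans (inversions_swap a (Down :: r)) _.
    have := inv (a ++ [:: Down]) r [:: Up; Down]; rewrite ew -!catA; apply=> //; by left.
  + case: e => ez ez' eb; subst z z' b.
    have ewx : w = a ++ [:: x; x] ++ m ++ [:: Down; Up] ++ r by rewrite ew.
    rewrite ewx; apply: (@adm_far_left K a [:: x; x] [:: x; x] m r [:: Cross 0]) => // y hy;
      apply: (stepX a [:: x; x]) => //.
    by have := inv (a ++ [:: x; x] ++ m) r y; rewrite ewx -!catA; apply.
- case: m eu e => [|z [|z' m]] eu /= e.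
  + by case: e => <-.
  + case: e => ez ex er'; subst z x r.
    have -> : [:: Cross (size a + 0)] = shift (size u) [:: Cross 1].
      by rewrite eu shift1 size_cat /= addn0.
    rewrite er; apply: adm_duu; apply: (stepX u [:: Up; Up; Down]) => //.
    have := inversions_swap (u ++ [:: Up]) b; rewrite -!catA /= => h; apply: ltn_trans h _.
    apply: (inv u (Up :: b) [:: Up; Down]) => //; by left.
  + case: e => ez ez' er'; subst z z' r.
    have ewx : w = u ++ [:: Down; Up] ++ m ++ [:: x; x] ++ b by rewrite er.
    have -> : [:: Cross (size a + 0)] = shift (size (u ++ [:: Down; Up] ++ m)) [:: Cross 0].
      by rewrite eu shift1 !size_cat.
    rewrite ewx; apply: (@adm_far_right K u m [:: x; x] [:: x; x]) => // y hy.
    have := inv u (m ++ [:: x; x] ++ b) y ewx hy.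
    have := stepX (u ++ y ++ m) [:: x; x] b 0%N isT erefl.
    by rewrite -!catA; apply.
Qed.

Lemma adm_cross' a l l' r j : step l (Cross j) = Some l' ->
  adm (a ++ l ++ r) (shift (size a) [:: Cross j]) (a ++ l' ++ r).
Proof.
move=> st; rewrite shift1; apply: adm_cross (ltnSn _) _; apply: run1.
by have := @run_shift a l l' r [:: Cross j]; rewrite run_cons st => /(_ erefl).
Qed.

Lemma adm_min N w i w' : (inversions w < N)%N -> step w (Min i) = Some w' ->
  adm w [:: Min i] w'.
Proof.
elim: N w i w' => // N IH w i w' lt st; case: (step_minP st) => a [c [b [ew ew' ei]]].
have i0 : [:: Min i] = shift (size a) [:: Min 0] by rewrite shift1 /= addn0 ei.
case: c ew => ew; last first.
  have := @adm_free a [:: Down; Up] b (Min 0) [::] isT erefl.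
  by rewrite -i0 ew ew'.
apply: adm_balanced => bw.
case: (balanced_split bw) => [[n en]|[u [r er]]].
  have h1 : (i < n)%N by rewrite -nth_P -en ew ei nth_mid.
  have h2 : (i.+1 < n)%N = false by rewrite -nth_P -en ew ei nth_mid1.
  have {en} en : w = P i.+1 by rewrite en; congr P; lia.
  have -> : w' = P i by move: st; rewrite en step_P_min => -[].
  rewrite en; apply: adm_cpath; apply: (@cpath_min _ [::]); exact: cpath_nil.
have inv u1 r1 y : w = u1 ++ [:: Down; Up] ++ r1 -> y = [:: Up; Down] \/ y = [::] ->
    (inversions (u1 ++ y ++ r1) < N)%N.
  move=> e [] ->; rewrite -ltnS; apply: leq_trans lt; rewrite ltnS e;
    [exact: inversions_swap | exact: inversions_del].
have stepM a1 l1 r1 j l2 : step l1 (Min j) = Some l2 ->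
    (inversions (a1 ++ l1 ++ r1) < N)%N ->
    adm (a1 ++ l1 ++ r1) (shift (size a1) [:: Min j]) (a1 ++ l2 ++ r1).
  move=> st1 hi; rewrite shift1 /=; apply: IH => //; apply: run1.
  by have := @run_shift a1 l1 l2 r1 [:: Min j]; rewrite run_cons st1 => /(_ erefl).
rewrite i0 ew' {ew' w' st}.
have e0 : a ++ Up :: Down :: b = u ++ Down :: Up :: r by rewrite -er ew.
case/cat_eq_split: e0 => -[m [eu e]].
- case: m eu e => [|z [|z' m]] eu //= [].
  + move=> ez eb; subst z b; rewrite ew.
    apply: (@adm_udu a r); first exact: adm_cross'.
    apply: (stepM a [:: Up; Up; Down]) => //.
    have := inv (a ++ [:: Up]) r [:: Up; Down]; rewrite ew -!catA; apply=> //; by left.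
  + move=> ez ez' eb; subst z z' b.
    have ewx : w = a ++ [:: Up; Down] ++ m ++ [:: Down; Up] ++ r by rewrite ew.
    rewrite ewx; apply: (@adm_far_left K a [:: Up; Down] [::] m r [:: Min 0]) => // y hy.
    apply: (stepM a [:: Up; Down]) => //.
    by have := inv (a ++ [:: Up; Down] ++ m) r y; rewrite ewx -!catA; apply.
- case: m eu e => [|z [|z' m]] eu //= [].
  + move=> ez er'; subst z r.
    have -> : [:: Min (size a + 0)] = shift (size u) [:: Min 1].
      by rewrite eu shift1 size_cat /= addn0.
    rewrite er eu -catA; apply: (@adm_dud u b); first exact: adm_cross'.
    apply: (stepM u [:: Up; Down; Down]) => //.
    apply: (inv u (Down :: b) [:: Up; Down]) => //; by left.
  + move=> ez ez' er'; subst z z' r.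
    have ewx : w = u ++ [:: Down; Up] ++ m ++ [:: Up; Down] ++ b by rewrite er.
    have -> : [:: Min (size a + 0)] = shift (size (u ++ [:: Down; Up] ++ m)) [:: Min 0].
      by rewrite eu shift1 !size_cat.
    rewrite ewx eu -!catA.
    apply: (@adm_far_right K u m [:: Up; Down] [::]) => // y hy.
    have := inv u (m ++ [:: Up; Down] ++ b) y ewx hy.
    have := stepM (u ++ y ++ m) [:: Up; Down] b 0%N [::] erefl.
    by rewrite -!catA; apply.
Qed.

Lemma adm_max_up N w i w' : (inversions w < N)%N -> step w (Max Up i) = Some w' ->
  adm w [:: Max Up i] w'.
Proof.
elim: N w i w' => // N IH w i w' lt /step_maxP[a [b [ew ew' ei]]].
have i0 : [:: Max Up i] = shift (size a) [:: Max Up 0] by rewrite shift1 /= addn0 ei.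
have inv u1 r1 y : w = u1 ++ [:: Down; Up] ++ r1 -> y = [:: Up; Down] \/ y = [::] ->
    (inversions (u1 ++ y ++ r1) < N)%N.
  move=> e [] ->; rewrite -ltnS; apply: leq_trans lt; rewrite ltnS e;
    [exact: inversions_swap | exact: inversions_del].
have stepM a1 r1 : (inversions (a1 ++ r1) < N)%N ->
    adm (a1 ++ r1) (shift (size a1) [:: Max Up 0]) (a1 ++ [:: Up; Down] ++ r1).
  by move=> hi; rewrite shift1 /= addn0; apply: IH => //; rewrite step_max_cat.
rewrite i0 {ei i0 i}; apply: adm_balanced => bw.
case: (balanced_split bw) => [[n en]|[u [r er]]]; last first.
  have left a1 m1 : w = a1 ++ m1 ++ [:: Down; Up] ++ r ->
      adm w (shift (size a1) [:: Max Up 0]) (a1 ++ [:: Up; Down] ++ m1 ++ [:: Down; Up] ++ r).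
    move=> e; rewrite e; apply: (@adm_far_left K a1 [::] [:: Up; Down] m1 r [:: Max Up 0]) => // y
      hy.
    by apply: stepM; have := inv (a1 ++ m1) r y; rewrite e -!catA; apply.
  have e0 : a ++ b = u ++ Down :: Up :: r by rewrite -er ew.
  case/cat_eq_split: e0 => -[m [eu e]].
    by rewrite ew' e; apply: left; rewrite ew e.
  case: m eu e => [|z [|z' m]] eu //=.
  - rewrite cats0 in eu; move=> e; subst a b; rewrite ew'; apply: (left u [::]); exact: ew.
  - case=> ez eb; subst z b; rewrite ew'.
    have -> : [:: Max Up (size a + 0)] = shift (size u) [:: Max Up 1].
      by rewrite eu shift1 size_cat /= addn0.
    rewrite er eu -catA; apply: (@adm_max_over_down u (Up :: r)); first exact: adm_cross'.
    by have := left u [::] er; rewrite er.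
  - case=> ez ez' er'; subst z z' r.
    have ewx : w = u ++ [:: Down; Up] ++ m ++ b by rewrite er.
    have -> : [:: Max Up (size a + 0)] = shift (size (u ++ [:: Down; Up] ++ m)) [:: Max Up 0].
      by rewrite eu shift1 !size_cat.
    rewrite ew' ewx eu -!catA.
    apply: (@adm_far_right K u m [::] [:: Up; Down]) => // y hy.
    have := inv u (m ++ b) y ewx hy.
    by have := stepM (u ++ y ++ m) b; rewrite -!catA; apply.
(* A sorted word allows a cap anywhere, but a [cpath] only in the middle: the cap is moved to the
   middle one strand at a time, [d] counting the strands still in between. *)
have ups d j : (j + d = n)%N ->
    adm (nseq j Up ++ nseq d Up ++ nseq n Down) (shift (size (nseq j Up)) [:: Max Up 0])
      (nseq j Up ++ [:: Up; Down] ++ nseq d Up ++ nseq n Down).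
  elim: d j => [|d IHd] j jd.
    rewrite shift1 /= addn0 size_nseq -[j]addn0 jd -P_succ.
    by apply: adm_cpath; apply: (@cpath_max _ [::]); exact: cpath_nil.
  apply: (@adm_max_over_up (nseq j Up)); first exact: adm_cross'.
  have := IHd j.+1; rewrite -addn1 nseqD -!catA size_cat !shift1 /= addn0 => h.
  by apply: h; rewrite -jd addn1 addSnnS.
have downs d e : (d + e = n)%N ->
    adm ((nseq n Up ++ nseq d Down) ++ nseq e Down)
      (shift (size (nseq n Up ++ nseq d Down)) [:: Max Up 0])
      ((nseq n Up ++ nseq d Down) ++ [:: Up; Down] ++ nseq e Down).
  elim: d e => [|d IHd] e de.
    by move: de; rewrite add0n => ->; have := ups 0%N n (addn0 n); rewrite cats0.
  have -> : nseq n Up ++ nseq d.+1 Down = (nseq n Up ++ nseq d Down) ++ [:: Down].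
    by rewrite -addn1 nseqD catA.
  rewrite -[(_ ++ [:: Down]) ++ nseq e Down]catA -[(_ ++ [:: Down]) ++ _ ++ nseq e Down]catA.
  have -> : shift (size ((nseq n Up ++ nseq d Down) ++ [:: Down])) [:: Max Up 0] =
      shift (size (nseq n Up ++ nseq d Down)) [:: Max Up 1].
    by rewrite size_cat !shift1 /= addn0.
  apply: adm_max_over_down; first exact: adm_cross'.
  by apply: (IHd e.+1); rewrite addnS -addSn.
have nsplit c k a1 m : nseq k c = a1 ++ m -> a1 = nseq (size a1) c /\ m = nseq (size m) c.
  elim: a1 k => [|x a1 IHa] [|k] //=; first by move=> <-.
    by move=> <-; rewrite /= size_nseq.
  by case=> <- /IHa[<- <-].
have : a ++ b = nseq n Up ++ nseq n Down by rewrite -ew en.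
rewrite ew ew'; case/cat_eq_split => -[m [e1 e2]].
- have [ea em] := nsplit _ _ _ _ _ e1; have := congr1 size e1; rewrite size_cat size_nseq => hs.
  by have := ups (size m) (size a) (esym hs); rewrite -ea -em e2.
- have [em eb] := nsplit _ _ _ _ _ e2; have := congr1 size e2; rewrite size_cat size_nseq => hs.
  by have := downs (size m) (size b) (esym hs); rewrite -em -eb e1.
Qed.

Lemma adm_step w s w' : step w s = Some w' -> adm w [:: s] w'.
Proof.
case: s => [[] i|i|i] st.
- exact: adm_max_up (ltnSn _) st.
- case/step_maxP: st => u [r [-> -> ->]]; exact: adm_max_down.
- exact: adm_min (ltnSn _) st.
- exact: adm_cross (ltnSn _) st.
Qed.

Lemma good_run n d w : run (P n) d = Some w -> good (mor (P n) w d).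
Proof.
elim/last_ind: d w => [|d s IH] w.
  move=> [ew]; subst w; rewrite -[[::]]cat0s.
  exact: good_path (cpath_nil n) (tpath_nil _).
rewrite run_rcons; case E : (run (P n) d) => [v|] // st; rewrite -cats1.
have rs : run v [:: s] = Some w by rewrite run_cons st.
by rewrite -(comp_mor K E rs); apply: adm_step st _ _ (IH _ E).
Qed.

Lemma good_all n w (f : Heis (P n) w) : good f.
Proof.
move: f; apply: Heis_subspace; first exact: spanned_subspace.
by move=> d; exact: good_run.
Qed.

(** For a sorted target the inversion-creating half of the normal form is empty, by [tpath_P]. *)
Lemma cpath_span n m (f : Heis (P n) (P m)) :
  spanned (fun g => exists2 c, cpath n c m & g = mor (P n) (P m) c) f.
Proof.
have := good_all f; apply: (@spanned_sub _ _ _ (fun f => spanned _ f)).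
  exact: spanned_subspace.
move=> g [c [l [t [hc /tpath_P[et el] eg]]]]; subst; apply: spanned_gen.
by exists c; rewrite ?cats0.
Qed.
End Straightening2.

(** Far commutation and triple points; unlike [sim] this does not depend on the
    word. *)
Inductive bcong : events -> events -> Prop :=
  | bc_refl d : bcong d d
  | bc_sym d d' : bcong d d' -> bcong d' d
  | bc_trans d1 d2 d3 : bcong d1 d2 -> bcong d2 d3 -> bcong d1 d3
  | bc_comm p q i j : (i.+1 < j)%N ->
      bcong (p ++ [:: Cross i; Cross j] ++ q) (p ++ [:: Cross j; Cross i] ++ q)
  | bc_triple p q i :
      bcong (p ++ [:: Cross i; Cross i.+1; Cross i] ++ q)
            (p ++ [:: Cross i.+1; Cross i; Cross i.+1] ++ q).

Definition cross_lt (n : nat) (s : event) : bool := if s is Cross i then (i.+1 < n)%N else false.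
Definition crosses n (d : events) : bool := all (cross_lt n) d.
Definition far (i : nat) (s : event) : bool :=
  if s is Cross j then (i.+1 < j)%N || (j.+1 < i)%N else false.

Lemma bcong_ctx p q d d' : bcong d d' -> bcong (p ++ d ++ q) (p ++ d' ++ q).
Proof.
elim=> [{}d|{}d {}d' _ IH|d1 d2 d3 _ IH1 _ IH2|p' q' i j lt|p' q' i].
- exact: bc_refl.
- exact: bc_sym.
- exact: bc_trans IH1 IH2.
- by have := bc_comm (p ++ p') (q' ++ q) lt; rewrite -!catA.
- by have := bc_triple (p ++ p') (q' ++ q) i; rewrite -!catA.
Qed.

Lemma bcong_catr d d' q : bcong d d' -> bcong (d ++ q) (d' ++ q).
Proof. exact: (@bcong_ctx [::]). Qed.

Lemma bcong_catl p d d' : bcong d d' -> bcong (p ++ d) (p ++ d').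
Proof. by move=> h; have := bcong_ctx p [::] h; rewrite !cats0. Qed.

Lemma bcong_cons s d d' : bcong d d' -> bcong (s :: d) (s :: d').
Proof. exact: (@bcong_catl [:: s]). Qed.

Lemma bcong_far i d : all (far i) d -> bcong (Cross i :: d) (d ++ [:: Cross i]).
Proof.
elim: d => [|s d IH] /=; first by move=> _; exact: bc_refl.
case/andP; case: s => // j fj /IH h.
apply: (bc_trans (d2 := Cross j :: Cross i :: d)); last exact: bcong_cons.
case/orP: fj => lt; first exact: (bc_comm [::] d lt).
exact: bc_sym (bc_comm [::] d lt).
Qed.

Lemma bcong_far_block d d' : all (fun s => if s is Cross i then all (far i) d' else false) d ->
  bcong (d ++ d') (d' ++ d).
Proof.
elim: d => [|s d IH] /=; first by rewrite cats0 => _; exact: bc_refl.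
case: s => [|//|i /andP[h /IH h']] //.
apply: bc_trans (bcong_cons _ h') _; rewrite -cat_cons -[Cross i :: d]cat1s catA.
by apply: bcong_catr; apply: bcong_far.
Qed.

Lemma bcong_crosses n d d' : bcong d d' -> crosses n d = crosses n d'.
Proof.
elim=> // [d1 d2 d3 _ -> _ -> //|p q i j _|p q i]; rewrite /crosses !all_cat /= !andbT.
  by congr (_ && (_ && _)); rewrite andbC.
by do 3!case: (_ < _)%N.
Qed.

Lemma crosses_cat n d d' : crosses n (d ++ d') = crosses n d && crosses n d'.
Proof. exact: all_cat. Qed.

Lemma crosses_leq m n d : (m <= n)%N -> crosses m d -> crosses n d.
Proof. by move=> le; apply: sub_all => -[] //= i h; apply: leq_trans h le. Qed.

Lemma split2 (w : word) i : (i.+1 < size w)%N -> exists u x y r, w = u ++ x :: y :: r /\ size u = i.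
Proof.
move=> lt; exists (take i w), (nth Up w i), (nth Up w i.+1), (drop i.+2 w).
by rewrite -!drop_nth ?cat_take_drop ?size_takel //; lia.
Qed.

Lemma crosses_run w d : crosses (size w) d -> exists2 v, run w d = Some v & size v = size w.
Proof.
elim: d w => [|s d IH] w; first by exists w.
case: s => // i /andP[/= /split2[u [x [y [r [-> <-]]]]] h].
have [|v rv sv] := IH (u ++ y :: x :: r); first by move: h; rewrite !size_cat.
exists v; last by rewrite sv !size_cat.
by have /= -> := step_cross_cat u x y r.
Qed.

(** * Runs of crossings and the sorting diagram *)

Definition cr i n : events := [seq Cross j | j <- iota i n].
Definition crd i n : events := rev (cr i n).

Lemma crd_S i n : crd i n.+1 = Cross (i + n) :: crd i n.
Proof. by rewrite /crd /cr -addn1 iotaD map_cat rev_cat. Qed.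

Lemma crd_Sr i n : crd i n.+1 = crd i.+1 n ++ [:: Cross i].
Proof. by rewrite /crd /cr /= rev_cons cats1. Qed.

Lemma crd_all (p : pred event) i n :
  (forall j, (i <= j < i + n)%N -> p (Cross j)) -> all p (crd i n).
Proof.
move=> h; rewrite /crd all_rev all_map; apply/allP => j; rewrite mem_iota; exact: h.
Qed.

Lemma crosses_crd m i n : (i + n < m)%N -> crosses m (crd i n).
Proof. by move=> lt; apply: crd_all => j /=; lia. Qed.

(** Two neighbouring strands travel left across the same [n] strands; they may cross each other
    before or after. *)
Lemma bcong_two_over p n : bcong (crd p n ++ crd p.+1 n ++ [:: Cross p])
  (Cross (p + n) :: crd p n ++ crd p.+1 n).
Proof.
elim: n => [|n IH]; first by rewrite addn0; exact: bc_refl.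
rewrite !crd_S /= ?addSn ?addnS.
have c : bcong (crd p n ++ Cross (p + n).+1 :: crd p.+1 n) (Cross (p + n).+1 :: crd p n ++ crd
  p.+1 n).
  rewrite -cat1s catA -[X in bcong _ X]/(([:: _] ++ _) ++ _).
  by apply: bcong_catr; apply: bc_sym; apply: bcong_far; apply: crd_all => j /=; lia.
apply: (bc_trans (d2 := [:: Cross (p + n), Cross (p + n).+1, Cross (p + n) & crd p n ++ crd p.+1
  n])).
  apply: bcong_cons; have := bcong_catr [:: Cross p] c; rewrite -catA /= => h.
  apply: bc_trans h _; apply: bcong_cons; rewrite -catA; exact: IH.
apply: bc_trans (bc_triple [::] _ _) _ => /=.
by do 2!apply: bcong_cons; apply: bc_sym.
Qed.

(** A crossing of two of the strands passed by the travelling one. Its index grows by one because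
    that strand has arrived on its left. *)
Lemma bcong_slide p q n : (p <= q)%N -> (q.+1 < p + n)%N ->
  bcong (crd p n ++ [:: Cross q.+1]) (Cross q :: crd p n).
Proof.
elim: n => [|n IH] le lt; first by lia.
have [e|ne] := eqVneq q.+1 (p + n)%N; last first.
  rewrite crd_S /=; apply: (bc_trans (d2 := [:: Cross (p + n), Cross q & crd p n])).
    by apply: bcong_cons; apply: IH => //; lia.
  by apply: bc_sym; apply: (bc_comm [::]); lia.
case: n IH lt e => [|n] IH lt e; first by lia.
have eq : q = (p + n)%N by lia.
rewrite !crd_S -e -eq /=.
apply: (bc_trans (d2 := [:: Cross q.+1, Cross q, Cross q.+1 & crd p n])).
  by do 2!apply: bcong_cons; apply: bc_sym; apply: bcong_far; apply: crd_all => j /=; lia.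
by apply: bc_sym; apply: (bc_triple [::]).
Qed.

(** Insertion sort: once [m] pairs are sorted, the next [Up] stands at position [2 * m] and travels
    left across [m] downward strands. *)
Fixpoint Yd (n : nat) : events := if n is m.+1 then Yd m ++ crd m m else [::].

Lemma crosses_Yd n : crosses (n + n).-1 (Yd n).
Proof.
elim: n => // n IH; rewrite /= crosses_cat (crosses_leq _ IH) ?crosses_crd //; lia.
Qed.

Lemma Yd_pos n : all (fun s => if s is Cross i then (0 < i)%N else false) (Yd n).
Proof.
elim: n => //= n IH; rewrite all_cat IH /=; apply: crd_all => j /=; case: n {IH} => //; lia.
Qed.

Lemma ud_add m n : ud (m + n) = ud m ++ ud n.
Proof. by rewrite /ud nseqD flatten_cat. Qed.

Lemma ud_S n : ud n.+1 = ud n ++ [:: Up; Down].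
Proof. by rewrite -addn1 ud_add. Qed.

Lemma nseq_cons_cat (T : Type) n (x : T) s : nseq n x ++ x :: s = nseq n.+1 x ++ s.
Proof. by elim: n => //= n ->. Qed.

Lemma run_crd u x n t : run (u ++ nseq n x ++ ~~ x :: t) (crd (size u) n) =
  Some (u ++ ~~ x :: nseq n x ++ t).
Proof.
elim: n t => [|n IH] t //.
have e : u ++ nseq n.+1 x ++ ~~ x :: t = (u ++ nseq n x) ++ x :: ~~ x :: t.
  by rewrite -addn1 nseqD -!catA.
have := step_cross_cat (u ++ nseq n x) x (~~ x) t; rewrite size_cat size_nseq => st.
rewrite crd_S run_cons e st -catA IH; congr Some.
by rewrite -[in RHS](addn1 n) nseqD -catA.
Qed.

Lemma run_Yd n t : run (ud n ++ t) (Yd n) = Some (P n ++ t).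
Proof.
elim: n t => [|n IH] t //.
rewrite -[Yd n.+1]/(Yd n ++ crd n n) ud_S -catA run_cat IH /P -catA -[n in crd n _](size_nseq n Up).
rewrite -[[:: Up; Down] ++ t]/(~~ Down :: Down :: t) run_crd /=; congr Some.
by rewrite !nseq_cons_cat /P -!catA.
Qed.

(** * Sliding crossings and dots through the sorting diagram *)

Section Slides.
Variable K : fieldType.
Local Notation sim := (sim K).

Lemma bcong_sim w d d' : crosses (size w) d -> bcong d d' -> sim w d d'.
Proof.
move=> + h; elim: h => {d d'} [d|d d' h IH|d1 d2 d3 h1 IH1 h2 IH2|p q i j lt|p q i] hc.
- exact: sim_refl.
- by apply: sim_sym; apply: IH; rewrite (bcong_crosses _ h).
- by apply: sim_trans (IH1 hc) (IH2 _); rewrite -(bcong_crosses _ h1).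
- rewrite !crosses_cat /= !andbT in hc; case/and3P: hc => [/crosses_run[v rv sv] /andP[hi hj] _].
  apply: (sim_in q rv); have lj : (j.+1 < size v)%N by rewrite sv.
  have [u [x [y [r [ev eu]]]]] := split2 lj.
  have [u' [x' [y' [r' [ev' eu']]]]] : exists u' x' y' r', u = u' ++ [:: x'; y'] ++ r' /\ size u'
    = i.
    by apply: split2; lia.
  rewrite ev ev' -!catA -[[:: x, y & r]]/([:: x; y] ++ r).
  have := sim_exchange (K := K) r' (erefl : run [:: x'; y'] [:: Cross 0] = Some [:: y'; x'])
    (erefl : run [:: x; y] [:: Cross 0] = Some [:: y; x]).
  move/(sim_widen u' r); rewrite -!catA !shift_cat /= eu' !addn0.
  have -> : (i + (2 + size r'))%N = j by rewrite -eu ev' !size_cat /= eu'; lia.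
  exact.
- rewrite !crosses_cat /= !andbT in hc; case/and3P: hc => [/crosses_run[v rv sv] /and3P[hi hj _] _].
  apply: (sim_in q rv); have lj : (i.+2 < size v)%N by rewrite sv.
  have [u [x [y [r [ev eu]]]]] := split2 (ltnW lj).
  case: r ev lj => [|z r] ev lj; first by move: lj; rewrite ev size_cat /= eu addn2 ltnn.
  rewrite ev -[[:: x, y, z & r]]/([:: x; y; z] ++ r).
  have s : sound K (triple x y z) by apply: skein_eqv; apply: skein_triple.
  have := sim_widen u r s.
  by rewrite /= eu !addn0 !addn1.
Qed.

Lemma crosses_exchange w1 w2 c d2 v2 : crosses (size w1) c -> run w2 d2 = Some v2 ->
  sim (w1 ++ w2) (c ++ shift (size w1) d2) (shift (size w1) d2 ++ c).
Proof.
by move=> /crosses_run[v1 r1 s1] r2; have := sim_exchange0 (K := K) r1 r2; rewrite s1.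
Qed.

End Slides.

Section Slides2.
Variable K : fieldType.
Local Notation sim := (sim K).
Local Notation eqv := (eqv K).

Lemma tau_diagE i : tau_diag i.+2 = [:: Cross i; Cross i.+1; Cross i].
Proof. by rewrite /tau_diag subn2 subn1. Qed.

Lemma Yd_S n : Yd n.+1 = Yd n ++ crd n n. Proof. by []. Qed.

Lemma all_Yd n m : (n + n <= m)%N -> all (cross_lt m) (Yd n).
Proof. move=> le; apply: crosses_leq (crosses_Yd n); lia. Qed.

Lemma all_crd i n m : (i + n < m)%N -> all (cross_lt m) (crd i n).
Proof. exact: crosses_crd. Qed.

Ltac crs := rewrite ?size_ud /crosses ?all_cat /= ?all_cat ?all_Yd ?all_crd /= ?andbT; lia.

(** A crossing left of the last inserted strand commutes with the last run, and induction applies.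
    For the last two upward strands [bcong_two_over] brings their crossing up, and on
    [Up; Down; Up; Down] a triple point and a removable bigon produce the three crossings of
    [tau]. *)
Lemma slide_up j i : (i.+1 < j)%N ->
  sim (ud j) (Yd j ++ [:: Cross i]) (tau_diag (2 * i).+2 ++ Yd j).
Proof.
elim: j => // j IH lt.
have [lt'|ge] := ltnP i.+1 j.
  have s : sim (ud j.+1) (Yd j.+1 ++ [:: Cross i]) (Yd j ++ [:: Cross i] ++ crd j j).
    apply: bcong_sim; first by crs.
    rewrite Yd_S -catA; apply: bcong_catl; apply: bc_sym; apply: bcong_far.
    by apply: crd_all => l /=; lia.
  apply: sim_trans s _; rewrite ud_S Yd_S !catA; apply: sim_catr.
  by apply: sim_widenr; apply: IH.
have {IH ge lt} -> : j = i.+1 by lia.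
have Y2 : Yd i.+2 = Yd i ++ crd i i ++ Cross (i + i).+1 :: crd i.+1 i.
  by rewrite !Yd_S crd_S addSn -!catA.
have e2 : (2 * i)%N = (i + i)%N by lia.
have far1 : bcong (Cross (i + i).+1 :: crd i i) (crd i i ++ [:: Cross (i + i).+1]).
  by apply: bcong_far; apply: crd_all => l /=; lia.
apply: (@sim_trans _ _ _ (Yd i ++ [:: Cross (i + i).+1; Cross (i + i)] ++ crd i i ++ crd i.+1 i)).
  apply: bcong_sim; first by crs.
  rewrite Y2 -!catA; apply: bcong_catl.
  apply: (bc_trans (d2 := Cross (i + i).+1 :: crd i i ++ crd i.+1 i ++ [:: Cross i])).
    rewrite -cat_cons -[X in bcong X]/(crd i i ++ [:: Cross (i + i).+1] ++ crd i.+1 i ++ [:: Cross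
      i]).
    by rewrite catA; apply: bcong_catr; apply: bc_sym.
  by apply: bcong_cons; apply: bcong_two_over.
apply: sim_sym; rewrite tau_diagE e2.
apply: (@sim_trans _ _ _ (Yd i ++ [:: Cross (i + i); Cross (i + i).+1; Cross (i + i); Cross (i +
  i).+1]
   ++ crd i i ++ crd i.+1 i)).
  apply: bcong_sim; first by crs.
  rewrite Y2.
  apply: (bc_trans (d2 := Yd i ++ [:: Cross (i + i); Cross (i + i).+1; Cross (i + i)]
     ++ crd i i ++ Cross (i + i).+1 :: crd i.+1 i)).
    rewrite [X in bcong _ X]catA [X in bcong X]catA; apply: bcong_catr.
    apply: bcong_far_block; rewrite /= !andbT; apply/and3P; split;
      apply: sub_all (crosses_Yd i) => -[] //= l; lia.
  do 2!apply: bcong_catl; rewrite -[X in bcong _ X]/((_ :: _) ++ _).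
  by rewrite -cat1s catA; apply: bcong_catr; apply: bc_sym.
have r : run (ud i.+2) (Yd i) = Some (P i ++ [:: Up; Down; Up; Down] ++ [::]).
  by have -> : ud i.+2 = ud i ++ [:: Up; Down; Up; Down]; [rewrite !ud_S -catA | exact: run_Yd].
have e : eqv [:: Up; Down; Up; Down] [:: (1, [:: Cross 0; Cross 1; Cross 0; Cross 1])]
    [:: (1, [:: Cross 1; Cross 0])].
  by apply: (skein_check K (P := [:: At 0; At 2; Skip; Skip])); vm_compute.
have := sim_frame (crd i i ++ crd i.+1 i) r e.
by rewrite size_P /= addn0 addn1.
Qed.

(** As for [slide_up], but now the travelling strand shifts the crossing ([bcong_slide]), and the
    bigon removed at the end is one of downward strands. *)
Lemma slide_down j i : (i.+1 < j)%N ->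
  sim (ud j) (Yd j ++ [:: Cross (j + i)]) (tau_diag (2 * i).+3 ++ Yd j).
Proof.
elim: j => // j IH lt.
have [lt'|ge] := ltnP i.+1 j.
  have s : sim (ud j.+1) (Yd j.+1 ++ [:: Cross (j.+1 + i)]) (Yd j ++ [:: Cross (j + i)] ++ crd j j).
    apply: bcong_sim; first by crs.
    rewrite Yd_S -catA addSn; apply: bcong_catl; apply: bcong_slide; lia.
  apply: sim_trans s _; rewrite ud_S Yd_S !catA; apply: sim_catr.
  by apply: sim_widenr; apply: IH.
have {IH ge lt} -> : j = i.+1 by lia.
have Y2 : Yd i.+2 = Yd i.+1 ++ Cross (i + i).+1 :: crd i.+1 i.
  by rewrite Yd_S crd_S addSn.
have e2 : (2 * i)%N = (i + i)%N by lia.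
apply: (@sim_trans _ _ _ (Yd i.+1 ++ [:: Cross (i + i).+1; Cross (i + i).+2] ++ crd i.+1 i)).
  apply: bcong_sim; first by crs.
  rewrite Y2 -catA; apply: bcong_catl; rewrite /=; apply: bcong_cons.
  rewrite addSn addSn; apply: bc_sym; apply: bcong_far; apply: crd_all => l /=; lia.
apply: sim_sym; rewrite tau_diagE e2.
apply: (@sim_trans _ _ _ (Yd i.+1 ++ [:: Cross (i + i).+1; Cross (i + i).+2; Cross (i + i).+1;
  Cross (i + i).+1]
   ++ crd i.+1 i)).
  apply: bcong_sim; first by crs.
  rewrite Y2 -[X in bcong _ X]/(Yd i.+1 ++ [:: _; _; _] ++ [:: Cross (i + i).+1] ++ crd i.+1 i).
  rewrite [X in bcong _ X]catA [X in bcong X]catA; apply: bcong_catr.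
  apply: bcong_far_block; rewrite /= !andbT; apply/and3P; split;
    apply: sub_all (crosses_Yd i.+1) => -[] //= l; lia.
have r : run (ud i.+2) (Yd i.+1) =
    Some ((nseq i.+1 Up ++ nseq i Down) ++ [:: Down; Up; Down] ++ [::]).
  have -> : ud i.+2 = ud i.+1 ++ [:: Up; Down] by exact: ud_S.
  rewrite run_Yd /P -!catA; congr (Some (_ ++ _)).
  by rewrite -[[:: Down; Up; Down] ++ [::]]/(Down :: [:: Up; Down]) nseq_cons_cat.
have e : eqv [:: Down; Up; Down] [:: (1, [:: Cross 0; Cross 1; Cross 0; Cross 0])]
    [:: (1, [:: Cross 0; Cross 1])].
  by apply: (skein_check K (P := [:: At 2; Skip; Skip])); vm_compute.
have := sim_frame (crd i.+1 i) r e.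
by rewrite size_cat !size_nseq /= addn0 addn1 addSn.
Qed.

Lemma shift_of_ge n d : all (fun s => if s is Cross i then (n <= i)%N else false) d ->
  exists2 d', d = shift n d' & forall m, crosses (n + m) d -> crosses m d'.
Proof.
elim: d => [|s d IH] /=; first by exists [::].
case: s => // i /andP[le /IH[d' -> h]]; exists (Cross (i - n) :: d').
  by rewrite /= subnKC.
by move=> m /= /andP[lt /h ->]; rewrite andbT; lia.
Qed.

(** The first strand takes no part in [Yd]. *)
Lemma slide_dot_up j t : (0 < j)%N -> sim (ud j ++ t) (Yd j ++ dot Up 0) (dot Up 0 ++ Yd j).
Proof.
move=> j0; have := Yd_pos j; case/shift_of_ge => d' e hc.
have [w ew] : exists w, ud j ++ t = [:: Up] ++ w by case: j j0 {e hc} => // j _; eexists.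
have sw : crosses (size w) d'.
  apply: hc; apply: crosses_leq (crosses_Yd j); have := congr1 size ew.
  by rewrite !size_cat size_ud /=; lia.
have [v rv _] := crosses_run sw.
have := sim_exchange0 (K := K) (erefl : run [:: Up] (dot Up 0) = Some [:: Up]) rv.
by rewrite -e -ew; apply: sim_sym.
Qed.

(** The last strand takes no part in [Yd]. *)
Lemma Yd_exchange j t d v : run (Down :: t) d = Some v ->
  sim (ud j.+1 ++ t) (Yd j.+1 ++ shift (2 * j).+1 d) (shift (2 * j).+1 d ++ Yd j.+1).
Proof.
move=> r; have -> : ud j.+1 ++ t = (ud j ++ [:: Up]) ++ (Down :: t) by rewrite ud_S -!catA.
have sw : size (ud j ++ [:: Up]) = (2 * j).+1 by rewrite size_cat size_ud addn1.
rewrite -sw; apply: crosses_exchange r; apply: crosses_leq (crosses_Yd _); lia.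
Qed.

End Slides2.

(** * Generated subrings and integral spans *)

Section GeneratedSubring.
Variable E : pzRingType.

(** Monomials grow only on the right, so the coset argument need only multiply by one generator from
    that side; all products are recovered in [subring_gen_mul]. *)
Inductive subring_gen (G : E -> Prop) : E -> Prop :=
  | subring_gen1 : subring_gen G 1
  | subring_genB u v : subring_gen G u -> subring_gen G v -> subring_gen G (u - v)
  | subring_genM u g : subring_gen G u -> G g -> subring_gen G (u * g).

Inductive zspan (G : E -> Prop) : E -> Prop :=
  | zspan_gen g : G g -> zspan G g
  | zspan0 : zspan G 0
  | zspanB u v : zspan G u -> zspan G v -> zspan G (u - v).

Lemma subring_gen_gen (G : E -> Prop) g : G g -> subring_gen G g.
Proof. by move=> Gg; rewrite -[g]mul1r; apply: subring_genM => //; exact: subring_gen1. Qed.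

Lemma subring_gen_mul G u v : subring_gen G u -> subring_gen G v -> subring_gen G (u * v).
Proof.
move=> Gu; elim=> [|v1 v2 _ IH1 _ IH2|v1 g _ IH Gg]; first by rewrite mulr1.
  by rewrite mulrBr; apply: subring_genB.
by rewrite mulrA; apply: subring_genM.
Qed.

Lemma subring_gen_exp G u n : subring_gen G u -> subring_gen G (u ^+ n).
Proof.
move=> Gu; elim: n => [|n IH]; first exact: subring_gen1.
by rewrite exprS; apply: subring_gen_mul.
Qed.

Lemma subring_gen_sub (G H : E -> Prop) u :
  (forall g, G g -> H g) -> subring_gen G u -> subring_gen H u.
Proof.
move=> GH; elim=> [|v1 v2 _ IH1 _ IH2|v1 g _ IH Gg]; first exact: subring_gen1.
  exact: subring_genB.
by apply: subring_genM => //; apply: GH.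
Qed.

Lemma subring_gen_comm (G : E -> Prop) u y :
  (forall g, G g -> g * y = y * g) -> subring_gen G u -> u * y = y * u.
Proof.
move=> h; elim=> [|v1 v2 _ IH1 _ IH2|v1 g _ IH Gg]; first by rewrite mul1r mulr1.
  by rewrite mulrBl mulrBr IH1 IH2.
by rewrite -mulrA h // !mulrA IH.
Qed.

Lemma zspanD G u v : zspan G u -> zspan G v -> zspan G (u + v).
Proof.
move=> Gu Gv; rewrite -[v]opprK -[- v]sub0r; apply: zspanB => //.
by apply: zspanB => //; exact: zspan0.
Qed.

Lemma zspan_map (G H : E -> Prop) (f : E -> E) u : f 0 = 0 ->
  (forall a b, f (a - b) = f a - f b) ->
  (forall g, G g -> zspan H (f g)) -> zspan G u -> zspan H (f u).
Proof.
move=> f0 fB h; elim=> [g /h //||a b _ IHa _ IHb]; first by rewrite f0; exact: zspan0.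
by rewrite fB; apply: zspanB.
Qed.

End GeneratedSubring.

(** The relations of the degenerate affine Hecke algebra. *)
Section Hecke.
Variables (E : pzRingType) (s x : nat -> E) (N : nat).
Hypothesis ss : forall i, (i.+1 < N)%N -> s i * s i = 1.
Hypothesis braid : forall i, (i.+2 < N)%N -> s i.+1 * s i * s i.+1 = s i * s i.+1 * s i.
Hypothesis sC : forall i j, (i.+1 < j)%N -> (j.+1 < N)%N -> s i * s j = s j * s i.
Hypothesis xC : forall i j, (i < j)%N -> (j < N)%N -> x i * x j = x j * x i.
Hypothesis sxC : forall i j, (i.+1 < j)%N -> (j < N)%N -> s i * x j = x j * s i.
Hypothesis xsC : forall i j, (j < i)%N -> (i.+1 < N)%N -> x j * s i = s i * x j.
Hypothesis sx : forall i, (i.+1 < N)%N -> s i * x i.+1 = x i * s i - 1.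

Definition hecke_gen n (g : E) : Prop :=
  (exists2 i, (i.+1 < n)%N & g = s i) \/ (exists2 i, (i < n)%N & g = x i).
Definition hecke n := subring_gen (hecke_gen n).

Definition hecke_cross (n : nat) (b : bool) : E := if b then s n.-1 else 1.

(** Spanning set for a Mackey decomposition: the algebra on [n + 1] strands is the sum of the
    bimodules H_n x_n^c H_n and H_n x_n^c s_(n-1) H_n over the algebra H_n on [n] strands. *)
Definition hecke_coset n (g : E) : Prop :=
  exists (u : E) (c : nat) (b : bool) (v : E), [/\ hecke n u, hecke n v, (b -> 0 < n)%N &
    g = u * x n ^+ c * hecke_cross n b * v].

Lemma hecke_s n i : (i.+1 < n)%N -> hecke n (s i).
Proof. by move=> h; apply: subring_gen_gen; left; exists i. Qed.

Lemma hecke_x n i : (i < n)%N -> hecke n (x i).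
Proof. by move=> h; apply: subring_gen_gen; right; exists i. Qed.

Lemma hecke_comm_x n u : (n < N)%N -> hecke n u -> u * x n = x n * u.
Proof.
move=> lt; apply: subring_gen_comm => g [[i hi ->]|[i hi ->]]; first exact: sxC.
exact: xC.
Qed.

Lemma hecke_comm_s n u : (n.+1 < N)%N -> hecke n u -> u * s n = s n * u.
Proof.
move=> lt; apply: subring_gen_comm => g [[i hi ->]|[i hi ->]]; first exact: sC.
exact: xsC.
Qed.

Lemma hecke_comm_xX n u c : (n < N)%N -> hecke n u -> u * x n ^+ c = x n ^+ c * u.
Proof.
move=> lt hu; elim: c => [|c IH]; first by rewrite mulr1 mul1r.
by rewrite exprS mulrA hecke_comm_x // -mulrA IH mulrA.
Qed.

Lemma sx' i : (i.+1 < N)%N -> s i * x i = x i.+1 * s i + 1.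
Proof.
move=> h; rewrite -[LHS]mulr1 -(ss h) mulrA -[s i * x i * s i]mulrA.
have -> : x i * s i = s i * x i.+1 + 1 by rewrite sx // subrK.
by rewrite mulrDr mulrDl mulr1 !mulrA ss // mul1r.
Qed.

Lemma hecke_coset_mulr n w g : hecke n w -> zspan (hecke_coset n) g ->
  zspan (hecke_coset n) (g * w).
Proof.
move=> hw; apply: (@zspan_map _ _ _ (fun g => g * w)) => [|a b|]; [by rewrite mul0r | by rewrite
  mulrBl |].
move=> _ [u [c [b [v [h1 h2 hb ->]]]]]; apply: zspan_gen.
by exists u, c, b, (v * w); split; rewrite ?mulrA //; apply: subring_gen_mul.
Qed.

Lemma hecke_coset_intro n (u : E) (c : nat) (b : bool) (v : E) : hecke n u -> hecke n v -> (b -> 0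
  < n)%N ->
  zspan (hecke_coset n) (u * x n ^+ c * hecke_cross n b * v).
Proof. by move=> *; apply: zspan_gen; exists u, c, b, v. Qed.

Lemma hecke_coset_mul_x n g : (n < N)%N -> zspan (hecke_coset n) g ->
  zspan (hecke_coset n) (g * x n).
Proof.
move=> ltN; apply: (@zspan_map _ _ _ (fun g => g * x n)) => [|a b|]; [by rewrite mul0r | by
  rewrite mulrBl |].
move=> _ [u [c [b [v [h1 h2 hb ->]]]]].
rewrite -mulrA hecke_comm_x // mulrA.
case: b hb => [/(_ isT)|_]; last first.
  have := @hecke_coset_intro n u c.+1 false v h1 h2.
  by rewrite /= !mulr1 exprSr mulrA; apply.
case: n ltN h1 h2 => // n ltN h1 h2 _ /=.
rewrite -[_ * s n * x n.+1]mulrA sx // mulrBr mulr1 mulrBl; apply: zspanB; last first.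
  by have := @hecke_coset_intro n.+1 u c false v h1 h2; rewrite /= !mulr1; apply.
have xn : hecke n.+1 (x n) by apply: hecke_x.
rewrite mulrA -[u * _ * x n]mulrA -hecke_comm_xX // mulrA.
by apply: (@hecke_coset_intro n.+1 (u * x n) c true v) => //; apply: subring_gen_mul.
Qed.

(** The right factor [v] is decomposed once more by the hypothesis on [n]. Its own right factor
    commutes with [s n], which leaves [s n * x n ^+ d * hecke_cross n b' * s n] to be rewritten. *)
Lemma hecke_coset_mul_s n g : (n.+1 < N)%N ->
  (forall u, hecke n.+1 u -> zspan (hecke_coset n) u) ->
  zspan (hecke_coset n.+1) g -> zspan (hecke_coset n.+1) (g * s n).
Proof.
move=> ltN IH; apply: (@zspan_map _ _ _ (fun g => g * s n)) => [|a b|]; [by rewrite mul0r | by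
  rewrite mulrBl |].
move=> _ [u [c [b [v [h1 h2 _ ->]]]]].
have up w : hecke n w -> hecke n.+1 w.
  apply: subring_gen_sub => g0 [[i hi ->]|[i hi ->]]; [left|right]; exists i => //; exact: ltnW.
pose f w := u * x n.+1 ^+ c * hecke_cross n.+1 b * w * s n.
apply: (@zspan_map _ (hecke_coset n) _ f) (IH v h2) => [|a a'|].
- by rewrite /f mulr0 mul0r.
- by rewrite /f mulrBr mulrBl.
move=> _ [u' [d [b' [v' [h1' h2' hb' ->]]]]].
have hs : b' -> hecke n.+1 (s n.-1) by move=> /hb' n0; apply: hecke_s; lia.
have hc : hecke n.+1 (hecke_cross n b').
  by case: (b') hs => [/(_ isT)|_] //; exact: subring_gen1.
have e1 : v' * s n = s n * v' by apply: hecke_comm_s.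
have e2 : hecke_cross n.+1 b * u' = u' * hecke_cross n.+1 b.
  by case: (b) => /=; rewrite ?mulr1 ?mul1r // hecke_comm_s.
have hx : hecke n.+1 (x n ^+ d) by apply: subring_gen_exp; apply: hecke_x.
have -> : f (u' * x n ^+ d * hecke_cross n b' * v') =
    (u * u') * x n.+1 ^+ c * hecke_cross n.+1 b * x n ^+ d * (hecke_cross n b' * s n) * v'.
  rewrite /f !mulrA -[_ * v' * s n]mulrA e1 !mulrA.
  by rewrite -[_ * hecke_cross n.+1 b * u']mulrA e2 !mulrA -[u * _ * u']mulrA -hecke_comm_xX
    ?mulrA //; apply: up.
apply: hecke_coset_mulr; first exact: up.
have huu : hecke n.+1 (u * u') by apply: subring_gen_mul => //; apply: up.
move: (u * u') huu => w hw {u u' h1 h1' e2 f}.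
(* With a single [s n] the product already has coset form once the power of [x n.+1] is commuted to
   its place. *)
have straight k l w' : hecke n.+1 w' -> zspan (hecke_coset n.+1)
    (w' * x n.+1 ^+ k * x n ^+ l * (hecke_cross n b' * s n)).
  move=> hw'; have hxl : hecke n.+1 (x n ^+ l) by apply: subring_gen_exp; apply: hecke_x.
  have hLC : hecke n.+1 (x n ^+ l * hecke_cross n b') by apply: subring_gen_mul.
  have -> : w' * x n.+1 ^+ k * x n ^+ l * (hecke_cross n b' * s n) =
      w' * (x n.+1 ^+ k * (x n ^+ l * hecke_cross n b')) * s n * 1 by rewrite !mulrA mulr1.
  rewrite -hecke_comm_xX // [w' * _]mulrA.
  by apply: (@hecke_coset_intro n.+1 _ k true 1); [apply: subring_gen_mul | exact: subring_gen1|].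
case: b => /=; last by rewrite mulr1; apply: straight.
(* Each dot between the two crossings leaves by [sx']: it becomes a dot [x n.+1] on the left, and
   the error term has one crossing less. *)
elim: d c w hw {hx} => [|d IHd] c w hw; last first.
  rewrite exprS -[_ * s n * _]mulrA [s n * (x n * _)]mulrA sx' // mulrDl mul1r mulrDr mulrDl.
  apply: zspanD; last by apply: straight.
  by have := IHd c.+1 w hw; rewrite exprSr !mulrA.
(* Without dots in between, either the two crossings cancel or the braid relation leaves a single
   [s n.+1]. *)
rewrite mulr1; case: b' hb' hs hc {straight} => [/(_ isT) n0 /(_ isT) hs _|_ _ _] /=; last first.
  rewrite mul1r -mulrA ss // mulr1.
  have := @hecke_coset_intro n.+1 w c false 1 hw (subring_gen1 _).
  by rewrite /= !mulr1; apply.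
case: n n0 IH ltN up v' h2 h2' e1 hw hs => // n _ IH ltN up v' h2 h2' e1 hw hs /=.
rewrite -mulrA [s n.+1 * _]mulrA braid //.
have := @hecke_coset_intro n.+2 (w * s n) c true (s n).
rewrite /= -[w * s n * _]mulrA hecke_comm_xX // !mulrA; apply=> //.
exact: subring_gen_mul.
Qed.

Lemma hecke_cosetP n u : (n < N)%N -> hecke n.+1 u -> zspan (hecke_coset n) u.
Proof.
elim: n u => [|n IH] u ltN; elim=> [|v1 v2 _ IH1 _ IH2|v g _ hv].
- have := @hecke_coset_intro 0 1 0 false 1 (subring_gen1 _) (subring_gen1 _).
  by rewrite /= !mulr1; apply.
- exact: zspanB.
- case=> [[i lt _]|[i lt ->]]; first by [].
  have -> : i = 0%N by lia.
  exact: hecke_coset_mul_x.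
- have := @hecke_coset_intro n.+1 1 0 false 1 (subring_gen1 _) (subring_gen1 _).
  by rewrite /= !mulr1; apply.
- exact: zspanB.
case=> [[i hi ->]|[i hi ->]].
- have [e|ne] := eqVneq i n; last by apply: hecke_coset_mulr => //; apply: hecke_s; lia.
  by rewrite e; apply: hecke_coset_mul_s => // w; apply: IH; lia.
- have [e|ne] := eqVneq i n.+1; last by apply: hecke_coset_mulr => //; apply: hecke_x; lia.
  by rewrite e; apply: hecke_coset_mul_x.
Qed.
End Hecke.

(** * Local endomorphisms and their Hecke relations *)

Definition loc (w : word) (i : nat) (l : word) : Prop :=
  exists a r, w = a ++ l ++ r /\ size a = i.

Lemma loc_sub w i l j l' r' : loc w i (l ++ l' ++ r') -> j = (i + size l)%N -> loc w j l'.
Proof.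
case=> a [r [-> sa]] ->; exists (a ++ l), (r' ++ r); rewrite -!catA; split=> //.
by rewrite size_cat sa.
Qed.

Lemma loc_disjoint w i j l l' : loc w i l -> loc w j l' -> (i + size l <= j)%N ->
  exists a m r, w = a ++ l ++ m ++ l' ++ r /\ size a = i /\ j = (i + (size l + size m))%N.
Proof.
move=> [a [r [ew sa]]] [b [t [ew' sb]]] le.
have : (a ++ l) ++ r = b ++ (l' ++ t) by rewrite -catA -ew -ew'.
case/cat_eq_split => -[m [e1 e2]].
- exists a, m, t; rewrite ew e2; split=> //; split=> //.
  by rewrite -sb e1 !size_cat sa; lia.
- have m0 : m = [::].
    by apply: size0nil; have := congr1 size e1; rewrite !size_cat sa sb; lia.
  subst m; rewrite cats0 in e1; exists a, [::], t; rewrite ew e2 /=; split=> //; split=> //.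
  by rewrite addn0 -sb -e1 size_cat sa.
Qed.

Section EndAlgebra.
Variable K : fieldType.
Local Notation mor := (mor K).
Local Notation eqv := (eqv K).
Local Notation sim := (sim K).

Definition endmor w (d : events) : EndHeis K w := mor w w d.
Local Notation em := endmor.

Lemma emM w d e : run w d = Some w -> run w e = Some w -> em w d * em w e = em w (d ++ e).
Proof. by move=> rd re; exact: comp_mor. Qed.

Lemma em1 w : em w [::] = 1. Proof. by []. Qed.

Lemma loc_run w i l l' d : loc w i l -> run l d = Some l -> l' = l -> run w (shift i d) = Some w.
Proof. by case=> a [r [-> <-]] rd _; apply: run_frame. Qed.

Lemma em_comm w i j l l' d d' : loc w i l -> loc w j l' -> (i + size l <= j)%N ->
  run l d = Some l -> run l' d' = Some l' ->
  em w (shift i d) * em w (shift j d') = em w (shift j d') * em w (shift i d).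
Proof.
move=> h h' le rd rd'.
have r1 : run w (shift i d) = Some w by apply: loc_run h rd erefl.
have r2 : run w (shift j d') = Some w by apply: loc_run h' rd' erefl.
rewrite !emM //; have [a [m [r [ew [sa sj]]]]] := loc_disjoint h h' le.
apply: sim_mor; rewrite ew.
have := sim_widen a r (sim_exchange (K := K) m rd rd').
by rewrite !shift_cat !shift_shift -!catA sa -sj.
Qed.

Lemma em_local w i l (L R : combo) : loc w i l -> eqv l L R ->
  \sum_(cd <- L) cd.1%:~R *: em w (shift i cd.2) =
  \sum_(cd <- R) cd.1%:~R *: em w (shift i cd.2).
Proof.
move=> [a [r [ew sa]]] e.
have E M : \sum_(cd <- M) cd.1%:~R *: em w (shift i cd.2) =
    mc K w w (frame_combo [::] i [::] M).
  by rewrite /mc big_map; apply: eq_bigr => cd _ /=; rewrite cats0.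
have rw : run w [::] = Some (a ++ l ++ r) by rewrite -ew.
by rewrite !E -sa; exact: (eqv_mor w [::] e rw).
Qed.

Lemma em_local_sim w i l d d' : loc w i l -> sim l d d' -> em w (shift i d) = em w (shift i d').
Proof. by move=> h s; have := em_local h s; rewrite !big_seq1 /= !scale1r. Qed.

Lemma shift_dot c i j : shift i (dot c j) = dot c (i + j).
Proof. by case: c; rewrite /dot /= ?addnS. Qed.

Lemma dotE c i : dot c i = shift i (dot c 0).
Proof. by rewrite shift_dot addn0. Qed.

Lemma crossE i : [:: Cross i] = shift i [:: Cross 0].
Proof. by rewrite shift1 /= addn0. Qed.

Lemma run_dot1 c : run [:: c] (dot c 0) = Some [:: c]. Proof. by case: c. Qed.

Section Relations.
Variables (w : word) (c : arrow).
Local Notation s i := (em w [:: Cross i]).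
Local Notation x i := (em w (dot c i)).

Lemma em_ss i : loc w i [:: c; c] -> s i * s i = 1.
Proof.
move=> h; have r : run w [:: Cross i] = Some w by rewrite crossE; apply: loc_run h _ erefl.
rewrite emM //.
have e : sim [:: c; c] [:: Cross 0; Cross 0] [::].
  by case: (c); apply: (skein_check K (P := [:: At 0])); vm_compute.
by have := em_local_sim h e; rewrite /= !addn0.
Qed.

Lemma em_braid i : loc w i [:: c; c; c] -> s i.+1 * s i * s i.+1 = s i * s i.+1 * s i.
Proof.
move=> h; have h1 : loc w i [:: c; c] by apply: (@loc_sub w i [::] i [:: c; c] [:: c] h); rewrite
  addn0.
have h2 : loc w i.+1 [:: c; c].
  by apply: (@loc_sub w i [:: c] i.+1 [:: c; c] [::] h); rewrite addn1.
have r1 : run w [:: Cross i] = Some w by rewrite crossE; apply: loc_run h1 _ erefl.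
have r2 : run w [:: Cross i.+1] = Some w by rewrite crossE; apply: loc_run h2 _ erefl.
rewrite !emM ?run_cat ?r1 ?r2 //.
have e : sim [:: c; c; c] [:: Cross 1; Cross 0; Cross 1] [:: Cross 0; Cross 1; Cross 0].
  by case: (c); apply: (skein_check K (P := [:: At 0; Skip; Skip])); vm_compute.
by have := em_local_sim h e; rewrite /= !addn0 !addn1.
Qed.

Lemma em_sC i j : loc w i [:: c; c] -> loc w j [:: c; c] -> (i.+1 < j)%N -> s i * s j = s j * s i.
Proof.
move=> h h' lt; rewrite (crossE i) (crossE j); apply: em_comm h h' _ _ _ => //=; lia.
Qed.

Lemma em_xC i j : loc w i [:: c] -> loc w j [:: c] -> (i < j)%N -> x i * x j = x j * x i.
Proof.
by move=> h h' lt; rewrite (dotE c i) (dotE c j); apply: em_comm h h' _ (run_dot1 c) (run_dot1 c);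
  rewrite addn1.
Qed.

Lemma em_sxC i j : loc w i [:: c; c] -> loc w j [:: c] -> (i.+1 < j)%N -> s i * x j = x j * s i.
Proof.
move=> h h' lt; rewrite (crossE i) (dotE c j); apply: em_comm h h' _ _ (run_dot1 c) => //=; lia.
Qed.

Lemma em_xsC i j : loc w i [:: c; c] -> loc w j [:: c] -> (j < i)%N -> x j * s i = s i * x j.
Proof.
move=> h h' lt; rewrite (crossE i) (dotE c j); apply: em_comm h' h _ (run_dot1 c) _ => //=; lia.
Qed.
End Relations.

Lemma em_sx w (i : nat) : loc w i [:: Up; Up] ->
  em w [:: Cross i] * em w (dot Up i.+1) = em w (dot Up i) * em w [:: Cross i] - 1.
Proof.
move=> h.
have h1 : loc w i [:: Up] by apply: (@loc_sub w i [::] i [:: Up] [:: Up] h); rewrite addn0.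
have h2 : loc w i.+1 [:: Up] by apply: (@loc_sub w i [:: Up] i.+1 [:: Up] [::] h); rewrite addn1.
have r0 : run w [:: Cross i] = Some w by rewrite crossE; apply: loc_run h _ erefl.
have r1 : run w (dot Up i) = Some w by rewrite dotE; apply: loc_run h1 (run_dot1 _) erefl.
have r2 : run w (dot Up i.+1) = Some w by rewrite dotE; apply: loc_run h2 (run_dot1 _) erefl.
rewrite !emM //.
have e : eqv [:: Up; Up] [:: (1, [:: Cross 0] ++ dot Up 1)]
    [:: (1, dot Up 0 ++ [:: Cross 0]); (-1, [::])].
  apply: (skein_check K (P := [:: At 0; At 2; At 1; At 2; Use (bigon' Up Up) 1 1; At 0; At 1;
    At 3; At 2; At 1; At 0; Skip; At 4; At 2; At 1; At 0; Skip; At 0; Skip; Skip])).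
  by vm_compute.
have := em_local h e; rewrite !big_cons !big_nil !addr0 !scale1r scaleN1r /=.
by rewrite !addn0 !addn1 addn2.
Qed.

(** Mirror image of [em_sx]: the dots change places in the opposite direction. For this reason
    downward strands will be counted from the right. *)
Lemma em_sy w (i : nat) : loc w i [:: Down; Down] ->
  em w [:: Cross i] * em w (dot Down i) = em w (dot Down i.+1) * em w [:: Cross i] - 1.
Proof.
move=> h.
have h1 : loc w i [:: Down] by apply: (@loc_sub w i [::] i [:: Down] [:: Down] h); rewrite addn0.
have h2 : loc w i.+1 [:: Down].
  by apply: (@loc_sub w i [:: Down] i.+1 [:: Down] [::] h); rewrite addn1.
have r0 : run w [:: Cross i] = Some w by rewrite crossE; apply: loc_run h _ erefl.
have r1 : run w (dot Down i) = Some w by rewrite dotE; apply: loc_run h1 (run_dot1 _) erefl.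
have r2 : run w (dot Down i.+1) = Some w by rewrite dotE; apply: loc_run h2 (run_dot1 _) erefl.
rewrite !emM //.
have e : eqv [:: Down; Down] [:: (1, [:: Cross 0] ++ dot Down 0)]
    [:: (1, dot Down 1 ++ [:: Cross 0]); (-1, [::])].
  apply: (skein_check K (P := [:: At 0; At 2; At 1; At 2; Use (bigon' Down Down) 1 1; At 0;
    At 1; At 3; Skip; At 4; At 2; At 1; At 0; Skip; At 1; At 2; Skip; Skip])).
  by vm_compute.
have := em_local h e; rewrite !big_cons !big_nil !addr0 !scale1r scaleN1r /=.
by rewrite !addn0 !addn1 addn2.
Qed.

End EndAlgebra.

(** * Dotted circles and their passage through strands *)

Section Bubbles.
Variable K : fieldType.
Local Notation Heis := (Heis K).
Local Notation mor := (mor K).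
Local Notation comp := (@Defs.comp K _ _ _).
Local Notation eqv := (eqv K).
Local Notation sim := (sim K).
Local Notation em := (@endmor K).

Lemma compM w X (f : Heis X w) (u v : EndHeis K w) : comp f (u * v) = comp (comp f u) v.
Proof. exact: Defs.compA. Qed.

Lemma compM' w X (u v : EndHeis K w) (f : Heis w X) : comp (u * v : EndHeis K w) f = comp u (comp
  v f).
Proof. by rewrite -[u * v]/(comp u v) Defs.compA. Qed.

Lemma comp1 w X (f : Heis X w) : comp f (1 : EndHeis K w) = f.
Proof. exact: comp_idr. Qed.

Lemma comp1' w X (f : Heis w X) : comp (1 : EndHeis K w) f = f.
Proof. exact: comp_idl. Qed.

Lemma compBl a b c (f g : Heis a b) (h : Heis b c) : comp (f - g) h = comp f h - comp g h.
Proof. by rewrite addrC -scaleN1r comp_Pl scaleN1r addrC. Qed.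

Lemma compBr a b c (f : Heis a b) (g h : Heis b c) : comp f (g - h) = comp f g - comp f h.
Proof. by rewrite addrC -scaleN1r comp_Pr scaleN1r addrC. Qed.

Definition dpow (c : arrow) (i n : nat) : events := flatten (nseq n (dot c i)).
Definition bub (p c : nat) : events := Max Up p :: dpow Up p c ++ [:: Min p].

Lemma run_pow w d n : run w d = Some w -> run w (flatten (nseq n d)) = Some w.
Proof. by move=> r; elim: n => //= n IH; rewrite run_cat r. Qed.

Lemma em_pow w d n : run w d = Some w -> em w d ^+ n = em w (flatten (nseq n d)).
Proof.
move=> r; elim: n => [|n IH]; first by rewrite expr0 em1.
by rewrite exprS IH /= emM // run_pow.
Qed.

Lemma shift_dpow i c j n : shift i (dpow c j n) = dpow c (i + j) n.
Proof.
by elim: n => //= n IH; rewrite /dpow /= shift_cat shift_dot -/(dpow _ _ _) IH.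
Qed.

Lemma run_dpow1 c n : run [:: c] (dpow c 0 n) = Some [:: c].
Proof. by apply: run_pow; exact: run_dot1. Qed.

(** Pulling a dotted clockwise circle through an upward strand. *)
Lemma sim_bubble d : eqv [:: Up]
  [:: (1, [:: Max Up 1; Cross 0] ++ dpow Up 0 d ++ [:: Cross 0; Min 1])]
  [:: (1, bub 0 d); (-1, dpow Up 0 d)].
Proof.
have D1 := run_dpow1 Up d.
have D2 : run [:: Up; Down; Up] (dpow Up 0 d) = Some [:: Up; Down; Up].
  exact: (run_frame0 [:: Down; Up] D1).
have D3 : run [:: Up; Up; Down] (dpow Up 0 d) = Some [:: Up; Up; Down].
  exact: (run_frame0 [:: Up; Down] D1).
have e1 : sim [:: Up] [:: Max Up 1; Cross 0] [:: Max Up 0; Cross 1].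
  by apply: (skein_check K (P := [:: At 0; Skip; Skip])); vm_compute.
have e2 : sim [:: Up; Up; Down] [:: Cross 0; Min 1] [:: Cross 1; Min 0].
  by apply: (skein_check K (P := [:: At 0; Skip; Skip])); vm_compute.
have e3 : sim [:: Up; Down; Up] (dpow Up 0 d ++ [:: Cross 1]) ([:: Cross 1] ++ dpow Up 0 d).
  exact: (sim_exchange0 (K := K) D1 (erefl : run [:: Down; Up] [:: Cross 0] = Some [:: Up; Down])).
have e4 : sim [:: Up; Down; Up] (dpow Up 0 d ++ [:: Min 1]) ([:: Min 1] ++ dpow Up 0 d).
  exact: (sim_exchange0 (K := K) D1 (erefl : run [:: Down; Up] [:: Min 0] = Some [::])).
have e5 : eqv [:: Up; Down; Up] [:: (1, [:: Cross 1; Cross 1])]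
   [:: (1, [::]); (-1, [:: Min 1; Max Down 1])].
  by apply: (skein_check K (P := [:: At 0])); vm_compute.
have z1 : sim [:: Up] [:: Max Up 0; Min 1] [::].
  by apply: (skein_check K (P := [:: At 0])); vm_compute.
have z2 : sim [:: Up] [:: Max Down 1; Min 0] [::].
  by apply: (skein_check K (P := [:: At 0])); vm_compute.
apply: (@eqv_trans K _ _ [:: (1, [:: Max Up 0; Cross 1] ++ dpow Up 0 d ++ [:: Cross 0; Min 1])]).
  exact: (sim_catr (dpow Up 0 d ++ [:: Cross 0; Min 1]) e1).
apply: (@eqv_trans K _ _ [:: (1, ([:: Max Up 0; Cross 1] ++ dpow Up 0 d) ++ [:: Cross 1; Min 0])]).
  by rewrite catA; apply: (sim_catl (w' := [:: Up; Up; Down]) _ e2); rewrite /= D3.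
apply: (@eqv_trans K _ _ [:: (1, [:: Max Up 0] ++ (dpow Up 0 d ++ [:: Cross 1]) ++ [:: Cross 1;
  Min 0])]).
  have := @sim_in K [:: Up] [:: Max Up 0] [:: Cross 1; Min 0] _ _ _ erefl (sim_sym e3).
  by rewrite -!catA.
have r1 : run [:: Up] (Max Up 0 :: dpow Up 0 d) = Some ([::] ++ [:: Up; Down; Up] ++ [::]).
  by rewrite run_cons.
have := eqv_frame [:: Min 0] r1 e5.
rewrite /frame_combo /= -?catA /= => h; apply: eqv_trans h _.
apply: (@eqv_cat _ _ [:: _] [:: _] [:: _] [:: _]); first exact: eqv_refl.
(* The correction term of the double crossing joins circle and strand into one dotted strand with
   two zigzags. *)
suff s : sim [:: Up] ((Max Up 0 :: dpow Up 0 d) ++ [:: Min 1; Max Down 1; Min 0]) (dpow Up 0 d).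
  by have := eqv_scale (-1) s; rewrite /scale_combo /= !mulr1.
apply: (@sim_trans _ _ _ ([:: Max Up 0] ++ ([:: Min 1] ++ dpow Up 0 d) ++ [:: Max Down 1; Min 0])).
  rewrite -[X in sim _ X]/([:: Max Up 0] ++ dpow Up 0 d ++ [:: Min 1] ++ [:: Max Down 1; Min 0]).
  by rewrite [dpow Up 0 d ++ _]catA; apply: (@sim_in K _ _ _ [:: Up; Down; Up]).
apply: (@sim_trans _ _ _ (dpow Up 0 d ++ [:: Max Down 1; Min 0])).
  exact: (sim_catr (dpow Up 0 d ++ [:: Max Down 1; Min 0]) z1).
by rewrite -[X in sim _ _ X]cats0; apply: (sim_catl (w' := [:: Up])).
Qed.

Section BubbleStep.
Variables (X a r : word) (S : Heis X (a ++ [:: Up] ++ r) -> Prop).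
Let W := a ++ [:: Up] ++ r.
Let W2 := a ++ [:: Up; Up; Down] ++ r.
Let p := size a.
Hypothesis Ssub : subspace S.
Hypothesis Sx : forall f, S f -> S (comp f (em W (dot Up p))).
Hypothesis Sb : forall c f, S f -> S (comp f (em W (bub p c))).

Let M := mor W W2 [:: Max Up p.+1].
Let N := mor W2 W [:: Min p.+1].
Let s := em W2 [:: Cross p].
Let x1 := em W2 (dot Up p.+1).
Let x0 := em W2 (dot Up p).
Let x := em W (dot Up p).

Let locW : loc W p [:: Up]. Proof. by exists a, r. Qed.
Let loc0 : loc W2 p [:: Up; Up]. Proof. by exists a, (Down :: r). Qed.
Let loc01 : loc W2 p [:: Up]. Proof. by exists a, (Up :: Down :: r). Qed.
Let loc1 : loc W2 p.+1 [:: Up].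
Proof. by exists (a ++ [:: Up]), (Down :: r); rewrite -catA size_cat addn1. Qed.

Let rx : run W (dot Up p) = Some W.
Proof. by rewrite dotE; apply: loc_run locW (run_dot1 _) erefl. Qed.
Let rx0 : run W2 (dot Up p) = Some W2.
Proof. by rewrite dotE; apply: loc_run loc01 (run_dot1 _) erefl. Qed.
Let rx1 : run W2 (dot Up p.+1) = Some W2.
Proof. by rewrite dotE; apply: loc_run loc1 (run_dot1 _) erefl. Qed.
Let rs : run W2 [:: Cross p] = Some W2.
Proof. by rewrite crossE; apply: loc_run loc0 _ erefl. Qed.
Let rM : run W [:: Max Up p.+1] = Some W2.
Proof. by have := run_shift a r (erefl : run [:: Up] [:: Max Up 1] = Some [:: Up; Up; Down]);
  rewrite shift1 /= addn1. Qed.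
Let rN : run W2 [:: Min p.+1] = Some W.
Proof. by have := run_shift a r (erefl : run [:: Up; Up; Down] [:: Min 1] = Some [:: Up]); rewrite
  shift1 /= addn1. Qed.

Let ss : s * s = 1. Proof. exact: em_ss loc0. Qed.
Let sx1 : s * x1 = x0 * s - 1. Proof. exact: em_sx loc0. Qed.
Let xx : x0 * x1 = x1 * x0. Proof. exact: em_xC loc01 loc1 _. Qed.

Let x1s : x1 * s = s * x0 - 1.
Proof.
rewrite -[LHS]mul1r -{1}ss -mulrA [s * (x1 * s)]mulrA sx1 mulrBl mul1r mulrBr -!mulrA.
by rewrite ss mulr1.
Qed.

Let x0N : comp x0 N = comp N x.
Proof.
rewrite /x0 /N /x /endmor !comp_mor //; apply: sim_mor.
have h := sim_exchange0 (K := K) (run_dot1 Up) (erefl : run [:: Up; Down] [:: Min 0] = Some [::]).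
by have := sim_widen a r h; rewrite !shift_cat shift_dot /= addn0 addn1.
Qed.

Let Mx0 : comp M x0 = comp x M.
Proof.
rewrite /x0 /M /x /endmor !comp_mor //; apply: sim_mor.
have h := sim_exchange0 (K := K) (run_dot1 Up) (erefl : run [::] [:: Max Up 0] = Some [:: Up;
  Down]).
by have := sim_sym (sim_widen a r h); rewrite !shift_cat shift_dot /= !addn0 !addn1.
Qed.

Let Mx0X d : comp M (x0 ^+ d) = comp (x ^+ d : EndHeis K W) M.
Proof.
elim: d => [|d IH]; first by rewrite !expr0 comp1 comp1'.
by rewrite exprSr compM IH exprSr compM' -Mx0 Defs.compA.
Qed.

Let x0X_x1X c d : x1 ^+ c * x0 ^+ d = x0 ^+ d * x1 ^+ c.
Proof. by apply: GRing.commrX; apply: GRing.commr_sym; apply: GRing.commrX. Qed.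

Let SX d f : S f -> S (comp f (x ^+ d)).
Proof.
move=> Sf; elim: d => [|d IH]; first by rewrite expr0 comp1.
by rewrite exprSr compM; apply: Sx.
Qed.

(** A right curl carrying [c] dots on its loop, hence a plain dot for [c = 0]; [bR c] is the dotted
    circle to the right of the strand. Moving one dot off the loop of [kappa c.+1] costs a
    [bR c]. *)
Let kappa c : Heis W W := comp M (comp (x1 ^+ c * s) N).
Let bR c : Heis W W := comp M (comp (x1 ^+ c) N).

Let kappaS c : kappa c.+1 = comp (kappa c) x - bR c.
Proof.
rewrite /kappa /bR exprSr -mulrA x1s mulrBr mulr1 compBl compBr; congr (_ - _).
by rewrite mulrA [in LHS]compM' x0N !Defs.compA.
Qed.

Let kappa0 : kappa 0 = x.
Proof.
rewrite /kappa expr0 mul1r /M /N /s /x /endmor comp_mor ?comp_mor //.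
by rewrite run_cat rs.
Qed.

Let through d : comp M (comp (s * x0 ^+ d * s) N) = em W (bub p d) - x ^+ d.
Proof.
rewrite /x0 /x /s !em_pow // !emM ?run_cat ?rs ?run_pow //.
have rD : run W2 (([:: Cross p] ++ flatten (nseq d (dot Up p))) ++ [:: Cross p]) = Some W2.
  by rewrite !run_cat rs run_pow.
rewrite /M /N /endmor !comp_mor ?run_cat ?rD //.
have e0 : loc W p [:: Up] by [].
have := em_local e0 (sim_bubble d).
rewrite !big_cons !big_nil !addr0 !scale1r scaleN1r /= !shift_cat /= shift_dpow !addn0 !addn1.
rewrite /bub /dpow /= -!catA => h.
- exact: h.
- by rewrite rs run_pow // rs.
- by rewrite rs run_pow // rs.
Qed.

(** Strong induction on the number of dots, treating curls and circles together since each is needed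
    to reduce the other. *)
Let main c : (forall f, S f -> S (comp f (kappa c))) /\ (forall f, S f -> S (comp f (bR c))).
Proof.
elim/ltn_ind: c => c IH.
have hk f : S f -> S (comp f (kappa c)).
  case: c IH => [|c] IH Sf; first by rewrite kappa0; apply: Sx.
  rewrite kappaS compBr; have [h1 h2] := IH c (ltnSn _).
  by apply: (subspaceB Ssub); [rewrite Defs.compA; apply: Sx; apply: h1 | apply: h2].
(* As [s * s = 1], the circle is [G c 0]. Its dots enter between the two crossings one by one, each
   at the cost of a curl with fewer dots; in [G 0 d] the circle is pulled to the left of the strand
   by [through]. *)
split=> // f Sf; pose G j d := comp f (comp M (comp (x1 ^+ j * s * x0 ^+ d * s) N)).
have G0 d : S (G 0 d).
  rewrite /G expr0 mul1r through compBr; apply: (subspaceB Ssub); first exact: Sb.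
  exact: SX.
have GS j d : (j <= c)%N -> S (G j d).
  elim: j d => // j IHj d lt.
  have -> : G j.+1 d = G j d.+1 - comp (comp f (x ^+ d)) (kappa j).
    rewrite /G exprSr -[x1 ^+ j * x1 * s]mulrA x1s mulrBr mulr1 2!mulrBl compBl 2!compBr.
    congr (_ - _); first by rewrite exprS !mulrA.
    rewrite x0X_x1X -mulrA compM' [comp M _]Defs.compA Mx0X -[in RHS]Defs.compA.
    by rewrite /kappa !Defs.compA.
  apply: (subspaceB Ssub); first by apply: IHj; lia.
  by apply: (IH j lt).1; apply: SX.
have := GS c 0%N (leqnn c); rewrite /G expr0 mulr1 -mulrA ss mulr1; exact.
Qed.

Lemma bubble_step c f : S f -> S (comp f (em W (bub p.+1 c))).
Proof.
move=> Sf; have := (main c).2 f Sf; rewrite /bR /x1 em_pow // /M /N /endmor.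
by rewrite !comp_mor // ?run_cat ?run_pow.
Qed.

End BubbleStep.
End Bubbles.

(** * The two Hecke algebras acting on a sorted word *)

Section Levels.
Variable K : fieldType.
Local Notation Heis := (Heis K).
Local Notation mor := (mor K).
Local Notation comp := (@Defs.comp K _ _ _).
Local Notation em := (@endmor K).

Lemma loc_up n i l : (i + l <= n)%N -> loc (P n) i (nseq l Up).
Proof.
move=> le; exists (nseq i Up), (nseq (n - i - l) Up ++ nseq n Down); rewrite size_nseq.
by split=> //; rewrite catA -nseqD catA -nseqD /P; congr (nseq _ _ ++ _); lia.
Qed.

Lemma loc_down n i l : (n <= i)%N -> (i + l <= n + n)%N -> loc (P n) i (nseq l Down).
Proof.
move=> ge le; exists (nseq n Up ++ nseq (i - n) Down), (nseq (n + n - i - l) Down).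
rewrite size_cat !size_nseq; split; last by lia.
by rewrite -catA /P -!nseqD; congr (_ ++ nseq _ _); lia.
Qed.

(** The strands of [P n] are counted from the outside: the downward ones from the
    right. *)
Definition up_cross n i : EndHeis K (P n) := em (P n) [:: Cross i].
Definition up_dot n i : EndHeis K (P n) := em (P n) (dot Up i).
Definition down_cross n i : EndHeis K (P n) := em (P n) [:: Cross ((n + n).-2 - i)].
Definition down_dot n i : EndHeis K (P n) := em (P n) (dot Down ((n + n).-1 - i)).

Definition hecke_up n := hecke (up_cross n) (up_dot n).
Definition hecke_dn n := hecke (down_cross n) (down_dot n).
Arguments hecke_up n : clear implicits.
Arguments hecke_dn n : clear implicits.

Lemma run_s_up n i : (i.+1 < n)%N -> run (P n) [:: Cross i] = Some (P n).
Proof. by move=> h; rewrite run_cons step_P_up. Qed.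

Lemma run_x_up n i : (i < n)%N -> run (P n) (dot Up i) = Some (P n).
Proof.
by move=> h; rewrite dotE; apply: (@loc_run _ _ [:: Up]) (run_dot1 _) erefl; apply: (loc_up (l :=
  1)); lia.
Qed.

Lemma run_s_dn n i : (i.+1 < n)%N -> run (P n) [:: Cross ((n + n).-2 - i)] = Some (P n).
Proof.
move=> h; have -> : ((n + n).-2 - i = n + (n.-2 - i))%N by lia.
by rewrite run_cons step_P_down //; lia.
Qed.

Lemma run_x_dn n i : (i < n)%N -> run (P n) (dot Down ((n + n).-1 - i)) = Some (P n).
Proof.
move=> h; rewrite dotE; apply: (@loc_run _ _ [:: Down]) (run_dot1 _) erefl.
apply: (loc_down (l := 1)); lia.
Qed.

Lemma hecke_cosetP_up n u : hecke_up n.+1 n.+1 u ->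
  zspan (hecke_coset (up_cross n.+1) (up_dot n.+1) n) u.
Proof.
apply: (@hecke_cosetP _ _ _ n.+1) => // [i h|i h|i j h h'|i j h h'|i j h h'|i j h h'|i h].
- by apply: em_ss; apply: (loc_up (l := 2)); lia.
- by apply: em_braid; apply: (loc_up (l := 3)); lia.
- by apply: em_sC => //; apply: (loc_up (l := 2)); lia.
- by apply: em_xC => //; apply: (loc_up (l := 1)); lia.
- by apply: em_sxC => //; [apply: (loc_up (l := 2)) | apply: (loc_up (l := 1))]; lia.
- by apply: em_xsC => //; [apply: (loc_up (l := 2)) | apply: (loc_up (l := 1))]; lia.
- by apply: em_sx; apply: (loc_up (l := 2)); lia.
Qed.

(** Counting from the right reverses all positions, so the relations enter in mirrored form, with
    [em_sy] in place of [em_sx]. *)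
Lemma hecke_cosetP_dn n u : hecke_dn n.+1 n.+1 u ->
  zspan (hecke_coset (down_cross n.+1) (down_dot n.+1) n) u.
Proof.
set N := n.+1.
apply: (@hecke_cosetP _ _ _ n.+1) => // [i h|i h|i j h h'|i j h h'|i j h h'|i j h h'|i h]; rewrite
  /down_cross /down_dot.
- by apply: (@em_ss _ _ Down); apply: (loc_down (l := 2)); lia.
- have -> : ((N + N).-2 - i = ((N + N).-2 - i.+1).+1)%N by lia.
  by apply/esym/(@em_braid _ _ Down); apply: (loc_down (l := 3)); lia.
- by apply/esym; apply: (@em_sC _ _ Down); try lia; apply: (loc_down (l := 2)); lia.
- by apply/esym; apply: em_xC; try lia; apply: (loc_down (l := 1)); lia.
- by apply/esym; apply: em_xsC; try lia; [apply: (loc_down (l := 2)) | apply: (loc_down (l :=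
    1))]; lia.
- by apply/esym; apply: em_sxC; try lia; [apply: (loc_down (l := 2)) | apply: (loc_down (l :=
    1))]; lia.
- have -> : ((N + N).-1 - i.+1 = (N + N).-2 - i)%N by lia.
  have -> : ((N + N).-1 - i = ((N + N).-2 - i).+1)%N by lia.
  by apply: em_sy; apply: (loc_down (l := 2)); lia.
Qed.

Lemma hecke_up_dn n a b u v : (a <= n)%N -> (b <= n)%N -> hecke_up n a u -> hecke_dn n b v ->
  u * v = v * u.
Proof.
move=> an bn hu hv; apply: subring_gen_comm hu => g hg; apply/esym.
apply: subring_gen_comm hv => g' hg'; apply/esym.
have lu : exists i l d, [/\ (i + size l <= n)%N, loc (P n) i l, run l d = Some l & g = em (P n)
  (shift i d)].
  case: hg => -[i h ->].
    exists i, [:: Up; Up], [:: Cross 0]; rewrite /up_cross (crossE i); split=> //; first by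
      rewrite /=; lia.
    by apply: (loc_up (l := 2)); lia.
  exists i, [:: Up], (dot Up 0); rewrite /up_dot (dotE _ i); split=> //; first by rewrite /=; lia.
  by apply: (loc_up (l := 1)); lia.
have lv : exists i l d, [/\ (n <= i)%N, loc (P n) i l, run l d = Some l & g' = em (P n) (shift i
  d)].
  case: hg' => -[i h ->].
    exists ((n + n).-2 - i)%N, [:: Down; Down], [:: Cross 0]; rewrite /down_cross (crossE (_ -
      i)); split=> //; first by lia.
    by apply: (loc_down (l := 2)); lia.
  exists ((n + n).-1 - i)%N, [:: Down], (dot Down 0); rewrite /down_dot (dotE _ (_ - i)); split=>
    //; first by lia.
  by apply: (loc_down (l := 1)); lia.
case: lu => i [l [d [h1 h2 h3 ->]]]; case: lv => i' [l' [d' [h1' h2' h3' ->]]].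
by apply: em_comm h2 h2' _ h3 h3'; lia.
Qed.

Definition capP m : Heis (P m) (P m.+1) := mor _ _ [:: Max Up m].
Definition cupP m : Heis (P m.+1) (P m) := mor _ _ [:: Min m].

Lemma run_capP m : run (P m) [:: Max Up m] = Some (P m.+1).
Proof. by rewrite run_cons step_P_max. Qed.

Lemma run_cupP m : run (P m.+1) [:: Min m] = Some (P m).
Proof. by rewrite run_cons step_P_min. Qed.

(** An endomorphism [g0] of [P m] continuing as [g1] beside the innermost cap. *)
Definition beside m (g0 : EndHeis K (P m)) (g1 : EndHeis K (P m.+1)) : Prop :=
  comp g0 (capP m) = comp (capP m) g1 /\ comp g1 (cupP m) = comp (cupP m) g0.

Lemma beside_left m i l d : loc (P m) i l -> (i + size l <= m)%N -> run l d = Some l ->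
  beside (em (P m) (shift i d)) (em (P m.+1) (shift i d)).
Proof.
move=> [a [r [ew sa]]] le rd.
have [t [er eU]] : exists t, r = t ++ nseq m Down /\ nseq m Up = a ++ l ++ t.
  have : (a ++ l) ++ r = nseq m Up ++ nseq m Down by rewrite -catA -ew.
  case/cat_eq_split => -[t [e1 e2]]; first by exists t; split; rewrite // e1 -catA.
  have t0 : t = [::].
    by apply: size0nil; have := congr1 size e1; rewrite !size_cat size_nseq; lia.
  by subst t; exists [::]; rewrite cats0 in e1; rewrite e2 cats0 e1.
have ew' : P m.+1 = a ++ l ++ (t ++ [:: Up; Down] ++ nseq m Down).
  by rewrite P_succ eU -!catA.
have sm : m = (size a + (size l + size t))%N by rewrite -!size_cat -eU size_nseq.
have r0 : run (P m) (shift i d) = Some (P m) by rewrite ew -sa; apply: run_frame.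
have r1 : run (P m.+1) (shift i d) = Some (P m.+1) by rewrite ew' -sa; apply: run_frame.
have rc := run_capP m; have rc' := run_cupP m.
split; rewrite /capP /cupP /endmor !comp_mor //; apply: sim_mor.
  have := sim_exchange (K := K) t rd (erefl : run [::] [:: Max Up 0] = Some [:: Up; Down]).
  move/(sim_widen a (nseq m Down)); rewrite !shift_cat !shift_shift /= addn0 -sm sa.
  by rewrite ew er -!catA.
have := sim_exchange (K := K) t rd (erefl : run [:: Up; Down] [:: Min 0] = Some [::]).
move/(sim_widen a (nseq m Down)); rewrite !shift_cat !shift_shift /= addn0 -sm sa.
by rewrite ew' -!catA.
Qed.

Lemma beside_right m i l d : loc (P m) i l -> (m <= i)%N -> run l d = Some l ->
  beside (em (P m) (shift i d)) (em (P m.+1) (shift i.+2 d)).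
Proof.
move=> [a [r [ew sa]]] ge rd.
have [t [ea eD]] : exists t, a = nseq m Up ++ t /\ nseq m Down = t ++ l ++ r.
  have : nseq m Up ++ nseq m Down = a ++ (l ++ r) by [].
  case/cat_eq_split => -[t [e1 e2]]; first by exists t.
  have t0 : t = [::].
    by apply: size0nil; have := congr1 size e1; rewrite !size_cat size_nseq; lia.
  by subst t; exists [::]; rewrite cats0 in e1; rewrite e1 cats0 e2.
have ew0 : P m = nseq m Up ++ t ++ l ++ r by rewrite ew ea -catA.
have ew' : P m.+1 = nseq m Up ++ [:: Up; Down] ++ t ++ l ++ r by rewrite P_succ eD.
have sm : i = (m + size t)%N by rewrite -sa ea size_cat size_nseq.
have r0 : run (P m) (shift i d) = Some (P m) by rewrite ew -sa; apply: run_frame.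
have r1 : run (P m.+1) (shift i.+2 d) = Some (P m.+1).
  have e : P m.+1 = (nseq m Up ++ [:: Up; Down] ++ t) ++ l ++ r by rewrite ew' -!catA.
  rewrite e; have -> : i.+2 = size (nseq m Up ++ [:: Up; Down] ++ t).
    by rewrite !size_cat size_nseq /=; lia.
  exact: run_frame.
have rc := run_capP m; have rc' := run_cupP m.
split; rewrite /capP /cupP /endmor !comp_mor //; apply: sim_mor.
  have := sim_sym (sim_exchange (K := K) t (erefl : run [::] [:: Max Up 0] = Some [:: Up; Down])
    rd).
  move/(sim_widen (nseq m Up) r); rewrite !shift_cat !shift_shift size_nseq -!catA /= addn0 -ew0.
  have -> : (m + (2 + size t) = i.+2)%N by lia.
  by have -> : (m + (0 + size t) = i)%N by lia.
have := sim_sym (sim_exchange (K := K) t (erefl : run [:: Up; Down] [:: Min 0] = Some [::]) rd).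
move/(sim_widen (nseq m Up) r); rewrite !shift_cat !shift_shift size_nseq -!catA /= addn0 -ew'.
have -> : (m + (2 + size t) = i.+2)%N by lia.
by have -> : (m + (0 + size t) = i)%N by lia.
Qed.

Lemma beside_s_up m i : (i.+1 < m)%N -> beside (up_cross m i) (up_cross m.+1 i).
Proof.
by move=> h; rewrite /up_cross crossE; apply: (@beside_left m i [:: Up; Up]) => //=; [apply:
  (loc_up (l := 2)) |]; lia.
Qed.

Lemma beside_x_up m i : (i < m)%N -> beside (up_dot m i) (up_dot m.+1 i).
Proof.
by move=> h; rewrite /up_dot dotE; apply: (@beside_left m i [:: Up]) => //=; [apply: (loc_up (l :=
  1)) |]; lia.
Qed.

Lemma beside_s_dn m i : (i.+1 < m)%N -> beside (down_cross m i) (down_cross m.+1 i).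
Proof.
move=> h; rewrite /down_cross.
have -> : ((m.+1 + m.+1).-2 - i = ((m + m).-2 - i).+2)%N by lia.
rewrite crossE [in X in _ X](crossE (_.+2)).
by apply: (@beside_right m _ [:: Down; Down]) => //=; [apply: (loc_down (l := 2)) |]; lia.
Qed.

Lemma beside_x_dn m i : (i < m)%N -> beside (down_dot m i) (down_dot m.+1 i).
Proof.
move=> h; rewrite /down_dot.
have -> : ((m.+1 + m.+1).-1 - i = ((m + m).-1 - i).+2)%N by lia.
rewrite dotE [dot Down _.+2]dotE.
by apply: (@beside_right m _ [:: Down]) => //=; [apply: (loc_down (l := 1)) |]; lia.
Qed.

Lemma beside1 m : @beside m 1 1.
Proof. by split; rewrite comp1 comp1'. Qed.
Lemma besideB m (g0 h0 : EndHeis K (P m)) g1 h1 : beside g0 g1 -> beside h0 h1 -> beside (g0 - h0)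
  (g1 - h1).
Proof. by move=> [a b] [c d]; split; rewrite !compBl !compBr ?a ?b ?c ?d. Qed.
Lemma besideM m (g0 h0 : EndHeis K (P m)) g1 h1 : beside g0 g1 -> beside h0 h1 -> beside (g0 * h0)
  (g1 * h1).
Proof.
move=> [a b] [c d]; split; rewrite ?compM ?compM'.
  by rewrite c !Defs.compA a.
by rewrite d !Defs.compA b.
Qed.
End Levels.
Arguments hecke_up {K} n _ _.
Arguments hecke_dn {K} n _ _.

(** * Extending stable subspaces to wider words *)

Section Extension.
Variable K : fieldType.
Local Notation Heis := (Heis K).
Local Notation mor := (mor K).
Local Notation comp := (@Defs.comp K _ _ _).
Local Notation eqv := (eqv K).
Local Notation sim := (sim K).
Local Notation em := (@endmor K).
Local Notation s_up := (@up_cross K).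
Local Notation x_up := (@up_dot K).
Local Notation s_dn := (@down_cross K).
Local Notation x_dn := (@down_dot K).
Variable X : word.

Definition stable w (S : Heis X w -> Prop) (g : EndHeis K w) := forall f, S f -> S (comp f g).

(** Closure under everything that keeps the width. Circles are required only at the left edge;
    [level_bub] moves them further right. *)
Record level n (S : Heis X (P n) -> Prop) : Prop := Level {
  lv_sub : subspace S;
  lv_s_up : forall i, (i.+1 < n)%N -> stable S (s_up n i);
  lv_x_up : forall i, (i < n)%N -> stable S (x_up n i);
  lv_s_dn : forall i, (i.+1 < n)%N -> stable S (s_dn n i);
  lv_x_dn : forall i, (i < n)%N -> stable S (x_dn n i);
  lv_bub : forall c, stable S (em (P n) (bub 0 c)) }.

Lemma stable1 w (S : Heis X w -> Prop) : stable S 1.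
Proof. by move=> f; rewrite comp1. Qed.
Lemma stableB w (S : Heis X w -> Prop) g h : subspace S -> stable S g -> stable S h -> stable S (g
  - h).
Proof. by move=> sS a b f Sf; rewrite compBr; apply: (subspaceB sS); [apply: a | apply: b]. Qed.
Lemma stableM w (S : Heis X w -> Prop) g h : stable S g -> stable S h -> stable S (g * h).
Proof. by move=> a b f Sf; rewrite compM; apply: b; apply: a. Qed.

Lemma stable_gen w (S : Heis X w -> Prop) (G : EndHeis K w -> Prop) u : subspace S ->
  (forall g, G g -> stable S g) -> subring_gen G u -> stable S u.
Proof.
move=> sS h; elim=> [|v1 v2 _ IH1 _ IH2|v g _ IH /h Gg]; first exact: stable1.
  exact: stableB.
exact: stableM.
Qed.

Lemma stable_up n (S : Heis X (P n) -> Prop) a u : level S -> (a <= n)%N -> hecke_up n a u ->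
  stable S u.
Proof.
move=> lS le; apply: (stable_gen (lv_sub lS)) => g [[i h ->]|[i h ->]].
  by apply: (lv_s_up lS); lia.
by apply: (lv_x_up lS); lia.
Qed.

Lemma stable_dn n (S : Heis X (P n) -> Prop) a u : level S -> (a <= n)%N -> hecke_dn n a u ->
  stable S u.
Proof.
move=> lS le; apply: (stable_gen (lv_sub lS)) => g [[i h ->]|[i h ->]].
  by apply: (lv_s_dn lS); lia.
by apply: (lv_x_dn lS); lia.
Qed.

Lemma bubble_step_loc w p (S : Heis X w -> Prop) : loc w p [:: Up] -> subspace S ->
  stable S (em w (dot Up p)) -> (forall c, stable S (em w (bub p c))) ->
  forall c, stable S (em w (bub p.+1 c)).
Proof.
case=> a [r [e sa]]; subst p w => sS Sx Sb c f.
by apply: (bubble_step sS Sx) => c' f'; apply: Sb.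
Qed.

Lemma level_bub n (S : Heis X (P n) -> Prop) p c : level S -> (p <= n)%N -> stable S (em (P n)
  (bub p c)).
Proof.
move=> lS; elim: p c => [|p IH] c le; first exact: (lv_bub lS).
apply: bubble_step_loc (lv_sub lS) _ _ _.
- by apply: (loc_up (l := 1)); lia.
- by apply: (lv_x_up lS).
- by move=> c'; apply: IH; lia.
Qed.

Section Cup.
Variables (m : nat) (S : Heis X (P m) -> Prop).
Hypothesis lS : level S.
Hypothesis S_mid : (0 < m)%N -> stable S (em (P m) [:: Min m.-1; Max Up m.-1]).

(** A partial trace: the two middle strands of [z] are closed by the innermost cap and cup. *)
Definition sandwich (z : EndHeis K (P m.+1)) : EndHeis K (P m) :=
  comp (@capP K m) (comp z (@cupP K m)).

Lemma sandwichB z z' : sandwich (z - z') = sandwich z - sandwich z'.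
Proof. by rewrite /sandwich compBl compBr. Qed.

Lemma sandwichMl g0 g1 z : beside g0 g1 -> sandwich (g1 * z) = g0 * sandwich z.
Proof.
move=> [h _]; rewrite /sandwich compM' Defs.compA -h -[g0 * _]/(comp g0 _).
by rewrite !Defs.compA.
Qed.

Lemma sandwichMr g0 g1 z : beside g0 g1 -> sandwich (z * g1) = sandwich z * g0.
Proof.
by move=> [_ h]; rewrite /sandwich compM' h -[_ * g0]/(comp _ g0) !Defs.compA.
Qed.

Let x := x_up m.+1 m.
Let y := x_dn m.+1 m.
Let s := s_up m.+1 m.-1.
Let t := s_dn m.+1 m.-1.

(** A dot slides over the cap from one leg to the other. So dots on both middle strands can be
    collected on the upward one. *)
Let capxy : comp (@capP K m) y = comp (@capP K m) x.
Proof.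
have rx := @run_x_up m.+1 m (ltnSn m); have ry := @run_x_dn m.+1 m (ltnSn m).
rewrite /capP /x /y /up_dot /down_dot /endmor !comp_mor ?run_capP //; apply: sim_mor.
have e : sim [::] ([:: Max Up 0] ++ dot Down 1) ([:: Max Up 0] ++ dot Up 0).
  by apply: (skein_check K (P := [:: At 1; At 0; Skip; At 1; Skip])); vm_compute.
have := sim_widen (nseq m Up) (nseq m Down) e.
rewrite !shift_cat !shift_dot size_nseq /= addn0 addn1.
by have -> : ((m.+1 + m.+1).-1 - m = m.+1)%N by lia.
Qed.

Let xy (z w : EndHeis K (P m.+1)) : hecke_up m.+1 m.+1 z -> hecke_dn m.+1 m.+1 w -> z * w = w * z.
Proof. exact: hecke_up_dn. Qed.

Let hx : hecke_up m.+1 m.+1 x. Proof. exact: hecke_x. Qed.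
Let hy : hecke_dn m.+1 m.+1 y. Proof. exact: hecke_x. Qed.
Let hs : (0 < m)%N -> hecke_up m.+1 m.+1 s. Proof. by move=> h; apply: hecke_s; lia. Qed.
Let ht : (0 < m)%N -> hecke_dn m.+1 m.+1 t. Proof. by move=> h; apply: hecke_s; lia. Qed.

Let cap_pow c : comp (@capP K m) (y ^+ c) = comp (@capP K m) (x ^+ c).
Proof.
elim: c => [|c IH]; first by rewrite !expr0.
rewrite exprSr compM IH exprS compM -capxy -!compM xy ?exprS //.
exact: subring_gen_exp.
Qed.

Let sandwich_pow c z : sandwich (y ^+ c * z) = sandwich (x ^+ c * z).
Proof. by rewrite /sandwich !compM' !Defs.compA cap_pow. Qed.

Let xs : (0 < m)%N -> x * s = s * x_up m.+1 m.-1 - 1.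
Proof.
move=> m0; have h : loc (P m.+1) m.-1 [:: Up; Up] by apply: (loc_up (l := 2)); lia.
have e := em_ss K h; have e' := em_sx K h.
have -> : x = em (P m.+1) (dot Up m.-1.+1) by rewrite /x /up_dot prednK.
rewrite /s /up_cross /up_dot -[LHS]mul1r -{1}e -mulrA [X in _ * X]mulrA e'.
by rewrite mulrBl mul1r mulrBr -!mulrA e mulr1.
Qed.

Let yt : (0 < m)%N -> y * t = t * x_dn m.+1 m.-1 - 1.
Proof.
move=> m0; set q := ((m.+1 + m.+1).-2 - m.-1)%N.
have h : loc (P m.+1) q [:: Down; Down] by apply: (loc_down (l := 2)); rewrite /q; lia.
have e := em_ss K h; have e' := em_sy K h.
have -> : y = em (P m.+1) (dot Down q) by rewrite /y /down_dot /q; congr (em _ (dot _ _)); lia.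
have -> : x_dn m.+1 m.-1 = em (P m.+1) (dot Down q.+1).
  by rewrite /down_dot /q; congr (em _ (dot _ _)); lia.
rewrite /t /down_cross -/q -[LHS]mul1r -{1}e -mulrA [X in _ * X]mulrA e'.
by rewrite mulrBl mul1r mulrBr -!mulrA e mulr1.
Qed.

Let stable_x : (0 < m)%N -> stable S (x_up m m.-1).
Proof. by move=> m0; apply: (lv_x_up lS); lia. Qed.
Let stable_y : (0 < m)%N -> stable S (x_dn m m.-1).
Proof. by move=> m0; apply: (lv_x_dn lS); lia. Qed.
Let bx : (0 < m)%N -> beside (x_up m m.-1) (x_up m.+1 m.-1).
Proof. by move=> m0; apply: beside_x_up; lia. Qed.
Let by' : (0 < m)%N -> beside (x_dn m m.-1) (x_dn m.+1 m.-1).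
Proof. by move=> m0; apply: beside_x_dn; lia. Qed.

Let sandwich_em d : run (P m.+1) d = Some (P m.+1) ->
  sandwich (em (P m.+1) d) = em (P m) ([:: Max Up m] ++ d ++ [:: Min m]).
Proof.
move=> r; rewrite /sandwich /capP /cupP /endmor comp_mor ?run_cupP //.
by rewrite comp_mor ?run_capP // run_cat r run_cupP.
Qed.

Let core0 c : stable S (sandwich (x ^+ c)).
Proof.
rewrite /x /up_dot em_pow ?run_x_up // sandwich_em ?run_pow ?run_x_up //.
exact: (level_bub (p := m)).
Qed.

(** Moving a dot past [s] sends it to an outer strand, where it leaves the sandwich, or removes the
    crossing and leaves a circle. Without dots the closed crossing is a right curl, that is, a
    dot. *)
Let core_s c : (0 < m)%N -> stable S (sandwich (x ^+ c * s)).
Proof.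
move=> m0; elim: c => [|c IH]; last first.
  rewrite exprSr -mulrA xs // mulrBr mulr1 sandwichB; apply: stableB; first exact: (lv_sub lS).
    by rewrite mulrA (sandwichMr _ (bx m0)); apply: stableM => //; exact: stable_x.
  exact: core0.
rewrite mul1r /s /up_cross sandwich_em ?run_s_up //; last by lia.
by have := stable_x m0; rewrite /up_dot /dot (prednK m0).
Qed.

Let core_t c : (0 < m)%N -> stable S (sandwich (x ^+ c * t)).
Proof.
move=> m0; rewrite -sandwich_pow; elim: c => [|c IH]; last first.
  rewrite exprSr -mulrA yt // mulrBr mulr1 sandwichB; apply: stableB; first exact: (lv_sub lS).
    by rewrite mulrA (sandwichMr _ (by' m0)); apply: stableM => //; exact: stable_y.
  by rewrite -[y ^+ c]mulr1 sandwich_pow mulr1; apply: core0.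
rewrite mul1r /t /down_cross sandwich_em ?run_s_dn //; last by lia.
have := stable_y m0; rewrite /down_dot /dot.
have -> : ((m + m).-1 - m.-1 = m)%N by lia.
by have -> : ((m.+1 + m.+1).-2 - m.-1 = m.+1)%N by lia.
Qed.

(** Without dots, the closed middle strands cross both neighbours and the bigon relation gives a cup
    over a cap minus the identity. This is what [S_mid] is for. *)
Let core_st c : (0 < m)%N -> stable S (sandwich (x ^+ c * s * t)).
Proof.
move=> m0; elim: c => [|c IH]; last first.
  have hxm : hecke_up m.+1 m.+1 (x_up m.+1 m.-1) by apply: hecke_x; lia.
  rewrite exprSr -[x ^+ c * x * s]mulrA xs // mulrBr mulr1 mulrBl sandwichB.
  apply: stableB; [exact: (lv_sub lS) | | exact: core_t].
  rewrite mulrA -[_ * t]mulrA (xy hxm (ht m0)) mulrA (sandwichMr _ (bx m0)).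
  by apply: stableM => //; exact: stable_x.
have r1 : run (P m.+1) [:: Cross m.-1] = Some (P m.+1) by apply: run_s_up; lia.
have r2 : run (P m.+1) [:: Cross ((m.+1 + m.+1).-2 - m.-1)] = Some (P m.+1).
  by apply: run_s_dn; lia.
rewrite mul1r /s /t /up_cross /down_cross emM // sandwich_em; last by rewrite run_cat r1.
have -> : ((m.+1 + m.+1).-2 - m.-1 = m.+1)%N by lia.
have h : loc (P m) m.-1 [:: Up; Down].
  case: (m) m0 => // n _; exists (nseq n Up), (nseq n Down); rewrite size_nseq P_succ.
  by split.
have e : eqv [:: Up; Down] [:: (1, [:: Max Up 1; Cross 0; Cross 2; Min 1])]
    [:: (1, [:: Min 0; Max Up 0]); (-1, [::])].
  apply: (skein_check K (P := [:: At 0; At 2; At 1; Skip; At 0; At 0; Skip; Left 0; Skip; Skip])).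
  by vm_compute.
have := em_local h e; rewrite !big_cons !big_nil !addr0 !scale1r scaleN1r /= !addn0.
rewrite !addn1 (prednK m0).
have -> : (m.-1 + 2 = m.+1)%N by lia.
by move=> ->; apply: stableB; [exact: (lv_sub lS) | exact: S_mid | exact: stable1].
Qed.

Let core c b b' : (b || b' -> 0 < m)%N ->
  stable S (sandwich (x ^+ c * hecke_cross (s_up m.+1) m b * hecke_cross (s_dn m.+1) m b')).
Proof.
case: b; case: b' => h; rewrite /hecke_cross ?mulr1.
- by apply: core_st; apply: h.
- by apply: core_s; apply: h.
- by apply: core_t; apply: h.
- exact: core0.
Qed.

(** Elements avoiding the two middle strands pass the cap and the cup; they become elements of the
    narrower word. *)
Let up_beside a (u : EndHeis K _) : (a <= m)%N -> hecke_up m.+1 a u -> exists2 u0, hecke_up m a u0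
  & beside u0 u.
Proof.
move=> le; elim=> [|v1 v2 _ [a1 h1 b1] _ [a2 h2 b2]|v g _ [a1 h1 b1] hg].
- by exists 1; [exact: subring_gen1 | exact: beside1].
- by exists (a1 - a2); [exact: subring_genB | exact: besideB].
- case: hg => -[i h ->].
    exists (a1 * s_up m i); last by apply: besideM => //; apply: beside_s_up; lia.
    by apply: subring_genM => //; left; exists i.
  exists (a1 * x_up m i); last by apply: besideM => //; apply: beside_x_up; lia.
  by apply: subring_genM => //; right; exists i.
Qed.

Let dn_beside a (u : EndHeis K _) : (a <= m)%N -> hecke_dn m.+1 a u -> exists2 u0, hecke_dn m a u0
  & beside u0 u.
Proof.
move=> le; elim=> [|v1 v2 _ [a1 h1 b1] _ [a2 h2 b2]|v g _ [a1 h1 b1] hg].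
- by exists 1; [exact: subring_gen1 | exact: beside1].
- by exists (a1 - a2); [exact: subring_genB | exact: besideB].
- case: hg => -[i h ->].
    exists (a1 * s_dn m i); last by apply: besideM => //; apply: beside_s_dn; lia.
    by apply: subring_genM => //; left; exists i.
  exists (a1 * x_dn m i); last by apply: besideM => //; apply: beside_x_dn; lia.
  by apply: subring_genM => //; right; exists i.
Qed.

Lemma hecke_up_leq a b (u : EndHeis K (P m.+1)) : (a <= b)%N -> hecke_up m.+1 a u -> hecke_up m.+1
  b u.
Proof.
by move=> le; apply: subring_gen_sub => g [[i h ->]|[i h ->]]; [left|right]; exists i => //; lia.
Qed.
Lemma hecke_dn_leq a b (u : EndHeis K (P m.+1)) : (a <= b)%N -> hecke_dn m.+1 a u -> hecke_dn m.+1
  b u.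
Proof.
by move=> le; apply: subring_gen_sub => g [[i h ->]|[i h ->]]; [left|right]; exists i => //; lia.
Qed.

Lemma cup_stable (u v : EndHeis K (P m.+1)) : hecke_up m.+1 m.+1 u -> hecke_dn m.+1 m.+1 v ->
  stable S (sandwich (u * v)).
Proof.
move=> /hecke_cosetP_up hu /hecke_cosetP_dn hv.
have sB (z z' : EndHeis K (P m.+1)) : stable S (sandwich z) -> stable S (sandwich z') -> stable S
  (sandwich (z - z')).
  by move=> h h'; rewrite sandwichB; apply: stableB => //; exact: (lv_sub lS).
have s0 : stable S (sandwich 0).
  by rewrite -(subrr 1); apply: sB; rewrite -(expr0 x); exact: core0.
elim: hu => [{}u hu||u1 u2 _ IH1 _ IH2]; [|by rewrite mul0r|by rewrite mulrBl; apply: sB].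
elim: hv => [{}v hv||v1 v2 _ IH1 _ IH2]; [|by rewrite mulr0|by rewrite mulrBr; apply: sB].
case: hu => u1 [c [b [u2 [hu1 hu2 hb ->]]]].
case: hv => v1 [d [b' [v2 [hv1 hv2 hb' ->]]]].
rewrite -/x -/y.
set p := hecke_cross _ _ b; set q := hecke_cross _ _ b'.
have hp : hecke_up m.+1 m.+1 p.
  by rewrite /p; case: (b) hb => [/(_ isT) m0|_]; [exact: hs | exact: subring_gen1].
have hq : hecke_dn m.+1 m.+1 q.
  by rewrite /q; case: (b') hb' => [/(_ isT) m0|_]; [exact: ht | exact: subring_gen1].
have hxc : hecke_up m.+1 m.+1 (x ^+ c) by apply: subring_gen_exp.
have hyd : hecke_dn m.+1 m.+1 (y ^+ d) by apply: subring_gen_exp.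
have wu := @hecke_up_leq m m.+1 _ (leqnSn m); have wd := @hecke_dn_leq m m.+1 _ (leqnSn m).
(* The upward and downward algebras commute, so the factors avoiding the middle strands can be
   collected on the outside, where they leave the sandwich. The dots [y ^+ d] are placed next to the
   cap and turn into dots [x] there. *)
have -> : u1 * x ^+ c * p * u2 * (v1 * y ^+ d * q * v2) =
    (u1 * v1) * (y ^+ d * (x ^+ c * p * q)) * (u2 * v2).
  have hu2' := wu _ hu2; have hv1' := wd _ hv1.
  rewrite -![in LHS]mulrA [u2 * (v1 * _)]mulrA (xy hu2' hv1') -[v1 * u2 * _]mulrA.
  rewrite [u2 * (y ^+ d * _)]mulrA (xy hu2' hyd) -[y ^+ d * u2 * _]mulrA.
  rewrite [u2 * (q * _)]mulrA (xy hu2' hq) -[q * u2 * _]mulrA.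
  rewrite [p * (v1 * _)]mulrA (xy hp hv1') -[v1 * p * _]mulrA.
  rewrite [x ^+ c * (v1 * _)]mulrA (xy hxc hv1') -[v1 * x ^+ c * _]mulrA.
  rewrite [p * (y ^+ d * _)]mulrA (xy hp hyd) -[y ^+ d * p * _]mulrA.
  rewrite [x ^+ c * (y ^+ d * _)]mulrA (xy hxc hyd) -[y ^+ d * x ^+ c * _]mulrA.
  by rewrite -!mulrA.
have [u1' hu1' bu1] := up_beside (leqnn m) hu1.
have [v1' hv1' bv1] := dn_beside (leqnn m) hv1.
have [u2' hu2' bu2] := up_beside (leqnn m) hu2.
have [v2' hv2' bv2] := dn_beside (leqnn m) hv2.
rewrite (sandwichMr _ (besideM bu2 bv2)) (sandwichMl _ (besideM bu1 bv1)) sandwich_pow.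
have su (w : EndHeis K _) (h : hecke_up m m w) := stable_up lS (leqnn m) h.
have sd (w : EndHeis K _) (h : hecke_dn m m w) := stable_dn lS (leqnn m) h.
apply: stableM; last by apply: stableM; [apply: su | apply: sd].
apply: stableM; first by apply: stableM; [apply: su | apply: sd].
rewrite !mulrA -exprD; apply: core.
by case/orP.
Qed.

End Cup.

Lemma run_bub c : run [::] (bub 0 c) = Some [::].
Proof.
rewrite -[LHS]/(run ([:: Up] ++ [:: Down]) (dpow Up 0 c ++ [:: Min 0])) run_cat.
by rewrite (run_frame0 [:: Down] (run_dpow1 Up c)).
Qed.

(** A closed diagram at the left edge is exchanged in height with the whole of [g]. No skein
    relation is involved, so dots make no difference. *)
Lemma bub_central w w' c (g : Heis w w') : comp g (em w' (bub 0 c)) = comp (em w (bub 0 c)) g.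
Proof.
elim/Heis_ind: g => [|a d g r IH]; first by rewrite comp0l comp0r.
rewrite comp_Pl comp_Pr IH /endmor; congr (_ *: _ + _).
have rb u : run u (bub 0 c) = Some u by have := run_frame0 u (run_bub c).
rewrite !comp_mor //; apply: sim_mor; apply: sim_sym.
by have := sim_exchange0 (K := K) (run_bub c) r; rewrite /= !shift0.
Qed.

Section Family.
Variables (k : nat) (S : forall n, Heis X (P n) -> Prop).
Arguments S : clear implicits.
Hypothesis S_level : forall n, (n <= k)%N -> level (S n).
Hypothesis S_cap : forall n f, (n < k)%N -> S n f -> S n.+1 (comp f (@capP K n)).
Hypothesis S_cup : forall n f, (n < k)%N -> S n.+1 f -> S n (comp f (@cupP K n)).

(** The least that a space at width [m + 1] must contain if it receives caps from [T] and is stable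
    under both Hecke algebras. *)
Definition capped m (T : Heis X (P m) -> Prop) : Heis X (P m.+1) -> Prop :=
  spanned (fun g => exists f u v, [/\ T f, hecke_up m.+1 m.+1 u, hecke_dn m.+1 m.+1 v
    & g = comp (comp f (@capP K m)) (u * v)]).

Fixpoint family n : Heis X (P n) -> Prop :=
  match n return Heis X (P n) -> Prop with
  | 0 => S 0
  | m.+1 => if (m < k)%N then S m.+1 else capped (@family m)
  end.
Arguments family : clear implicits.

Lemma familyE n : (n <= k)%N -> family n = S n.
Proof. by case: n => //= m ->. Qed.

Lemma family_cap m f : family m f -> family m.+1 (comp f (@capP K m)).
Proof.
rewrite /=; case: ltnP => [lt|_]; first by rewrite (familyE (ltnW lt)) //; apply: S_cap.
move=> h; apply: spanned_gen; exists f, 1, 1; split=> //; try exact: subring_gen1.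
by rewrite mul1r comp1.
Qed.

Lemma capped_level m (T : Heis X (P m) -> Prop) : level T -> level (capped T).
Proof.
move=> lT.
have sub (g : EndHeis K (P m.+1)) :
  (forall f u v, T f -> hecke_up m.+1 m.+1 u -> hecke_dn m.+1 m.+1 v ->
     capped T (comp (comp (comp f (@capP K m)) (u * v)) g)) -> stable (capped T) g.
  move=> h f; apply: (@spanned_sub _ _ _ (fun f => capped T (comp f g))).
    by apply: subspace_compl; exact: spanned_subspace.
  by move=> _ [f' [u [v [h1 h2 h3 ->]]]]; apply: h.
have up (g : EndHeis K (P m.+1)) : hecke_gen (s_up m.+1) (x_up m.+1) m.+1 g -> stable (capped T) g.
  move=> hg; apply: sub => f u v Tf hu hv; rewrite -compM; apply: spanned_gen.
  exists f, (u * g), v; split=> //; first exact: subring_genM.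
  rewrite -!mulrA (hecke_up_dn (leqnn _) (leqnn _) _ hv) //.
  exact: subring_gen_gen.
have dn (g : EndHeis K (P m.+1)) : hecke_gen (s_dn m.+1) (x_dn m.+1) m.+1 g -> stable (capped T) g.
  move=> hg; apply: sub => f u v Tf hu hv; rewrite -compM; apply: spanned_gen.
  exists f, u, (v * g); split=> //; first exact: subring_genM.
  by rewrite mulrA.
split=> [|i h|i h|i h|i h|c]; first exact: spanned_subspace.
- by apply: up; left; exists i.
- by apply: up; right; exists i.
- by apply: dn; left; exists i.
- by apply: dn; right; exists i.
(* The circle is central, so it moves up past the cap and past [f], is absorbed by [T] there, and
   never meets the Hecke factors. *)
apply: sub => f u v Tf hu hv; apply: spanned_gen.
exists (comp f (em (P m) (bub 0 c))), u, v; split=> //; first exact: (lv_bub lT).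
by rewrite [LHS]bub_central [in RHS](@bub_central _ _ c f) !Defs.compA.
Qed.

Lemma family_level n : level (family n).
Proof.
elim: n => [|m IH]; first exact: S_level.
by rewrite /=; case: ltnP => [lt|_]; [exact: S_level | exact: capped_level].
Qed.

(** Up to width [k] this is the hypothesis [S_cup]; above it, elements are capped ones and
    [cup_stable] applies. *)
Lemma family_cup m f : family m.+1 f -> family m (comp f (@cupP K m)).
Proof.
elim: m f => [|m IH] f.
  rewrite /=; case: ltnP => [lt|ge]; first by move=> h; apply: S_cup.
  apply: (@spanned_sub _ _ _ (fun f => S 0 (comp f (@cupP K 0)))).
    by apply: subspace_compl; exact: (lv_sub (S_level (leq0n k))).
  move=> _ [f' [u [v [h1 h2 h3 ->]]]].
  have := @cup_stable 0 _ (S_level (leq0n k)) _ _ _ h2 h3 f' h1.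
  by rewrite /sandwich !Defs.compA; apply.
rewrite [family m.+2]/=; case: ltnP => [lt|ge].
  by rewrite (familyE (ltnW lt)) => h; apply: S_cup.
pose T f := family m.+1 (comp f (@cupP K m.+1)).
apply: (@spanned_sub _ _ _ T).
  exact: (@subspace_compl K X (P m.+2) (P m.+1) (family m.+1) _ (lv_sub (family_level m.+1))).
move=> _ [f' [u [v [h1 h2 h3 ->]]]].
(* The cup over the cap passes through the narrower word, where the induction hypothesis is
   available, and comes back by [family_cap]. *)
have mid : (0 < m.+1)%N -> stable (family m.+1) (em (P m.+1) [:: Min m; Max Up m]).
  move=> _ f0 h0; have := family_cap (IH f0 h0).
  by rewrite /capP /cupP -Defs.compA comp_mor ?run_cupP ?run_capP.
have := @cup_stable m.+1 _ (family_level m.+1) mid _ _ h2 h3 f' h1.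
by rewrite /sandwich !Defs.compA.
Qed.

Lemma family_cpath n d m f : family n f -> cpath n d m -> family m (comp f (mor (P n) (P m) d)).
Proof.
move=> Ff; elim=> [|{}d {}m i cd IH lt|{}d {}m i cd IH lt|{}d {}m cd IH|{}d {}m cd IH].
- by rewrite comp_idr.
- rewrite -cats1 -(comp_mor K (cpath_run cd) (run_s_up lt)) Defs.compA.
  by apply: (lv_s_up (family_level m)).
- have lt' : (m.-2 - i + m = m.-2 - i + m)%N by [].
  have r : run (P m) [:: Cross (m + i)] = Some (P m) by rewrite run_cons step_P_down.
  rewrite -cats1 -(comp_mor K (cpath_run cd) r) Defs.compA.
  have h : (((m.-2 - i).+1 < m)%N) by lia.
  have := lv_s_dn (family_level m) h IH; rewrite /down_cross.
  by have -> : ((m + m).-2 - (m.-2 - i) = m + i)%N by lia.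
- rewrite -cats1 -(comp_mor K (cpath_run cd) (run_capP m)) Defs.compA.
  exact: family_cap.
- rewrite -cats1 -(comp_mor K (cpath_run cd) (run_cupP m)) Defs.compA.
  exact: family_cup.
Qed.

Lemma family_closed n m f (g : Heis (P n) (P m)) : (n <= k)%N -> (m <= k)%N ->
  S n f -> S m (comp f g).
Proof.
move=> ln lm; rewrite -!familyE // => Ff.
apply: (@spanned_sub _ _ _ (fun g => family m (comp f g)) _ _ _ (cpath_span g)).
  by apply: subspace_compr; exact: (lv_sub (family_level m)).
by move=> _ [d cd ->]; apply: family_cpath.
Qed.

End Family.
End Extension.

(** * Words in the generator diagrams, and the spaces [low] *)

Section Words.
Variable K : fieldType.
Local Notation Heis := (Heis K).
Local Notation mor := (mor K).
Local Notation comp := (@Defs.comp K _ _ _).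
Local Notation sim := (sim K).
Local Notation em := (@endmor K).

Lemma e_diag_gen k j : (1 <= j <= 2 * k - 1)%N -> gen_diag (g_e j) = e_diag k j.
Proof. by case: j => // j h; rewrite /e_diag nth_ud //=; lia. Qed.

Lemma x_diag_gen k r : (1 <= r <= 2 * k)%N -> gen_diag (g_x r) = x_diag k r.
Proof. by case: r => // r h; rewrite /x_diag nth_ud //=; lia. Qed.

Lemma run_gen_diag k g : defined_gen k g -> run (ud k) (gen_diag g) = Some (ud k).
Proof.
case: g => [i|j|r|l] h; last exact: run_z_diag.
- by case/and3P: (tau_diagP h) => /eqP.
- by rewrite (e_diag_gen h); case/and3P: (e_diagP h) => /eqP.
- by rewrite (x_diag_gen h) run_x_diag.
Qed.

Lemma defined_gen_leq k k' g : (k <= k')%N -> defined_gen k g -> defined_gen k' g.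
Proof. by case: g => [i|j|r|l] //= le; lia. Qed.

Definition gword k (d : events) : Prop :=
  exists2 gs, all (defined_gen k) gs & d = flatten [seq gen_diag g | g <- gs].

Lemma gword_nil k : gword k [::]. Proof. by exists [::]. Qed.
Lemma gword_gen k g : defined_gen k g -> gword k (gen_diag g).
Proof. by move=> h; exists [:: g]; rewrite /= ?h ?cats0. Qed.
Lemma gword_cat k d e : gword k d -> gword k e -> gword k (d ++ e).
Proof.
move=> [gs h ->] [gs' h' ->]; exists (gs ++ gs'); first by rewrite all_cat h.
by rewrite map_cat flatten_cat.
Qed.
Lemma gword_leq k k' d : (k <= k')%N -> gword k d -> gword k' d.
Proof.
move=> le [gs h ->]; exists gs => //; apply: sub_all h => g; exact: defined_gen_leq.
Qed.
Lemma run_gword k d : gword k d -> run (ud k) d = Some (ud k).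
Proof.
case=> gs + ->; elim: gs => //= g gs IH /andP[h hs].
by rewrite run_cat run_gen_diag // IH.
Qed.

(** The future image of the homomorphism, described without the presented algebra, so that
    surjectivity becomes the purely diagrammatic [Alg_all]. *)
Definition Alg k (f : EndHeis K (ud k)) : Prop :=
  spanned (fun g => exists2 d, gword k d & g = em (ud k) d) f.

Lemma Alg_word k d : gword k d -> Alg (em (ud k) d).
Proof. by move=> h; apply: spanned_gen; exists d. Qed.

Lemma Alg1 k : @Alg k 1. Proof. exact: (Alg_word (gword_nil k)). Qed.

Lemma Alg_subspace k : subspace (@Alg k). Proof. exact: spanned_subspace. Qed.

Lemma AlgM k (f g : EndHeis K (ud k)) : Alg f -> Alg g -> Alg (f * g).
Proof.
move=> Af Ag; pose T1 (g : EndHeis K (ud k)) := @Alg k (comp f g).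
apply: (@spanned_sub _ _ _ T1 g (subspace_compr f (Alg_subspace k)) _ Ag).
move=> _ [d hd ->]; pose T2 (f : EndHeis K (ud k)) := @Alg k (comp f (em (ud k) d)).
apply: (@spanned_sub _ _ _ T2 f (subspace_compl _ (Alg_subspace k)) _ Af).
move=> _ [e he ->]; rewrite /T2 -[comp _ _]/(em (ud k) e * em (ud k) d) emM ?run_gword //.
by apply: Alg_word; apply: gword_cat.
Qed.

Fixpoint cups m : events := if m is m'.+1 then Min (2 * m') :: cups m' else [::].
Definition cupd n m : events := shift (2 * n) (cups m).

Lemma run_cups m : run (ud m) (cups m) = Some [::].
Proof.
elim: m => // m IH; rewrite -[cups m.+1]/(Min (2 * m) :: cups m) run_cons ud_S.
by have := step_min_cat Up (ud m) [::]; rewrite size_ud cats0 => ->.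
Qed.

Lemma run_cupd n m : run (ud (n + m)) (cupd n m) = Some (ud n).
Proof.
have := run_frame1 (ud n) (run_cups m); rewrite cats0 size_ud ud_add; exact.
Qed.

Lemma cups_S m : cups m.+1 = shift 2 (cups m) ++ [:: Min 0].
Proof.
elim: m => // m IH; rewrite [cups m.+2]/= -/(cups m.+1) {1}IH -cat_cons; congr (_ ++ _).
by rewrite /=; congr (Min _ :: _); lia.
Qed.

Lemma cupd_S n m : cupd n m.+1 = cupd n.+1 m ++ [:: Min (2 * n)].
Proof.
rewrite /cupd cups_S shift_cat shift_shift; congr (shift _ _ ++ _); first by lia.
by rewrite /= addn0.
Qed.

Lemma cupd_comm n m d : run (ud n) d = Some (ud n) ->
  sim (ud (n + m)) (cupd n m ++ d) (d ++ cupd n m).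
Proof.
move=> r; apply: sim_sym.
by have := sim_exchange0 (K := K) r (run_cups m); rewrite size_ud ud_add.
Qed.

Definition rho n m : events := cupd n m ++ Yd n.

Lemma run_Yd0 n : run (ud n) (Yd n) = Some (P n).
Proof. by have := run_Yd n [::]; rewrite !cats0. Qed.

Lemma run_rho n m : run (ud (n + m)) (rho n m) = Some (P n).
Proof. by rewrite run_cat run_cupd run_Yd0. Qed.

Definition low k n (f : Heis (ud k) (P n)) : Prop :=
  exists2 a, Alg a & f = comp (a : EndHeis K (ud k)) (mor (ud k) (P n) (rho n (k - n))).

Lemma low_subspace k n : subspace (@low k n).
Proof.
split=> [|c _ _ [a Aa ->] [b Ab ->]]; first by exists 0; [exact: spanned0 | rewrite comp0l].
by exists (c *: a + b); [exact: spanned_lin | rewrite comp_Pl].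
Qed.

Lemma low_word k n d e : (n <= k)%N -> gword k d -> run (ud k) e = Some (P n) ->
  sim (ud k) e (d ++ rho n (k - n)) -> low (mor (ud k) (P n) e).
Proof.
move=> le gd re s; exists (em (ud k) d); first exact: Alg_word.
have rr : run (ud k) (rho n (k - n)) = Some (P n) by have := run_rho n (k - n); rewrite subnKC.
by rewrite (sim_mor _ s) /endmor comp_mor // run_gword.
Qed.

Lemma low_left k n a f : Alg a -> low f -> @low k n (comp (a : EndHeis K (ud k)) f).
Proof. by move=> Aa [b Ab ->]; exists (a * b); [exact: AlgM | rewrite compM']. Qed.

(** [low] consists of the left multiples of one diagram [rho] by [Alg], so what is composed from
    below need only be tested on [rho]. *)
Lemma low_right k n w (g : Heis (P n) (P w)) (f : Heis (ud k) (P n)) :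
  low (comp (mor (ud k) (P n) (rho n (k - n))) g) -> low f -> low (comp f g).
Proof. by move=> h [a Aa ->]; rewrite -Defs.compA; apply: low_left. Qed.

Lemma low_stable k n d e : (n <= k)%N -> gword n d -> run (P n) e = Some (P n) ->
  sim (ud n) (Yd n ++ e) (d ++ Yd n) -> stable (@low k n) (em (P n) e).
Proof.
move=> le gd re s f; apply: low_right.
have rr : run (ud k) (rho n (k - n)) = Some (P n) by have := run_rho n (k - n); rewrite subnKC.
rewrite /endmor comp_mor //; apply: (@low_word k n d) => //.
- exact: gword_leq gd.
- by rewrite run_cat rr.
rewrite /rho -!catA; have rc : run (ud k) (cupd n (k - n)) = Some (ud n).
  by have := run_cupd n (k - n); rewrite subnKC.
apply: sim_trans (sim_catl rc s) _; rewrite !catA; apply: sim_catr.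
by have := cupd_comm (m := k - n) (run_gword gd); rewrite subnKC.
Qed.

Lemma stable_step w X (S : Heis X w -> Prop) (s x y : EndHeis K w) : subspace S ->
  s * s = 1 -> s * y = x * s - 1 -> stable S s -> stable S x -> stable S y.
Proof.
move=> sS ss e hs hx; have -> : y = s * (x * s) - s.
  by rewrite -[LHS]mul1r -ss -mulrA e mulrBr mulr1.
by apply: stableB => //; apply: stableM => //; apply: stableM.
Qed.

(** Crossings slide through [Yd] and become some [tau]. Of the dots only the outermost two slide, to
    [x 1] and [x (2 * n)]; the others are obtained from them by the Hecke relation in [stable_step].
    Circles are the central [z]. *)
Lemma low_level k n : (n <= k)%N -> level (@low k n).
Proof.
move=> le.
have su i : (i.+1 < n)%N -> stable (@low k n) (up_cross K n i).
  move=> h; apply: (low_stable le (d := tau_diag (2 * i).+2)); last exact: slide_up.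
    by apply: (@gword_gen _ (g_tau _)) => /=; lia.
  exact: run_s_up.
have sd i : (i.+1 < n)%N -> stable (@low k n) (down_cross K n i).
  move=> h; rewrite /down_cross; have -> : ((n + n).-2 - i = n + (n.-2 - i))%N by lia.
  apply: (low_stable le (d := tau_diag (2 * (n.-2 - i)).+3)); last by apply: slide_down; lia.
    by apply: (@gword_gen _ (g_tau _)) => /=; lia.
  by rewrite run_cons step_P_down //; lia.
split=> //; first exact: low_subspace.
- elim=> [|i IH] h.
    apply: (low_stable le (d := dot Up 0)); first by apply: (@gword_gen _ (g_x 1)) => /=; lia.
      exact: run_x_up.
    by have := @slide_dot_up K n [::] h; rewrite cats0.
  have hl : loc (P n) i [:: Up; Up] by apply: (loc_up (l := 2)); lia.
  apply: stable_step (low_subspace k n) (em_ss K hl) (em_sx K hl) _ _; first exact: su.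
  by apply: IH; lia.
- elim=> [|i IH] h.
    case: n le su sd h => // n le su sd _; rewrite /down_dot.
    have e : ((n.+1 + n.+1).-1 - 0 = (2 * n).+1)%N by lia.
    apply: (low_stable le (d := dot Down (2 * n).+1)).
    - have -> : dot Down (2 * n).+1 = gen_diag (g_x (2 * n.+1)).
        by rewrite /gen_diag oddM; congr (dot _ _); lia.
      by apply: gword_gen => /=; lia.
    - exact: (@run_x_dn n.+1 0).
    - rewrite e; have := @Yd_exchange K n [::] _ _ (erefl : run [:: Down] (dot Down 0) = Some [::
        Down]).
      by rewrite shift_dot addn0 cats0.
  set q := ((n + n).-2 - i)%N.
  have hl : loc (P n) q [:: Down; Down] by apply: (loc_down (l := 2)); rewrite /q; lia.
  have -> : down_dot K n i.+1 = em (P n) (dot Down q) by rewrite /down_dot /q; congr (em _ (dot _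
    _)); lia.
  apply: stable_step (low_subspace k n) (em_ss K hl) (em_sy K hl) _ _; first exact: sd.
  have -> : em (P n) (dot Down q.+1) = down_dot K n i by rewrite /down_dot /q; congr (em _ (dot _
    _)); lia.
  by apply: IH; lia.
- move=> c f [a Aa ->]; rewrite bub_central Defs.compA.
  exists (em (ud k) (bub 0 c) * a) => //; apply: AlgM => //.
  by apply: Alg_word; apply: (@gword_gen _ (g_z c)).
Qed.

Lemma cr_S i n : cr i n.+1 = cr i n ++ [:: Cross (i + n)].
Proof. by rewrite /cr -addn1 iotaD map_cat. Qed.

Lemma shift_cr p i n : shift p (cr i n) = cr (p + i) n.
Proof. by elim: n i => //= n IH i; rewrite -/(cr _ _) -/(shift _ _) IH addnS. Qed.

Lemma shift_crd p i n : shift p (crd i n) = crd (p + i) n.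
Proof. by rewrite /crd -shift_cr /shift map_rev. Qed.

Lemma crosses_cr m i n : (i + n < m)%N -> crosses m (cr i n).
Proof. by move=> lt; rewrite /crosses -all_rev; apply: crosses_crd. Qed.

Lemma cr_crd_inv w c i n : (forall j, (i <= j < i + n)%N -> loc w j [:: c; c]) ->
  [/\ run w (cr i n) = Some w, run w (crd i n) = Some w & em w (cr i n ++ crd i n) = 1].
Proof.
elim: n i => [|n IH] i h; first by split.
have hi : loc w i [:: c; c] by apply: h; lia.
have ri : run w [:: Cross i] = Some w by rewrite crossE; apply: loc_run hi _ erefl.
have [|r1 r2 e] := IH i.+1; first by move=> j hj; apply: h; lia.
have er : run w (cr i n.+1) = Some w by rewrite -[cr _ _]/([:: Cross i] ++ cr i.+1 n) run_cat ri.
split=> //; first by rewrite crd_Sr run_cat r2.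
rewrite -[cr _ _]/([:: Cross i] ++ cr i.+1 n) crd_Sr -catA [cr _ _ ++ _]catA.
by rewrite -!emM ?run_cat ?r1 ?r2 ?ri // [em _ (cr _ _) * _]emM // e mul1r (em_ss K hi).
Qed.

Lemma stable_cr w X (S : Heis X w -> Prop) i n :
  (forall j, (i <= j < i + n)%N -> run w [:: Cross j] = Some w /\ stable S (em w [:: Cross j])) ->
  run w (cr i n) = Some w /\ stable S (em w (cr i n)).
Proof.
elim: n => [|n IH] h; first by split=> // f; rewrite /endmor comp_idr.
have [|r s] := IH; first by move=> j hj; apply: h; lia.
have [|rn sn] := h (i + n)%N; first by lia.
rewrite cr_S run_cat r rn; split=> //; rewrite -emM //; exact: stableM.
Qed.

Lemma stable_crd w X (S : Heis X w -> Prop) i n :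
  (forall j, (i <= j < i + n)%N -> run w [:: Cross j] = Some w /\ stable S (em w [:: Cross j])) ->
  run w (crd i n) = Some w /\ stable S (em w (crd i n)).
Proof.
elim: n => [|n IH] h; first by split=> // f; rewrite /endmor comp_idr.
have [|r s] := IH; first by move=> j hj; apply: h; lia.
have [|rn sn] := h (i + n)%N; first by lia.
rewrite crd_S -cat1s run_cat rn r; split=> //; rewrite -emM //; exact: stableM.
Qed.

(** A cap moves across [n] downward strands; they cross its left leg on one side of the equation and
    its right leg on the other. *)
Lemma sim_max_left u n r : sim (u ++ nseq n Down ++ r)
  (Max Up (size u + n) :: crd (size u) n) (Max Up (size u) :: cr (size u).+1 n).
Proof.
elim: n r => [|n IH] r; first by rewrite addn0; exact: sim_refl.
have e : u ++ nseq n.+1 Down ++ r = (u ++ nseq n Down) ++ [:: Down] ++ r.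
  by rewrite -catA /= nseq_cons_cat.
set p := size u; have sp : size (u ++ nseq n Down) = (p + n)%N by rewrite size_cat size_nseq.
apply: (@sim_trans _ _ _ ([:: Max Up (p + n); Cross (p + n).+1] ++ crd p n)).
  rewrite e crd_S; apply: (@sim_catr K _ [:: Max Up (p + n.+1); Cross (p + n)]).
  have s : sim [:: Down] [:: Max Up 1; Cross 0] [:: Max Up 0; Cross 1].
    by apply: (skein_check K (P := [:: At 0; Skip; Skip])); vm_compute.
  by have := sim_widen (u ++ nseq n Down) r s; rewrite /= sp !addn0 !addn1 addnS.
apply: (@sim_trans _ _ _ ((Max Up (p + n) :: crd p n) ++ [:: Cross (p + n).+1])).
  have rm : run (u ++ nseq n.+1 Down ++ r) [:: Max Up (p + n)] =
      Some ((u ++ nseq n Down) ++ Up :: Down :: Down :: r).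
    by rewrite e run_cons -sp step_max_cat.
  apply: (sim_catl rm); apply: bcong_sim.
    by apply/andP; split; [|apply: crosses_crd]; rewrite /= ?(size_cat, size_nseq) /= ?(size_cat,
      size_nseq) -/p /=; lia.
  by apply: bcong_far; apply: crd_all => l /=; lia.
rewrite cr_S addSn -cat_cons; apply: sim_catr.
by have := IH (Down :: r); rewrite /= nseq_cons_cat.
Qed.

Lemma sim_min_right u m r : sim (u ++ nseq m.+1 Down ++ Up :: r)
  (crd (size u).+1 m ++ [:: Min (size u)]) (cr (size u) m ++ [:: Min (size u + m)]).
Proof.
elim: m r => [|m IH] r; first by rewrite addn0; exact: sim_refl.
set p := size u.
have e : u ++ nseq m.+2 Down ++ Up :: r = (u ++ nseq m Down) ++ [:: Down; Down; Up] ++ r.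
  by rewrite -catA /= !nseq_cons_cat.
have sp : size (u ++ nseq m Down) = (p + m)%N by rewrite size_cat size_nseq.
have rx : run (u ++ nseq m.+2 Down ++ Up :: r) [:: Cross (p + m).+1] =
    Some (u ++ nseq m.+1 Down ++ Up :: Down :: r).
  have := step_cross_cat (u ++ nseq m.+1 Down) Down Up r.
  rewrite size_cat size_nseq -/p addnS -!catA nseq_cons_cat run_cons => ->.
  by [].
rewrite crd_S addSn.
apply: (@sim_trans _ _ _ ([:: Cross (p + m).+1] ++ cr p m ++ [:: Min (p + m)])).
  by apply: (sim_catl rx); exact: IH.
apply: (@sim_trans _ _ _ (cr p m ++ [:: Cross (p + m).+1; Min (p + m)])).
  rewrite -[[:: _; Min _]]/([:: Cross (p + m).+1] ++ [:: Min (p + m)]) [X in sim _ _ X]catA.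
  apply: (@sim_catr K _ (Cross (p + m).+1 :: cr p m) (cr p m ++ [:: Cross (p + m).+1])).
  apply: bcong_sim.
    by apply/andP; split; [|apply: crosses_cr]; rewrite /= ?(size_cat, size_nseq) /= ?(size_cat,
      size_nseq) -/p /=; lia.
  by apply: bcong_far; rewrite -all_rev; apply: crd_all => l /=; lia.
have [] := @cr_crd_inv (u ++ nseq m.+2 Down ++ Up :: r) Down p m.
  move=> j hj; exists (u ++ nseq (j - p) Down), (nseq (m - (j - p)) Down ++ Up :: r).
  rewrite size_cat size_nseq -/p; split; last by lia.
  have -> : m.+2 = (j - p + (2 + (m - (j - p))))%N by lia.
  by rewrite !nseqD -!catA.
move=> rc _ _; rewrite cr_S -catA; apply: (sim_catl rc).
have s : sim [:: Down; Down; Up] [:: Cross 1; Min 0] [:: Cross 0; Min 1].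
  by apply: (skein_check K (P := [:: At 0; Skip; Skip])); vm_compute.
by rewrite e; have := sim_widen (u ++ nseq m Down) r s; rewrite /= sp !addn0 !addn1 addnS.
Qed.
End Words.

(** * Caps and cups on the spaces [low] *)

Section LowMoves.
Variable K : fieldType.
Local Notation Heis := (Heis K).
Local Notation mor := (mor K).
Local Notation comp := (@Defs.comp K _ _ _).
Local Notation sim := (sim K).
Local Notation em := (@endmor K).

Lemma stable_P_down n X (S : Heis X (P n) -> Prop) i : level S -> (n <= i)%N -> (i.+1 < n + n)%N ->
  run (P n) [:: Cross i] = Some (P n) /\ stable S (em (P n) [:: Cross i]).
Proof.
move=> lS ge lt; split.
  by have := @step_P_down n (i - n); rewrite subnKC // run_cons => ->; last by lia.
have := lv_s_dn lS (i := (n + n).-2 - i); rewrite /down_cross.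
have -> : ((n + n).-2 - ((n + n).-2 - i) = i)%N by lia.
by apply; lia.
Qed.

Lemma run_cupd' k n : (n <= k)%N -> run (ud k) (cupd n (k - n)) = Some (ud n).
Proof. by move=> le; have := run_cupd n (k - n); rewrite subnKC. Qed.

Lemma run_rho' k n : (n <= k)%N -> run (ud k) (rho n (k - n)) = Some (P n).
Proof. by move=> le; have := run_rho n (k - n); rewrite subnKC. Qed.

Lemma cupd_comm' k n d : (n <= k)%N -> run (ud n) d = Some (ud n) ->
  sim (ud k) (cupd n (k - n) ++ d) (d ++ cupd n (k - n)).
Proof. by move=> le r; have := cupd_comm K (m := k - n) r; rewrite subnKC. Qed.

Lemma e_odd_diag n : gen_diag (g_e (2 * n).+1) = [:: Min (2 * n); Max Up (2 * n)].
Proof. by rewrite /= oddM. Qed.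
Lemma e_even_diag n : gen_diag (g_e (2 * n).+2) = [:: Min (2 * n).+1; Max Down (2 * n).+1].
Proof. by rewrite /= oddM. Qed.

(** The middle cap has [n] downward strands on its right. Inserting the invertible [cr n.+1 n] moves
    it across them to the right end, where its left leg performs the last run of [Yd n.+1]; together
    with one cup of [rho] the cap is then [e (2 * n + 1)]. The inverse [crd n.+1 n] is absorbed by
    stability. *)
Lemma low_cap k n (f : Heis (ud k) (P n)) : (n < k)%N -> low f -> low (comp f (@capP K n)).
Proof.
move=> lt; apply: low_right.
have le := ltnW lt; have rr := run_rho' le; have rc := run_cupd' le.
have lD i : (n.+1 <= i)%N -> (i.+1 < n.+1 + n.+1)%N -> loc (P n.+1) i [:: Down; Down].
  by move=> h1 h2; apply: (loc_down (l := 2)); lia.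
have [|r1 r2 inv] := @cr_crd_inv K (P n.+1) Down n.+1 n.
  by move=> j hj; apply: lD; lia.
have [|_ st] := @stable_crd K (P n.+1) _ (@low K k n.+1) n.+1 n.
  by move=> j hj; apply: stable_P_down; [exact: low_level | lia | lia].
pose D := rho n (k - n) ++ [:: Max Up n].
have rD : run (ud k) D = Some (P n.+1) by rewrite run_cat rr run_capP.
have -> : comp (mor (ud k) (P n) (rho n (k - n))) (@capP K n) =
    comp (mor (ud k) (P n.+1) (D ++ cr n.+1 n)) (em (P n.+1) (crd n.+1 n)).
  rewrite /capP comp_mor ?run_capP // -(comp_mor K rD r1) -Defs.compA.
  by rewrite -[comp (mor _ _ (cr _ _)) _]/(em _ (cr n.+1 n) * em _ _) emM // inv comp1.
apply: st; apply: (low_word (d := gen_diag (g_e (2 * n).+1))) => //.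
- by apply: gword_gen => /=; lia.
- by rewrite run_cat rD.
have s1 : sim (P n) (Max Up n :: cr n.+1 n) (Max Up (n + n) :: crd n n).
  have := @sim_max_left K (nseq n Up) n [::]; rewrite size_nseq cats0.
  exact: sim_sym.
have s2 : sim (ud n) (Yd n ++ [:: Max Up (n + n)]) (Max Up (2 * n) :: Yd n).
  have := sim_exchange0 (K := K) (run_Yd0 n) (erefl : run [::] [:: Max Up 0] = Some [:: Up; Down]).
  by rewrite cats0 size_P size_ud /= addn0 addn0.
have -> : D ++ cr n.+1 n = cupd n (k - n) ++ Yd n ++ (Max Up n :: cr n.+1 n).
  by rewrite /D /rho -!catA.
apply: (@sim_trans _ _ _ (cupd n (k - n) ++ Yd n ++ (Max Up (n + n) :: crd n n))).
  by apply: (sim_catl rc); apply: (sim_catl (run_Yd0 n)).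
apply: (@sim_trans _ _ _ (cupd n (k - n) ++ (Max Up (2 * n) :: Yd n) ++ crd n n)).
  apply: (sim_catl rc); rewrite -cat1s [X in sim _ X]catA; exact: sim_catr.
have -> : (k - n = (k - n.+1).+1)%N by lia.
rewrite cupd_S -catA -[_ ++ (Max _ _ :: _) ++ _]/([:: Min (2 * n); Max Up (2 * n)] ++ Yd n.+1).
rewrite -e_odd_diag [X in sim _ X]catA [X in sim _ _ X]catA; apply: sim_catr.
apply: cupd_comm' => //; apply: run_gen_diag => /=; lia.
Qed.

(** The last crossing of [Yd n.+1] and the cup form a right curl, that is, a dot on the first
    downward strand. The cup then slides to the right end, leaving crossings of downward strands. *)
Lemma sim_Yd_min n : (0 < n)%N -> sim (ud n.+1) (Yd n.+1 ++ [:: Min n])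
  ((Yd n ++ dot Down n ++ cr n n.-1) ++ [:: Min (2 * n).-1]).
Proof.
case: n => // n _; rewrite -[Yd n.+2]/(Yd n.+1 ++ crd n.+1 n.+1) [ud n.+2]ud_S.
rewrite -[X in sim _ X]catA -[X in sim _ _ X]catA.
apply: (sim_catl (run_Yd n.+1 [:: Up; Down])); rewrite -[X in sim _ _ X]catA.
set W := P n.+1 ++ [:: Up; Down].
have W1 : W = nseq n.+1 Up ++ nseq n.+1 Down ++ Up :: [:: Down] by rewrite /W /P -catA.
have rc : run (nseq n Down ++ Up :: [:: Down]) (crd 0 n) = Some (Up :: nseq n Down ++ [:: Down]).
  exact: (@run_crd [::] Down n [:: Down]).
have W2 : W = (nseq n.+1 Up ++ [:: Down]) ++ (nseq n Down ++ Up :: [:: Down]).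
  by rewrite W1 -catA.
have s0 : size (nseq n.+1 Up ++ [:: Down]) = n.+2 by rewrite size_cat size_nseq addn1.
have rc' : run W (crd n.+2 n) = Some (nseq n.+1 Up ++ [:: Down; Up] ++ nseq n Down ++ [:: Down]).
  have := run_frame1 (nseq n.+1 Up ++ [:: Down]) rc; rewrite -W2 s0 shift_crd addn0 => ->.
  by rewrite -!catA.
rewrite crd_Sr -catA.
apply: (@sim_trans _ _ _ (crd n.+2 n ++ dot Down n.+1 ++ [:: Min n.+1])).
  apply: (sim_catl rc').
  have s : sim [:: Down; Up] ([:: Cross 0] ++ [:: Min 0]) (dot Down 0 ++ [:: Min 0]).
    by apply: (skein_check K (P := [:: Skip; At 0; At 2; At 1; At 0; Skip])); vm_compute.
  by have := sim_widen (nseq n.+1 Up) (nseq n Down ++ [:: Down]) s; rewrite !shift_cat shift_dot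
    size_nseq /= !addn0.
apply: (@sim_trans _ _ _ (dot Down n.+1 ++ crd n.+2 n ++ [:: Min n.+1])).
  rewrite [X in sim _ X]catA [X in sim _ _ X]catA; apply: sim_catr; apply: sim_sym.
  have := sim_exchange0 (K := K) (run_dot1 Down) rc.
  move/(sim_widen (nseq n.+1 Up) [::]); rewrite !cats0 !shift_cat !shift_shift shift_dot !shift_crd.
  by rewrite size_nseq /= !addn0 !addn1 W1.
have rd : run W (dot Down n.+1) = Some W.
  rewrite W1 dotE -{1}(size_nseq n.+1 Up).
  have := run_frame (nseq n.+1 Up) (nseq n Down ++ Up :: [:: Down]) (run_dot1 Down).
  by rewrite size_nseq; apply.
apply: (sim_catl rd).
have := @sim_min_right K (nseq n.+1 Up) n [:: Down]; rewrite size_nseq -W1.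
by have -> : ((2 * n.+1).-1 = n.+1 + n)%N by lia.
Qed.

Lemma run_min_last n t : (0 < n)%N ->
  run (P n ++ Up :: Down :: t) [:: Min (2 * n).-1] = Some (P n ++ t).
Proof.
case: n => // n _.
have e s : P n.+1 ++ s = (nseq n.+1 Up ++ nseq n Down) ++ Down :: s.
  by rewrite /P -!catA nseq_cons_cat.
have := step_min_cat Down (nseq n.+1 Up ++ nseq n Down) (Down :: t).
rewrite !e run_cons size_cat !size_nseq.
have -> : ((2 * n.+1).-1 = n.+1 + n)%N by lia.
by move=> ->.
Qed.

(** By [sim_Yd_min] the cup becomes an endomorphism [g] of [P n] followed by a cup at the right end.
    As [low] at width [n] is stable under [g], it is traded for an element of [Alg n] above [Yd n].
    The remaining cup misses [Yd n] and is, by a zigzag, an [e (2 * n)] followed by the cup of the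
    last pair. For [n = 0] the cup just joins those of [rho]. *)
Lemma low_cup k n (f : Heis (ud k) (P n.+1)) : (n < k)%N -> low f -> low (comp f (@cupP K n)).
Proof.
move=> lt; apply: low_right.
have le := ltnW lt; have rr := run_rho' lt; have rc := run_cupd' lt.
rewrite /cupP comp_mor ?run_cupP //.
have kn : (k - n = (k - n.+1).+1)%N by lia.
have [n0|n0] := posnP n.
  apply: (low_word (d := [::])) => //; first exact: gword_nil.
    by rewrite run_cat rr run_cupP.
  by rewrite /rho kn cupd_S n0 /= !cats0; exact: sim_refl.
pose g := em (P n) (dot Down n ++ cr n n.-1).
have ln := @low_level K n n (leqnn n).
have [|r1 st1] := @stable_cr K (P n) _ (@low K n n) n n.-1.
  by move=> j hj; apply: stable_P_down => //; lia.
have en : ((n + n).-1 - n.-1 = n)%N by lia.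
have r2 : run (P n) (dot Down n) = Some (P n).
  by rewrite -{2}en; apply: run_x_dn; lia.
have sg : stable (@low K n n) g.
  rewrite /g -emM //; apply: stableM => //.
  have := lv_x_dn ln (i := n.-1); rewrite /down_dot en; apply; lia.
have rg : run (P n) (dot Down n ++ cr n n.-1) = Some (P n) by rewrite run_cat r2.
have l0 : low (mor (ud n) (P n) (Yd n)).
  apply: (low_word (d := [::])) => //; [exact: gword_nil | exact: run_Yd0 |].
  by rewrite /rho subnn; exact: sim_refl.
have [a Aa] := sg _ l0; rewrite /rho subnn [cupd n 0 ++ _]/= /g /endmor comp_mor ?run_Yd0 // => ea.
have rmin := run_min_last _ n0.
have -> : mor (ud k) (P n) (rho n.+1 (k - n.+1) ++ [:: Min n]) =
    ctx (ud k) (P n) (cupd n.+1 (k - n.+1)) [:: Min (2 * n).-1] [:: Up; Down]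
      (comp (a : EndHeis K (ud n)) (mor (ud n) (P n) (Yd n))).
  rewrite -ea ctx_mor.
  - by rewrite /rho -catA; apply: sim_mor; apply: (sim_catl rc); exact: sim_Yd_min.
  - by rewrite rc ud_S.
  - by rewrite run_cat run_Yd0.
  - by rewrite rmin cats0.
pose T (a : EndHeis K (ud n)) := low (ctx (ud k) (P n) (cupd n.+1 (k - n.+1))
   [:: Min (2 * n).-1] [:: Up; Down] (comp a (mor (ud n) (P n) (Yd n)))).
have sT : subspace T.
  have [h0 h] := low_subspace K k n.
  split=> [|c u v Tu Tv]; rewrite /T; first by rewrite comp0l linear0.
  by rewrite comp_Pl linearP; apply: h.
apply: (@spanned_sub _ _ _ T a sT _ Aa) => _ [d hd ->].
have rd := run_gword hd.
rewrite /T /endmor comp_mor ?run_Yd0 // ctx_mor; first last.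
- by rewrite rmin cats0.
- by rewrite run_cat rd run_Yd0.
- by rewrite rc ud_S.
(* This index is [2 * n], since [n] is positive here. *)
have e_def : defined_gen n.+1 (g_e (2 * n.-1).+2) by rewrite /=; lia.
have hd' : gword n.+1 (d ++ gen_diag (g_e (2 * n.-1).+2)).
  by apply: gword_cat; [apply: gword_leq hd | apply: gword_gen].
have rY : run (ud n.+1) (Yd n) = Some (P n ++ [:: Up; Down]) by rewrite ud_S run_Yd.
have rd1 : run (ud n.+1) d = Some (ud n.+1) by rewrite ud_S; apply: run_frame0.
apply: (low_word (d := d ++ gen_diag (g_e (2 * n.-1).+2))) => //.
- exact: gword_leq hd'.
- by rewrite run_cat rc run_cat run_cat rd1 rY rmin cats0.
apply: (@sim_trans _ _ _ (cupd n.+1 (k - n.+1) ++ d ++ [:: Min (2 * n).-1] ++ Yd n)).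
  rewrite -!catA; apply: (sim_catl rc); apply: (sim_catl rd1).
  have := @Yd_exchange K n.-1 [:: Up; Down] _ _ (erefl : run [:: Down; Up; Down] [:: Min 0] = Some
    [:: Down]).
  rewrite prednK // -ud_S shift1 /= addn0.
  by have -> : ((2 * n).-1 = (2 * n.-1).+1)%N by lia.
rewrite /rho kn cupd_S.
apply: (@sim_trans _ _ _ (cupd n.+1 (k - n.+1) ++ (d ++ gen_diag (g_e (2 * n.-1).+2)) ++ [:: Min
  (2 * n)] ++ Yd n)).
  apply: (sim_catl rc); rewrite -!catA; apply: (sim_catl rd1).
  rewrite [X in sim _ _ X]catA; apply: sim_catr; apply: sim_sym; rewrite e_even_diag.
  have s : sim [:: Down; Up; Down] [:: Min 0; Max Down 0; Min 1] [:: Min 0].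
    by apply: (skein_check K (P := [:: At 1; Skip])); vm_compute.
  case: (n) n0 => // m _; have -> : ud m.+2 = (ud m ++ [:: Up]) ++ [:: Down; Up; Down] by rewrite
    !ud_S -!catA.
  have sz : size (ud m ++ [:: Up]) = (2 * m).+1 by rewrite size_cat size_ud addn1.
  have h := sim_widen (ud m ++ [:: Up]) [::] s; rewrite cats0 /= sz !addn0 !addn1 in h.
  have -> : (2 * m.+1 = (2 * m).+2)%N by lia.
  exact: h.
have := sim_catr ([:: Min (2 * n)] ++ Yd n) (cupd_comm' lt (run_gword hd')).
by rewrite -!catA.
Qed.

Lemma low_closed k n m (f : Heis (ud k) (P n)) (g : Heis (P n) (P m)) :
  (n <= k)%N -> (m <= k)%N -> low f -> low (comp f g).
Proof.
move=> ln lm; apply: (@family_closed K (ud k) k (@low K k)) => //.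
- by move=> i le; apply: low_level.
- by move=> i h lt; apply: low_cap.
- by move=> i h lt; apply: low_cup.
Qed.

End LowMoves.

(** * Telescoping the identity of [ud n] *)

Section Telescope.
Variable K : fieldType.
Local Notation eqv := (eqv K).
Local Notation sim := (sim K).
Local Notation em := (@endmor K).

Definition Xd n : events := rev (Yd n).

Lemma run_rev w v n d : crosses n d -> run w d = Some v -> run v (rev d) = Some w.
Proof.
elim: d w => [|s d IH] w; first by move=> _ [->].
case: s => // i /andP[_ hd]; rewrite run_cons; case E: step => [w1|] // /(IH _ hd) r.
have [u [x [y [t [-> e ->]]]]] := step_crossP E.
by rewrite rev_cons run_rcons r e; exact: step_cross_cat.
Qed.

Lemma run_Xd n t : run (P n ++ t) (Xd n) = Some (ud n ++ t).
Proof. exact: run_rev (crosses_Yd n) (run_Yd n t). Qed.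

Lemma Xd_S n : Xd n.+1 = cr n n ++ Xd n.
Proof. by rewrite /Xd -[Yd n.+1]/(Yd n ++ crd n n) rev_cat /crd revK. Qed.

(** Crossings among the downward strands of [P n] only; by [slide_down] they pass through [Yd n] and
    become odd [tau]. *)
Definition dn_word n (d : events) : bool :=
  all (fun s => if s is Cross q then (n <= q)%N && (q.+1 < n + n)%N else false) d.

Lemma slide_dn n d : dn_word n d -> exists2 d', gword n d' & sim (ud n) (Yd n ++ d) (d' ++ Yd n).
Proof.
elim/last_ind: d => [|d s IH]; first by exists [::]; [exact: gword_nil | rewrite cats0; exact:
  sim_refl].
rewrite /dn_word all_rcons; case: s => // q /andP[/andP[h1 h2] /IH[d' gd' s]].
exists (d' ++ tau_diag (2 * (q - n)).+3).
  by apply: gword_cat => //; apply: (@gword_gen _ (g_tau _)) => /=; lia.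
rewrite -cats1 catA; apply: sim_trans (sim_catr _ s) _; rewrite -!catA.
apply: (sim_catl (run_gword gd')).
have := @slide_down K n (q - n); rewrite subnKC //; apply; lia.
Qed.

Lemma sim_maxd_right u m r : sim (u ++ nseq m Down ++ r)
  (Max Down (size u) :: cr (size u).+1 m) (Max Down (size u + m) :: crd (size u) m).
Proof.
elim: m r => [|n IH] r; first by rewrite addn0; exact: sim_refl.
have e : u ++ nseq n.+1 Down ++ r = (u ++ nseq n Down) ++ [:: Down] ++ r.
  by rewrite -catA /= nseq_cons_cat.
set p := size u; have sp : size (u ++ nseq n Down) = (p + n)%N by rewrite size_cat size_nseq.
apply: sim_sym; apply: (@sim_trans _ _ _ ([:: Max Down (p + n); Cross (p + n).+1] ++ crd p n)).
  rewrite e crd_S; apply: (@sim_catr K _ [:: Max Down (p + n.+1); Cross (p + n)]).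
  have s : sim [:: Down] [:: Max Down 1; Cross 0] [:: Max Down 0; Cross 1].
    by apply: (skein_check K (P := [:: At 0; Skip; Skip])); vm_compute.
  by have := sim_widen (u ++ nseq n Down) r s; rewrite /= sp !addn0 !addn1 addnS.
apply: (@sim_trans _ _ _ ((Max Down (p + n) :: crd p n) ++ [:: Cross (p + n).+1])).
  have rm : run (u ++ nseq n.+1 Down ++ r) [:: Max Down (p + n)] =
      Some ((u ++ nseq n Down) ++ Down :: Up :: Down :: r).
    by rewrite e run_cons -sp step_max_cat.
  apply: (sim_catl rm); apply: bcong_sim.
    by apply/andP; split; [|apply: crosses_crd]; rewrite /= ?(size_cat, size_nseq) /= ?(size_cat,
      size_nseq) -/p /=; lia.
  by apply: bcong_far; apply: crd_all => l /=; lia.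
rewrite cr_S addSn -cat_cons; apply: sim_catr; apply: sim_sym.
by have := IH (Down :: r); rewrite /= nseq_cons_cat.
Qed.

(** The factor [Yd j ++ Xd j] is kept at the end so that [Alg_YX] can treat it by induction on
    [j]. *)
Definition correction n j (g : EndHeis K (ud n)) : Prop :=
  exists d d', [/\ (0 < j)%N, gword j d, gword j d' &
    g = em (ud n) (d ++ gen_diag (g_e (2 * j)) ++ d' ++ Yd j ++ Xd j)].

Lemma e_even_diag' j : gen_diag (g_e (2 * j)) = [:: Min (2 * j).-1; Max Down (2 * j).-1].
Proof. by rewrite /= oddM. Qed.

(** The correction term of one bigon, met after the next upward strand has crossed [m] downward
    ones. Sliding its cup and cap to the right end turns those crossings into crossings of downward
    strands, which pass through [Yd j]; cup and cap at the right end form [e (2 * j)]. *)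
Lemma telescope_sim j m : (m < j)%N -> exists d d', [/\ gword j d, gword j d' &
  sim (ud j.+1) (Yd j ++ crd (2 * j - m) m ++
      [:: Min (2 * j - m.+1); Max Down (2 * j - m.+1)] ++ cr (2 * j - m) m ++ Xd j)
    (d ++ gen_diag (g_e (2 * j)) ++ d' ++ Yd j ++ Xd j)].
Proof.
move=> lt; set p := (2 * j - m.+1)%N.
have ep : (2 * j - m = p.+1)%N by rewrite /p; lia.
have j0 : (0 < j)%N by lia.
have h1 : dn_word j (cr p m).
  by rewrite /dn_word -all_rev; apply: crd_all => q; rewrite /p; lia.
have h2 : dn_word j (crd p m) by apply: crd_all => q; rewrite /p; lia.
have [d gd s1] := slide_dn h1; have [d' gd' s2] := slide_dn h2.
exists d, d'; split=> //; rewrite ep.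
pose u := nseq j Up ++ nseq (j - m.+1) Down.
have su : size u = p by rewrite size_cat !size_nseq /p; lia.
have eP t : P j ++ t = u ++ nseq m.+1 Down ++ t.
  by rewrite /u /P -!catA; congr (_ ++ _); rewrite catA -nseqD; congr (nseq _ _ ++ _); lia.
have eP' t : P j ++ Up :: Down :: t = u ++ nseq m.+1 Down ++ Up :: Down :: t by rewrite eP.
have eQ : P j = u ++ nseq m Down ++ [:: Down].
  by rewrite -[P j]cats0 eP cats0 -addn1 nseqD.
have rY := run_Yd j [:: Up; Down]; rewrite -ud_S in rY.
have rmin := run_min_last [::] j0; rewrite cats0 in rmin.
have epm : (p + m = (2 * j).-1)%N by rewrite /p; lia.
apply: (@sim_trans _ _ _ (Yd j ++ (cr p m ++ [:: Min (2 * j).-1]) ++ (Max Down p :: cr p.+1 m) ++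
  Xd j)).
  apply: (sim_catl rY); rewrite catA -[(_ ++ _) ++ _ ++ _]catA; have := @sim_min_right K u m [::
    Down].
  rewrite su epm -eP' => s; have := sim_catr ((Max Down p :: cr p.+1 m) ++ Xd j) s.
  by rewrite -!catA.
have rc : run (P j ++ [:: Up; Down]) (cr p m) = Some (P j ++ [:: Up; Down]).
  have [] := @cr_crd_inv K (P j ++ [:: Up; Down]) Down p m => // q hq.
  have [a [r [e sa]]] : loc (P j) q [:: Down; Down] by apply: (loc_down (l := 2)); move: hq;
    rewrite /p; lia.
  by exists a, (r ++ [:: Up; Down]); rewrite e -!catA.
apply: (@sim_trans _ _ _ (Yd j ++ (cr p m ++ [:: Min (2 * j).-1]) ++ (Max Down (2 * j).-1 :: crd p
  m) ++ Xd j)).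
  apply: (sim_catl rY); apply: (@sim_catl K _ (P j)); first by rewrite run_cat rc.
  apply: sim_catr; have := @sim_maxd_right u m [:: Down].
  by rewrite su epm -eQ.
rewrite e_even_diag'.
pose mm := [:: Min (2 * j).-1; Max Down (2 * j).-1].
have -> : Yd j ++ (cr p m ++ [:: Min (2 * j).-1]) ++ (Max Down (2 * j).-1 :: crd p m) ++ Xd j =
   (Yd j ++ cr p m) ++ mm ++ crd p m ++ Xd j by rewrite -!catA.
have s1' := sim_widenr [:: Up; Down] s1; have s2' := sim_widenr [:: Up; Down] s2.
rewrite -ud_S in s1' s2'.
apply: sim_trans (sim_catr _ s1') _; rewrite -[X in sim _ X]catA.
have rd : run (ud j.+1) d = Some (ud j.+1) by apply: run_gword; apply: gword_leq gd.
apply: (sim_catl rd).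
have s3 : sim (ud j.+1) (Yd j ++ mm) (mm ++ Yd j).
  have := @Yd_exchange K j.-1 [:: Up; Down] _ _ (erefl : run [:: Down; Up; Down] [:: Min 0; Max
    Down 0] = Some [:: Down; Up; Down]).
  rewrite prednK // -ud_S.
  have -> : shift (2 * j.-1).+1 [:: Min 0; Max Down 0] = mm.
    by rewrite /mm /= addn0; have -> : ((2 * j).-1 = (2 * j.-1).+1)%N by lia.
  exact.
rewrite [X in sim _ X]catA; apply: sim_trans (sim_catr _ s3) _; rewrite -[X in sim _ X]catA.
have re : run (ud j.+1) mm = Some (ud j.+1).
  by rewrite /mm -e_even_diag'; apply: run_gen_diag; rewrite /=; lia.
apply: (sim_catl re); rewrite [X in sim _ X]catA [X in sim _ _ X]catA.
exact: sim_catr.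
Qed.

Lemma telescope n j : (j < n)%N -> exists2 c, spanned (@correction n j) c &
  em (ud n) (Yd j ++ Xd j) = em (ud n) (Yd j.+1 ++ Xd j.+1) + c.
Proof.
move=> lt; have eu : ud n = ud j.+1 ++ ud (n - j.+1) by rewrite -ud_add subnKC.
(* In [D m] the next upward strand travels across the last [m] downward strands of [P j] and back.
   Each further strand is one bigon, and [D j] is the next pair of sorting and unsorting. *)
pose D m := em (ud n) (Yd j ++ crd (2 * j - m) m ++ cr (2 * j - m) m ++ Xd j).
suff h m : (m <= j)%N -> exists2 c, spanned (@correction n j) c & em (ud n) (Yd j ++ Xd j) = D m +
  c.
  have [c hc e] := h j (leqnn j); exists c => //; rewrite e; congr (_ + _); rewrite /D.
  have -> : (2 * j - j = j)%N by lia.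
  by rewrite Xd_S -[Yd j.+1]/(Yd j ++ crd j j) -!catA.
elim: m => [|m IH] le.
  by exists 0; [exact: spanned0 | rewrite addr0 /D /=].
have [|c hc ->] := IH; first by lia.
have [d [d' [gd gd' s]]] := telescope_sim le.
exists (em (ud n) (d ++ gen_diag (g_e (2 * j)) ++ d' ++ Yd j ++ Xd j) + c).
  rewrite -[em _ _]scale1r; apply: spanned_lin => //; apply: spanned_gen.
  by exists d, d'; split=> //; lia.
rewrite addrA; congr (_ + _); rewrite /D.
have s' := sim_widenr (ud (n - j.+1)) s; rewrite -eu in s'.
rewrite -[em _ (d ++ _)](sim_mor _ s').
set p := (2 * j - m.+1)%N; have ep : (2 * j - m = p.+1)%N by rewrite /p; lia.
rewrite ep crd_Sr -[cr p m.+1]/(Cross p :: cr p.+1 m).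
have e5 : eqv [:: Down; Up] [:: (1, [:: Cross 0; Cross 0])]
   [:: (1, [::]); (-1, [:: Min 0; Max Down 0])].
  by apply: (skein_check K (P := [:: At 0])); vm_compute.
pose u := nseq j Up ++ nseq (j - m.+1) Down.
have su : size u = p by rewrite size_cat !size_nseq /p; lia.
have eP t : P j ++ t = u ++ Down :: nseq m Down ++ t.
  rewrite /u /P -!catA; congr (_ ++ _); rewrite -[Down :: _]/(nseq m.+1 Down ++ t) catA -nseqD.
  by congr (nseq _ _ ++ _); lia.
have r : run (ud n) (Yd j ++ crd p.+1 m) =
    Some (u ++ [:: Down; Up] ++ nseq m Down ++ Down :: ud (n - j.+1)).
  have -> : ud n = ud j ++ Up :: Down :: ud (n - j.+1) by rewrite eu ud_S -catA.
  rewrite run_cat run_Yd eP.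
  have := @run_crd (u ++ [:: Down]) Down m (Down :: ud (n - j.+1)).
  by rewrite size_cat su addn1 -!catA.
have := eqv_mor (ud n) (cr p.+1 m ++ Xd j) e5 r.
rewrite /frame_combo /mc !big_cons !big_nil /= !addr0 !scale1r scaleN1r su !addn0 -!catA /=.
by rewrite /endmor => ->; rewrite subrK.
Qed.

(** Starting from the identity at [j = 0], each difference is a correction, which is a word in the
    generators times the preceding element. *)
Lemma Alg_YX n j : (j <= n)%N -> Alg (em (ud n) (Yd j ++ Xd j)).
Proof.
elim: j => [|j IH] le; first exact: Alg1.
have [c hc e] := telescope le.
have -> : em (ud n) (Yd j.+1 ++ Xd j.+1) = em (ud n) (Yd j ++ Xd j) - c by rewrite e addrK.
have AE : Alg (em (ud n) (Yd j ++ Xd j)) by apply: IH; lia.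
apply: (subspaceB (@Alg_subspace K n)) => //.
apply: (@spanned_sub _ _ _ _ _ (@Alg_subspace K n) _ hc) => _ [d [d' [j0 gd gd' ->]]].
have ge : gword n (d ++ gen_diag (g_e (2 * j)) ++ d').
  apply: gword_cat; first by apply: gword_leq gd; lia.
  apply: gword_cat; first by apply: gword_gen => /=; lia.
  by apply: gword_leq gd'; lia.
have rE : run (ud n) (Yd j ++ Xd j) = Some (ud n).
  have -> : ud n = ud j ++ ud (n - j) by rewrite -ud_add subnKC //; lia.
  by rewrite run_cat run_Yd run_Xd.
have -> : em (ud n) (d ++ gen_diag (g_e (2 * j)) ++ d' ++ Yd j ++ Xd j) =
    em (ud n) (d ++ gen_diag (g_e (2 * j)) ++ d') * em (ud n) (Yd j ++ Xd j).
  by rewrite (emM K (run_gword ge) rE) -!catA.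
by apply: AlgM => //; apply: Alg_word.
Qed.
End Telescope.

(** * Every endomorphism of [ud k] is a combination of words *)

Section Spanning.
Variable K : fieldType.
Local Notation Heis := (Heis K).
Local Notation mor := (mor K).
Local Notation comp := (@Defs.comp K _ _ _).
Local Notation sim := (sim K).
Local Notation em := (@endmor K).

Lemma ud_loc k i : (i.+2 < 2 * k)%N -> exists u r, ud k = u ++ [:: ~~ odd i; odd i; ~~ odd i] ++ r
  /\ size u = i.
Proof.
move=> lt; exists (take i (ud k)), (drop i.+3 (ud k)); split; last by rewrite size_takel ?size_ud
  //; lia.
have e j : (j < 2 * k)%N -> drop j (ud k) = (~~ odd j) :: drop j.+1 (ud k).
  by move=> h; rewrite (drop_nth Up) ?size_ud // nth_ud.
rewrite -[LHS](cat_take_drop i) e; last by lia.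
rewrite e; last by lia.
by rewrite e /= ?negbK //; lia.
Qed.

(** One step to the right is a zigzag: a cup at [q] equals [e (q + 1)] followed by a cup at
    [q + 1]. *)
Lemma min_to_right k i q : (i <= q)%N -> (q.+1 < 2 * k)%N -> exists2 d, gword k d &
  sim (ud k) [:: Min i] (d ++ [:: Min q]).
Proof.
elim: q => [|q IH] le lt.
  by exists [::]; [exact: gword_nil | have -> : i = 0%N by lia; exact: sim_refl].
have [->|ne] := eqVneq i q.+1; first by exists [::]; [exact: gword_nil | exact: sim_refl].
have [||d gd s] := IH; try lia.
have dg : defined_gen k (g_e q.+1) by rewrite /=; lia.
exists (d ++ gen_diag (g_e q.+1)); first by apply: gword_cat => //; exact: gword_gen.
apply: sim_trans s _; rewrite -catA; apply: (sim_catl (run_gword gd)); apply: sim_sym.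
have [u [r [-> su]]] := ud_loc lt.
have s : sim [:: ~~ odd q; odd q; ~~ odd q] [:: Min 0; Max (~~ odd q) 0; Min 1] [:: Min 0].
  by case: (odd q); apply: (skein_check K (P := [:: At 1; Skip])); vm_compute.
by have := sim_widen u r s; rewrite su /= !addn0 addn1.
Qed.

Lemma max_to_right k i q : (i <= q)%N -> (q <= 2 * k)%N -> exists2 d, gword k.+1 d &
  sim (ud k) [:: Max (~~ odd i) i] (Max (~~ odd q) q :: d).
Proof.
elim: q => [|q IH] le lt.
  by exists [::]; [exact: gword_nil | have -> : i = 0%N by lia; exact: sim_refl].
have [->|ne] := eqVneq i q.+1; first by exists [::]; [exact: gword_nil | exact: sim_refl].
have [||d gd s] := IH; try lia.
have dg : defined_gen k.+1 (g_e q.+1) by rewrite /=; lia.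
exists (gen_diag (g_e q.+1) ++ d); first by apply: gword_cat => //; exact: gword_gen.
apply: sim_trans s _; rewrite -cat1s -[X in sim _ _ X]/([:: _] ++ _ ++ d) [X in sim _ _ X]catA.
apply: sim_catr; apply: sim_sym.
have e : ud k = take q (ud k) ++ [:: ~~ odd q] ++ drop q.+1 (ud k).
  by rewrite cat1s -(nth_ud lt) -drop_nth ?size_ud // cat_take_drop.
have s' : sim [:: ~~ odd q] [:: Max (odd q) 1; Min 0; Max (~~ odd q) 0] [:: Max (~~ odd q) 0].
  by case: (odd q); apply: (skein_check K (P := [:: At 0; Skip])); vm_compute.
have := sim_widen (take q (ud k)) (drop q.+1 (ud k)) s'; rewrite -e size_takel ?size_ud; last by
  lia.
by rewrite /= !addn0 addn1 negbK.
Qed.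

Definition through_low k (f : EndHeis K (ud k)) : Prop :=
  spanned (fun f => exists j l (g : Heis (P j) (ud k)), [/\ (j <= k)%N, @low K k j l & f = comp l
    g]) f.

Lemma run_drop_min n j : (0 < j)%N -> (j < n)%N -> run (ud n) [:: Min (2 * j).-1] = Some (ud n.-1).
Proof.
move=> j0 lt.
have -> : ud n = (ud j.-1 ++ [:: Up]) ++ Down :: ~~ Down :: Down :: ud (n - j.+1).
  by rewrite -{1}(subnKC lt) ud_add -{1}(prednK j0) !ud_S -!catA.
have := step_min_cat Down (ud j.-1 ++ [:: Up]) (Down :: ud (n - j.+1)).
rewrite run_cons size_cat size_ud.
have -> : (2 * j.-1 + size [:: Up] = (2 * j).-1)%N by rewrite /=; lia.
move=> ->; rewrite -catA -[[:: Up] ++ _]/([:: Up; Down] ++ _) catA -ud_S -ud_add.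
by congr (Some (ud _)); lia.
Qed.

Lemma run_drop_max n j : (0 < j)%N -> (j < n)%N -> run (ud n.-1) [:: Max Down (2 * j).-1] = Some
  (ud n).
Proof.
move=> j0 lt.
have -> : ud n = (ud j.-1 ++ [:: Up]) ++ Down :: ~~ Down :: Down :: ud (n - j.+1).
  by rewrite -{1}(subnKC lt) ud_add -{1}(prednK j0) !ud_S -!catA.
have -> : ud n.-1 = (ud j.-1 ++ [:: Up]) ++ Down :: ud (n - j.+1).
  rewrite -catA -[[:: Up] ++ _]/([:: Up; Down] ++ _) catA -ud_S -ud_add.
  by congr (ud _); lia.
have := step_max_cat Down (ud j.-1 ++ [:: Up]) (Down :: ud (n - j.+1)).
rewrite run_cons size_cat size_ud.
have -> : (2 * j.-1 + size [:: Up] = (2 * j).-1)%N by rewrite /=; lia.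
by move=> ->.
Qed.

Lemma run_YX n j : (j <= n)%N -> run (ud n) (Yd j ++ Xd j) = Some (ud n).
Proof.
move=> le; have -> : ud n = ud j ++ ud (n - j) by rewrite -ud_add subnKC.
by rewrite run_cat run_Yd run_Xd.
Qed.

Lemma correction_split n j g : (j < n)%N -> @correction K n j g -> exists d (b : EndHeis K (ud n)),
  [/\ (0 < j)%N, gword n d, Alg b & g = comp (mor (ud n) (ud n.-1) (d ++ [:: Min (2 * j).-1]))
    (comp (mor (ud n.-1) (ud n) [:: Max Down (2 * j).-1]) b)].
Proof.
move=> lt [d [d' [j0 gd gd' ->]]].
have wd : gword n d by apply: gword_leq gd; lia.
have wd' : gword n d' by apply: gword_leq gd'; lia.
have rE : run (ud n) (Yd j ++ Xd j) = Some (ud n) by apply: run_YX; lia.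
exists d, (em (ud n) d' * em (ud n) (Yd j ++ Xd j)); split=> //.
  by apply: AlgM; [exact: Alg_word | apply: Alg_YX; lia].
have r1 := run_drop_min j0 lt; have r2 := run_drop_max j0 lt.
rewrite emM ?(run_gword wd') // /endmor !comp_mor //.
- by congr mor; rewrite e_even_diag' -!catA.
- by rewrite run_cat (run_gword wd).
- by rewrite run_cat r2 run_cat (run_gword wd').
- by rewrite run_cat (run_gword wd').
Qed.

(** Once moved to the last pair, the cup commutes with the generators on the first [k - 1] pairs and
    becomes one more cup of [rho]. *)
Lemma low_min k j i (l : Heis (ud k.-1) (P i)) : (0 < j)%N -> (j < k)%N -> (i <= k.-1)%N -> low l ->
  low (comp (mor (ud k) (ud k.-1) [:: Min (2 * j).-1]) l).
Proof.
move=> j0 lt le [a Aa ->].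
have [||d gd s] := @min_to_right k (2 * j).-1 (2 * k.-1); try lia.
have rq : run (ud k) [:: Min (2 * k.-1)] = Some (ud k.-1).
  have := run_cupd k.-1 1; have -> : (k.-1 + 1 = k)%N by lia.
  by rewrite cupd_S.
pose T (a : EndHeis K (ud k.-1)) := low (comp (mor (ud k) (ud k.-1) [:: Min (2 * j).-1])
   (comp a (mor (ud k.-1) (P i) (rho i (k.-1 - i))))).
have sT : subspace T.
  have [h0 h] := low_subspace K k i.
  split=> [|c u v Tu Tv]; rewrite /T; first by rewrite comp0l comp0r.
  by rewrite comp_Pl comp_Pr; apply: h.
apply: (@spanned_sub _ _ _ T a sT _ Aa) => _ [d' gd' ->]; rewrite /T.
have rd' := run_gword gd'; have rr := run_rho' le.
have wd' : gword k d' by apply: gword_leq gd'; lia.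
rewrite (sim_mor _ s) /endmor comp_mor // comp_mor //; first last.
- by rewrite run_cat rd'.
- by rewrite run_cat (run_gword gd).
have ik : (i <= k)%N by lia.
apply: (low_word (d := d ++ d')) => //.
- exact: gword_cat.
- by rewrite run_cat run_cat (run_gword gd) rq run_cat rd'.
rewrite -!catA; apply: (sim_catl (run_gword gd)).
have s2 : sim (ud k) ([:: Min (2 * k.-1)] ++ d') (d' ++ [:: Min (2 * k.-1)]).
  have := @cupd_comm' K k k.-1 d' (leq_pred k) rd'.
  have -> : (k - k.-1 = 1)%N by lia.
  by rewrite cupd_S.
have := sim_catr (rho i (k.-1 - i)) s2; rewrite -!catA => s3; apply: sim_trans s3 _.
apply: (sim_catl (run_gword wd')).
rewrite /rho; have -> : (k - i = (k.-1 - i).+1)%N by lia.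
have -> : (2 * k.-1 = 2 * i + 2 * (k.-1 - i))%N by lia.
exact: sim_refl.
Qed.

Lemma through_low_compr k (b : Heis (ud k.-1) (ud k)) j :
  (0 < j)%N -> (j < k)%N -> through_low (1 : EndHeis K (ud k.-1)) ->
  through_low (comp (mor (ud k) (ud k.-1) [:: Min (2 * j).-1]) b : EndHeis K (ud k)).
Proof.
move=> j0 lt h.
pose T (f : EndHeis K (ud k.-1)) :=
  through_low (comp (comp (mor (ud k) (ud k.-1) [:: Min (2 * j).-1]) f) b : EndHeis K (ud k)).
have sT : subspace T.
  have [h0 hl] : subspace (@through_low k) by exact: spanned_subspace.
  by split=> [|c u v Tu Tv]; rewrite /T ?comp0r ?comp0l // comp_Pr comp_Pl; apply: hl.
have := @spanned_sub _ _ _ T 1 sT _ h; rewrite /T comp1; apply.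
move=> _ [i [l' [g [le ll ->]]]]; rewrite /T; apply: spanned_gen.
exists i, (comp (mor (ud k) (ud k.-1) [:: Min (2 * j).-1]) l'), (comp g b); split; first by lia.
  exact: low_min.
by rewrite -!Defs.compA.
Qed.

Lemma through_low_left k (a : EndHeis K (ud k)) f : Alg a -> @through_low k f -> through_low (a *
  f).
Proof.
move=> Aa; pose T (f : EndHeis K (ud k)) := through_low (a * f).
have sT : subspace T.
  have [h0 hl] : subspace (@through_low k) by exact: spanned_subspace.
  by split=> [|c u v Tu Tv]; rewrite /T ?mulr0 // -[a * _]/(comp a _) comp_Pr; apply: hl.
apply: (@spanned_sub _ _ _ T f sT) => _ [i [l [g [le ll ->]]]].
apply: spanned_gen; exists i, (comp a l), g; split=> //; first exact: low_left.
by rewrite -[a * _]/(comp a _) Defs.compA.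
Qed.

(** The last term of the telescope factors through [P k] by construction. Each correction factors
    through the identity of [ud (k - 1)], where the induction hypothesis is inserted. The inner
    induction runs down the telescope to [j = 0], where the term is the identity. *)
Lemma through_low1 k : @through_low k 1.
Proof.
elim: k => [|k IH].
  apply: spanned_gen; exists 0, (mor (ud 0) (P 0) [::]), (mor (P 0) (ud 0) [::]).
  split=> //; last by rewrite comp_mor.
  apply: (@low_word K 0 0 [::]) => //; first exact: gword_nil.
have [h0 hl] : subspace (@through_low k.+1) by exact: spanned_subspace.
suff h j : (j <= k.+1)%N -> through_low (em (ud k.+1) (Yd j ++ Xd j)) -> through_low (1 : EndHeis
  K (ud k.+1)).
  apply: (h k.+1) => //; apply: spanned_gen.
  have rX := run_Xd k.+1 [::]; rewrite !cats0 in rX.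
  exists k.+1, (mor _ _ (Yd k.+1)), (mor _ _ (Xd k.+1)); split=> //.
    apply: (low_word (d := [::])) => //; [exact: gword_nil | exact: run_Yd0 |].
    by rewrite /rho subnn; exact: sim_refl.
  by rewrite comp_mor // run_Yd0.
elim: j => // j IHj le hj; apply: IHj; first by lia.
have [c hc ->] := telescope K le.
apply: (subspaceD (conj h0 hl)) => //.
apply: (@spanned_sub _ _ _ _ _ (conj h0 hl) _ hc) => g hg.
have [d [b [j0 gd Ab ->]]] := correction_split le hg.
have rm := run_drop_min j0 le; have rd := run_gword gd.
rewrite -(comp_mor K rd rm) -Defs.compA.
apply: (through_low_left (a := em (ud k.+1) d)); first exact: Alg_word.
exact: through_low_compr.
Qed.

(** Writing the identity as a sum of [comp l g] with [l] in [low] turns [f] into morphisms between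
    sorted words applied to [l], and [low] is closed under these. *)
Lemma low_all k n (f : Heis (ud k) (P n)) : (n <= k)%N -> low f.
Proof.
move=> le; pose T (g : EndHeis K (ud k)) := low (comp g f).
have [h0 h] := low_subspace K k n.
have sT : subspace T by split=> [|c u v Tu Tv]; rewrite /T ?comp0l // comp_Pl; apply: h.
have := @spanned_sub _ _ _ T 1 sT _ (through_low1 k); rewrite /T comp1'; apply.
by move=> _ [i [l [g [li ll ->]]]]; rewrite -Defs.compA; apply: low_closed.
Qed.

Definition cup_multiple k n (f : Heis (ud k) (ud n)) : Prop :=
  exists2 a, Alg a & f = comp (a : EndHeis K (ud k)) (mor (ud k) (ud n) (cupd n (k - n))).

Lemma cup_multiple_subspace k n : subspace (@cup_multiple k n).
Proof.
split=> [|c _ _ [a Aa ->] [b Ab ->]]; first by exists 0; [exact: spanned0 | rewrite comp0l].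
by exists (c *: a + b); [exact: spanned_lin | rewrite comp_Pl].
Qed.

Lemma cup_multiple_right k n f (b : EndHeis K (ud n)) : (n <= k)%N -> Alg b ->
  @cup_multiple k n f -> cup_multiple (comp f b).
Proof.
move=> le Ab hf; pose T (b : EndHeis K (ud n)) := cup_multiple (comp f b).
have [h0 h] := cup_multiple_subspace k n.
have sT : subspace T by split=> [|c u v Tu Tv]; rewrite /T ?comp0r // comp_Pr; apply: h.
apply: (@spanned_sub _ _ _ T b sT _ Ab) => _ [d gd ->]; rewrite /T.
have [a Aa ->] := hf; have rd := run_gword gd; have rc := run_cupd' le.
have gd' := gword_leq le gd; have rd' := run_gword gd'.
exists (a * em (ud k) d); first by apply: AlgM => //; apply: Alg_word.
rewrite compM' -Defs.compA /endmor !comp_mor //; congr comp.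
by apply: sim_mor; apply: cupd_comm'.
Qed.

(** Telescope the identity of the target. In the last term, [f] followed by sorting is in [low], and
    sorting followed by unsorting is in [Alg]. A correction first leads to the shorter target, where
    induction applies, and returns by a cap. *)
Lemma cup_multiple_all k n (f : Heis (ud k) (ud n)) : (n <= k)%N -> cup_multiple f.
Proof.
elim: n f => [|n IH] f le.
  have [a Aa e] := @low_all k 0 f le; exists a => //.
  by rewrite {1}e /rho /= cats0.
have [h0 h] := cup_multiple_subspace k n.+1; pose T (g : EndHeis K (ud n.+1)) := cup_multiple
  (comp f g).
have sT : subspace T by split=> [|c u v Tu Tv]; rewrite /T ?comp0r // comp_Pr; apply: h.
suff hT j : (j <= n.+1)%N -> T (em (ud n.+1) (Yd j ++ Xd j)) -> T 1.
  have := hT n.+1 (leqnn _); rewrite /T comp1; apply.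
  have rX := run_Xd n.+1 [::]; rewrite !cats0 in rX.
  have rY := run_Yd0 n.+1.
  rewrite /endmor -(comp_mor K rY rX) Defs.compA.
  have [a Aa ->] := @low_all k n.+1 (comp f (mor (ud n.+1) (P n.+1) (Yd n.+1))) le.
  have rc := run_cupd' le.
  rewrite /rho -(comp_mor K rc rY) -!Defs.compA (comp_mor K rY rX) Defs.compA.
  apply: (@cup_multiple_right k n.+1 _ (em (ud n.+1) (Yd n.+1 ++ Xd n.+1)) le); first exact: Alg_YX.
  by exists a.
elim: j => // j IHj lej hj; apply: IHj; first by lia.
have [c hc ->] := telescope K lej.
apply: (subspaceD sT) => //.
apply: (@spanned_sub _ _ _ _ _ sT _ hc) => g hg; rewrite /T.
have [d [b [j0 gd Ab ->]]] := correction_split lej hg.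
rewrite !Defs.compA; apply: (cup_multiple_right le Ab).
have [a Aa ->] := IH (comp f (mor (ud n.+1) (ud n) (d ++ [:: Min (2 * j).-1]))) (ltnW le).
have rmax := run_drop_max j0 lej.
have kn : (k - n = (k - n.+1).+1)%N by lia.
have rc := run_cupd' le.
have rmin : run (ud n.+1) [:: Min (2 * n)] = Some (ud n).
  by have := run_cupd n 1; rewrite addn1 cupd_S.
(* The returning cap is moved to the last pair, so that with the last cup above it forms
   [e (2 * n + 1)]. *)
have [||d' gd' s] := @max_to_right n (2 * j).-1 (2 * n); try lia.
have oj : ~~ odd (2 * j).-1 = false.
  have -> : ((2 * j).-1 = (2 * j.-1).+1)%N by lia.
  by rewrite /= oddM.
rewrite oj oddM /= in s.
rewrite kn cupd_S -(comp_mor K rc rmin) -!Defs.compA [comp a _]Defs.compA.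
have -> : comp (mor (ud n.+1) (ud n) [:: Min (2 * n)]) (mor (ud n) (ud n.+1) [:: Max Down (2 *
  j).-1]) =
    em (ud n.+1) (gen_diag (g_e (2 * n).+1) ++ d').
  rewrite comp_mor //; apply: sim_mor; rewrite e_odd_diag.
  exact: (sim_catl rmin s).
apply: cup_multiple_right => //; last by exists a.
apply: Alg_word; apply: gword_cat => //; apply: gword_gen => /=; lia.
Qed.

Lemma Alg_all k (f : EndHeis K (ud k)) : Alg f.
Proof.
have [a Aa ->] := @cup_multiple_all k k f (leqnn k).
by rewrite subnn comp_idr.
Qed.
End Spanning.

(** * The relations for all indices *)

Section GlobalRelations.
Variable K : fieldType.
Local Notation mor := (mor K).
Local Notation comp := (@Defs.comp K _ _ _).
Local Notation eqv := (eqv K).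
Local Notation em := (@endmor K).

Fixpoint ev k (s : aff_expr) : EndHeis K (ud k) :=
  match s with
  | Gen g => em (ud k) (gen_diag g)
  | Zero => 0
  | One => 1
  | Add s t => ev k s + ev k t
  | Defs.Sub s t => ev k s - ev k t
  | Mul s t => ev k s * ev k t
  end.

Definition shift_gen p (g : aff_gen) : aff_gen :=
  match g with
  | g_tau i => g_tau (2 * p + i) | g_e i => g_e (2 * p + i)
  | g_x i => g_x (2 * p + i) | g_z l => g_z l
  end.

Fixpoint shift_expr p (s : aff_expr) : aff_expr :=
  match s with
  | Gen g => Gen (shift_gen p g)
  | Zero => Zero | One => One
  | Add s t => Add (shift_expr p s) (shift_expr p t)
  | Defs.Sub s t => Defs.Sub (shift_expr p s) (shift_expr p t)
  | Mul s t => Mul (shift_expr p s) (shift_expr p t)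
  end.

(** The circles [g_z] are excluded: they stay at the left edge and do not move with the disc. *)
Fixpoint local_expr m (s : aff_expr) : bool :=
  match s with
  | Gen (g_z _) => false
  | Gen g => defined_gen m g
  | Zero | One => true
  | Add s t | Defs.Sub s t | Mul s t => local_expr m s && local_expr m t
  end.

Lemma gen_diag_shift m p g : local_expr m (Gen g) -> gen_diag (shift_gen p g) = shift (2 * p)
  (gen_diag g).
Proof.
case: g => //= [i|j|r] h.
- case: i h => [|[|i]] //= _; rewrite !addnS !tau_diagE /= ; congr [:: Cross _; Cross _; Cross _];
    lia.
- have -> : odd (2 * p + j) = odd j by rewrite oddD oddM.
  by congr [:: Min _; Max _ _]; lia.
- have -> : odd (2 * p + r) = odd r by rewrite oddD oddM.
  by rewrite shift_dot; congr dot; lia.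
Qed.

Lemma expr_combo_run m s : local_expr m s ->
  {in expr_combo s, forall cd, run (ud m) cd.2 = Some (ud m)}.
Proof.
elim: s => [g|||s IHs t IHt|s IHs t IHt|s IHs t IHt] //=.
- move=> h cd; rewrite inE => /eqP -> /=; apply: run_gen_diag; by case: g h.
- by move=> _ cd; rewrite inE => /eqP ->.
- by case/andP => /IHs h /IHt h' cd; rewrite mem_cat => /orP[/h|/h'].
- case/andP => /IHs h /IHt h' cd; rewrite mem_cat => /orP[/h|] //.
  by case/mapP => cd' /h' r ->.
- case/andP => /IHs h /IHt h' cd /allpairsP[[x y] /= [/h rx /h' ry ->]] /=.
  by rewrite run_cat rx.
Qed.

Lemma ud_locate p m k : (p + m <= k)%N -> loc (ud k) (2 * p) (ud m).
Proof.
move=> le; exists (ud p), (ud (k - (p + m))); rewrite size_ud -!ud_add; split=> //.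
by congr ud; lia.
Qed.

Lemma ev_shift k p m s : local_expr m s -> (p + m <= k)%N ->
  ev k (shift_expr p s) = \sum_(cd <- expr_combo s) cd.1%:~R *: em (ud k) (shift (2 * p) cd.2).
Proof.
move=> + le; elim: s => [g|||s IHs t IHt|s IHs t IHt|s IHs t IHt] /=.
- by move=> h; rewrite big_seq1 scale1r (gen_diag_shift p h).
- by rewrite big_nil.
- by rewrite big_seq1 scale1r.
- by case/andP => /IHs -> /IHt ->; rewrite big_cat.
- case/andP => /IHs -> /IHt ->; rewrite big_cat; congr (_ + _).
  by rewrite big_map -sumrN; apply: eq_bigr => cd _; rewrite /= intrN scaleNr.
case/andP => hs ht; rewrite IHs // IHt //.
have rs := expr_combo_run hs; have rt := expr_combo_run ht.
have rsh d : run (ud m) d = Some (ud m) -> run (ud k) (shift (2 * p) d) = Some (ud k).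
  by move=> r; apply: loc_run (ud_locate le) r erefl.
rewrite /combo_mul big_allpairs_dep mulr_suml big_seq [RHS]big_seq.
apply: eq_bigr => x /rs rx; rewrite mulr_sumr big_seq [RHS]big_seq.
apply: eq_bigr => y /rt ry /=.
rewrite -[_ * _]/(comp _ _) comp_scalel comp_scaler scalerA -intrM; congr (_ *: _).
by rewrite -[comp _ _]/(em _ _ * em _ _) emM ?rsh // shift_cat.
Qed.

Lemma ev_local k p m s t s' t' : local_rel K m s t -> local_expr m s && local_expr m t ->
  (p + m <= k)%N -> s' = shift_expr p s -> t' = shift_expr p t -> ev k s' = ev k t'.
Proof.
move=> h /andP[ls lt] le -> ->; rewrite !(ev_shift _ le) //.
exact: em_local (ud_locate le) h.
Qed.

(** The strands, counted from 0, on which the diagram of a generator is not the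
    identity. *)
Definition gen_span (g : aff_gen) : nat * nat :=
  match g with
  | g_tau i => (i - 2, 3)%N | g_e i => (i.-1, 2)%N | g_x i => (i.-1, 1)%N | g_z _ => (0, 0)%N
  end.

Lemma take_drop_ud k i n : (i + n <= 2 * k)%N ->
  take n (drop i (ud k)) = mkseq (fun j => ~~ odd (i + j)) n.
Proof.
move=> le; apply: (@eq_from_nth _ Up); first by rewrite size_mkseq size_takel // size_drop
  size_ud; lia.
move=> j; rewrite size_takel ?size_drop ?size_ud; last by lia.
by move=> lt; rewrite nth_take // nth_drop nth_mkseq // nth_ud //; lia.
Qed.

Lemma gen_span_loc k g : defined_gen k g ->
  exists l d, [/\ loc (ud k) (gen_span g).1 l, size l = (gen_span g).2,
    run l d = Some l & gen_diag g = shift (gen_span g).1 d].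
Proof.
have cut i n : (i + n <= 2 * k)%N -> loc (ud k) i (mkseq (fun j => ~~ odd (i + j)) n).
  move=> le; rewrite -(take_drop_ud le); exists (take i (ud k)), (drop n (drop i (ud k))).
  by rewrite !cat_take_drop size_takel // size_ud; lia.
case: g => [i|j|r|l] /= h.
- exists (mkseq (fun j => ~~ odd (i - 2 + j)) 3), [:: Cross 0; Cross 1; Cross 0]; split=> //.
  + by apply: cut; lia.
  + by rewrite /mkseq /= !addn0 !addn1 !addn2 /= negbK.
  + by case: i h => [|[|i]] //= _; rewrite tau_diagE subn2 /= addn0 addn1.
- exists (mkseq (fun i => ~~ odd (j.-1 + i)) 2), [:: Min 0; Max (odd j) 0]; split=> //.
  + by apply: cut; lia.
  + by case: j h => //= j _; rewrite /mkseq /= !addn0 !addn1 /= /opp_arrow !negbK eqxx.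
  + by rewrite /= addn0.
- exists (mkseq (fun i => ~~ odd (r.-1 + i)) 1), (dot (odd r) 0); split=> //.
  + by apply: cut; lia.
  + by case: r h => //= r _; rewrite /mkseq /= addn0; exact: run_dot1.
  + by rewrite -dotE.
- exists [::], (z_diag l); split; last by rewrite shift0.
  + by exists [::], (ud k).
  + by [].
  + exact: run_z_diag.
Qed.

Lemma ev_far k g h : defined_gen k g -> defined_gen k h ->
  ((gen_span g).1 + (gen_span g).2 <= (gen_span h).1)%N ||
  ((gen_span h).1 + (gen_span h).2 <= (gen_span g).1)%N ->
  ev k (Gen g * Gen h)%A = ev k (Gen h * Gen g)%A.
Proof.
move=> /gen_span_loc[l [d [L S r /= ->]]] /gen_span_loc[l' [d' [L' S' r' /= ->]]].
rewrite -S -S' => /orP[le|le]; first exact: em_comm L L' le r r'.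
by apply/esym; exact: em_comm L' L le r' r.
Qed.

Lemma ev_z_central k l g : defined_gen k g -> ev k (Gen (g_z l) * Gen g)%A = ev k (Gen g * Gen
  (g_z l))%A.
Proof.
move=> h /=; rewrite -[em _ (z_diag l) * _]/(comp _ _) -[_ * em _ (z_diag l)]/(comp _ _).
by rewrite -[z_diag l]/(bub 0 l) bub_central.
Qed.

(** Moving the undotted circle right across an upward strand subtracts 1 and across a downward
    strand adds 1, so the two corrections of a pair cancel. *)
Lemma em_bub0 n p : (p <= n)%N -> em (ud n) (bub (2 * p) 0) = em (ud n) (bub 0 0).
Proof.
elim: p => // p IH le; rewrite -IH; last by lia.
have L : loc (ud n) (2 * p) (ud 1) by apply: ud_locate; lia.
have bU : eqv [:: Up] [:: (1, [:: Max Up 1; Min 1])] [:: (1, [:: Max Up 0; Min 0]); (-1, [::])].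
  apply: (skein_check K (P := [:: Use (bigon' Up Up) 1 0; At 0; At 2; At 1; Skip; At 0; At 0;
    Skip; Skip; Skip])).
  by vm_compute.
have bD : eqv [:: Down] [:: (1, [:: Max Up 0; Min 0])] [:: (1, [:: Max Up 1; Min 1]); (-1, [::])].
  apply: (skein_check K (P := [:: Use (bigon' Down Down) 1 1; At 0; At 2; At 1; Skip; At 0; At 0;
    Skip; Skip; Skip])).
  by vm_compute.
have LU : loc (ud n) (2 * p) [:: Up].
  by apply: (@loc_sub _ _ [::] _ [:: Up] [:: Down] L); rewrite addn0.
have LD : loc (ud n) (2 * p).+1 [:: Down].
  by apply: (@loc_sub _ _ [:: Up] _ [:: Down] [::] L); rewrite addn1.
have := em_local LU bU; have := em_local LD bD.
rewrite !big_cons !big_nil !addr0 !scale1r !scaleN1r /= !addn0 !addn1.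
move=> -> e; rewrite /bub /dpow /=.
have -> : (2 * p.+1 = (2 * p).+2)%N by lia.
by have := congr1 (fun z => z + em (ud n) [::]) e; rewrite /= !subrK.
Qed.

Ltac expr_eq := rewrite /=;
  repeat match goal with |- @eq aff_expr _ _ => f_equal | |- @eq aff_gen _ _ => f_equal end; first
    [reflexivity | lia].
Ltac by_local H p := refine (@ev_local _ p _ _ _ _ _ (H K) _ _ _ _); [by [] | lia | expr_eq |
  expr_eq].

Lemma ev_pow k s l : ev k (expr_pow s l) = ev k s ^+ l.
Proof. by elim: l => //= l ->; rewrite exprS. Qed.

(** The two inner arcs close to a circle between pairs of [ud k.-1]; [em_bub0] brings it to the left
    edge, where it is central. *)
Lemma ev_e_odd_sq k i : (1 <= i <= k)%N ->
  ev k (Gen (g_e (2 * i - 1)) * Gen (g_e (2 * i - 1)))%A = ev k (Gen (g_z 0) * Gen (g_e (2 * i -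
    1)))%A.
Proof.
case: i => // p /andP[_ lt].
have -> : (2 * p.+1 - 1 = (2 * p).+1)%N by lia.
have dg : defined_gen k (g_e (2 * p).+1) by rewrite /=; lia.
have rg := run_gen_diag dg; rewrite [LHS]/= [RHS]/= -!/(gen_diag (g_e _)) -!/(gen_diag (g_z _)).
rewrite -/(gen_diag (g_e (2 * p).+1)) e_odd_diag in rg *.
have rM : run (ud k) [:: Min (2 * p)] = Some (ud k.-1).
  have -> : ud k = ud p ++ Up :: ~~ Up :: ud (k - p.+1).
    by rewrite -{1}(subnKC lt) ud_add ud_S -catA.
  rewrite -(size_ud p) run_cons step_min_cat -ud_add; congr (Some (ud _)); lia.
have rX : run (ud k.-1) [:: Max Up (2 * p)] = Some (ud k).
  have -> : ud k.-1 = ud p ++ ud (k - p.+1) by rewrite -ud_add; congr ud; lia.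
  rewrite -(size_ud p) run_cons step_max_cat; congr Some.
  by rewrite -[in RHS](subnKC lt) ud_add ud_S -catA.
have eb : em (ud k.-1) (bub (2 * p) 0) = em (ud k.-1) (bub 0 0) by apply: em_bub0; lia.
have -> : em (ud k) [:: Min (2 * p); Max Up (2 * p)] =
    comp (mor (ud k) (ud k.-1) [:: Min (2 * p)]) (mor (ud k.-1) (ud k) [:: Max Up (2 * p)]).
  by rewrite comp_mor.
set m := mor (ud k) _ _; set x := mor (ud k.-1) _ _.
transitivity (comp (comp m x) (comp m x)); first by [].
transitivity (comp (em (ud k) (bub 0 0)) (comp m x)); last by [].
rewrite [RHS]Defs.compA -bub_central -eb Defs.compA; congr comp; rewrite -Defs.compA; congr comp.
by rewrite comp_mor.
Qed.

(** Relations with neighbouring indices are translates of the local ones; commutations of generators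
    with disjoint supports are height exchanges. Only the commutations whose supports overlap need a
    separate look. *)
Lemma aff_rel_sound k s t : aff_rel k s t -> defined_expr k s -> defined_expr k t -> ev k s = ev k
  t.
Proof.
case=> {s t}.
- by move=> i h _ _; by_local tau_even_sq i.-1.
- by move=> i h _ _; by_local tau_odd_sq i.-1.
- move=> i j ne /andP[h1 h2] _; rewrite /= in h1 h2; have [->|ne'] := eqVneq j i.
    by by_local tau_tau_comm i.-1.
  by apply: ev_far => /=; lia.
- move=> i j ne ne2 /andP[h1 h2] _; rewrite /= in h1 h2; have [->|ne'] := eqVneq j i => //.
  by apply: ev_far => /=; lia.
- move=> i j ne ne2 /andP[h1 h2] _; rewrite /= in h1 h2; have [->|ne'] := eqVneq j i => //.
  by apply: ev_far => /=; lia.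
- by move=> i h _ _; by_local braid i.-1.
- by move=> i h _ _; apply: ev_e_odd_sq.
- by move=> i h _ _; by_local e_even_idem i.-1.
- by move=> i h _ _; by_local tau_odd_e i.-1.
- by move=> i h _ _; by_local e_tau_odd i.-1.
- by move=> i h _ _; by_local tau_even_e i.-1.
- by move=> i h _ _; by_local e_tau_even i.-1.
- by move=> i h _ _; by_local tau_e_e i.-1.
- by move=> i h _ _; by_local e_e_tau i.-1.
- by move=> i j ne /andP[h1 h2] _; rewrite /= in h1 h2; apply: ev_far => /=; lia.
- by move=> i j ne ne2 /andP[h1 h2] _; rewrite /= in h1 h2; apply: ev_far => /=; lia.
(* For [j + 1 = i] the two diagrams share strands, but both products vanish. *)
- move=> i j ne /andP[h1 h2] _; rewrite /= in h1 h2; have [e|ne'] := eqVneq j.+1 i; last by apply: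
    ev_far => /=; lia.
  have z1 : ev k (Gen (g_tau (2 * i - 1)) * Gen (g_e (2 * j)))%A = ev k Zero.
    by by_local tau_odd_e j.-1.
  have z2 : ev k (Gen (g_e (2 * j)) * Gen (g_tau (2 * i - 1)))%A = ev k Zero.
    by by_local e_tau_odd j.-1.
  by rewrite z1 z2.
- by move=> i j ne ne2 /andP[h1 h2] _; rewrite /= in h1 h2; apply: ev_far => /=; lia.
- move=> i j ne /andP[h1 h2] _; rewrite /= in h1 h2; have [e|ne'] := eqVneq j i; last by apply:
    ev_far => /=; lia.
  have z1 : ev k (Gen (g_tau (2 * i)) * Gen (g_e (2 * j)))%A = ev k Zero.
    by by_local tau_even_e j.-1.
  have z2 : ev k (Gen (g_e (2 * j)) * Gen (g_tau (2 * i)))%A = ev k Zero.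
    by by_local e_tau_even j.-1.
  by rewrite z1 z2.
- move=> i h _ _; have [p [e|e]] : exists p, i = (2 * p).+1 \/ i = (2 * p).+2.
    by exists (i.-1)./2; have := odd_double_half i.-1; case: (odd _) => /=; lia.
  + by by_local e121 p.
  + by by_local e232 p.
- move=> i h _ _; have [p [e|e]] : exists p, i = (2 * p).+1 \/ i = (2 * p).+2.
    by exists (i.-1)./2; have := odd_double_half i.-1; case: (odd _) => /=; lia.
  + by by_local e212 p.
  + by by_local e323 p.
- by move=> i h _ _; by_local tau_e_tau_odd i.-1.
- by move=> i h _ _; by_local tau_e_tau_even i.-2.
- move=> i j /andP[h1 h2] _; rewrite /= in h1 h2; have [->|ne'] := eqVneq j i => //.
  by apply: ev_far => /=; lia.
- by move=> i j n1 n2 n3 /andP[h1 h2] _; rewrite /= in h1 h2; apply: ev_far => /=; lia.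
- by move=> i j n1 n2 /andP[h1 h2] _; rewrite /= in h1 h2; apply: ev_far => /=; lia.
- by move=> i h _; rewrite /= in h; by_local tau424 i.-2.
- by move=> i h _; rewrite /= in h; by_local tau535 i.-2.
- by move=> i h _; rewrite /= in h; by_local tau343 i.-2.
- by move=> i h _; rewrite /= in h; by_local tau434 i.-2.
- by move=> i _ h; rewrite /= in h; by_local x3_even i.-1.
- by move=> i _ h; rewrite /= in h; by_local x4_odd i.-1.
- by move=> i _ h; rewrite /= in h; by_local x2_even i.-1.
- by move=> i _ h; rewrite /= in h; by_local x3_odd i.-1.
- move=> i h _ _; have [p [e|e]] : exists p, i = (2 * p).+1 \/ i = (2 * p).+2.
    by exists (i.-1)./2; have := odd_double_half i.-1; case: (odd _) => /=; lia.
  + by by_local e1_x p.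
  + by by_local e2_x p.
- move=> i h _ _; have [p [e|e]] : exists p, i = (2 * p).+1 \/ i = (2 * p).+2.
    by exists (i.-1)./2; have := odd_double_half i.-1; case: (odd _) => /=; lia.
  + by by_local x_e1 p.
  + by by_local x_e2 p.
(* The inner arcs of the two [e 1] and the [l] dots close to a circle at the left edge of [ud k.-1],
   which is then moved to the top. *)
- move=> l l0 h _; have k0 : (0 < k)%N by move: h => /=; lia.
  have rM : run (ud k) [:: Min 0] = Some (ud k.-1) by case: (k) k0.
  have rX : run (ud k.-1) [:: Max Up 0] = Some (ud k) by case: (k) k0 => // k' _; rewrite run_cons
    (step_max_cat Up [::]).
  have rx : run (ud k) (dot Up 0) = Some (ud k).
    by have := @run_gen_diag k (g_x 1); apply; rewrite /=; lia.
  rewrite /= ev_pow /= -/(dot Up 0) em_pow //.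
  have e1 : em (ud k) [:: Min 0; Max Up 0] =
      comp (mor (ud k) (ud k.-1) [:: Min 0]) (mor (ud k.-1) (ud k) [:: Max Up 0]).
    by rewrite comp_mor.
  have rP := run_pow l rx.
  rewrite e1; set m := mor (ud k) _ _; set x := mor (ud k.-1) _ _.
  set b := em (ud k) (flatten _).
  transitivity (comp (comp (comp m x) b) (comp m x)); first by [].
  transitivity (comp (em (ud k) (bub 0 l)) (comp m x)); last by [].
  rewrite [RHS]Defs.compA -bub_central -!Defs.compA; congr comp.
  rewrite !Defs.compA; congr comp.
  by rewrite /endmor !comp_mor ?run_cat ?rX ?rP -?catA.
- by move=> l g h _; apply: ev_z_central.
Qed.
End GlobalRelations.

(** * The homomorphism and its image *)

Section Homomorphism.
Variables (K : fieldType) (k : nat).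
Local Notation Heis := (Heis K).
Local Notation mor := (mor K).
Local Notation comp := (@Defs.comp K _ _ _).
Local Notation em := (@endmor K).
Local Notation E := (EndHeis K (ud k)).
Local Notation free := {malg K[{fmonom aff_gen_sub k}]}.

Definition word_image (w : {fmonom aff_gen_sub k}) : E :=
  \prod_(g <- (w : seq (aff_gen_sub k))) em (ud k) (gen_diag (val g)).

Definition free_image (u : free) : E := lext word_image u.

Lemma free_imageP c u v : free_image (c *: u + v) = c *: free_image u + free_image v.
Proof. exact: lext_is_linear. Qed.

Lemma free_image0 : free_image 0 = 0.
Proof. by have := free_imageP (-1) 0 0; rewrite scaler0 addr0 scaleN1r addNr. Qed.

Lemma free_imageB u v : free_image (u - v) = free_image u - free_image v.
Proof. by rewrite addrC -scaleN1r free_imageP scaleN1r addrC. Qed.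

Lemma free_imageD u v : free_image (u + v) = free_image u + free_image v.
Proof. by rewrite -[u]scale1r free_imageP !scale1r. Qed.

Lemma free_imageU w : free_image << w >> = word_image w.
Proof. exact: lextU. Qed.

Lemma free_image1 : free_image 1 = 1.
Proof. have -> : 1 = << fmone (aff_gen_sub k) >> :> free by [].
by rewrite free_imageU /word_image fmoneE big_nil. Qed.

Lemma free_imageM u v : free_image (u * v) = free_image u * free_image v.
Proof.
elim/malg_ind_lin: u => [|c x u IHu]; first by rewrite mul0r !free_image0 mul0r.
rewrite mulrDl free_imageD free_imageP -[RHS]/(comp _ _) comp_Pl; congr (_ + _); last exact: IHu.
rewrite -scalerAl -[c *: (_ * v)]addr0 free_imageP free_image0 addr0; congr (_ *: _) => {IHu}.
elim/malg_ind_lin: v => [|d y v IHv]; first by rewrite mulr0 !free_image0 comp0r.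
rewrite mulrDr free_imageD free_imageP comp_Pr; congr (_ + _); last exact: IHv.
rewrite -free_scalerAr -[d *: _]addr0 free_imageP free_image0 addr0; congr (_ *: _).
rewrite !free_imageU -[RHS]/(word_image x * word_image y).
have -> : << x >> * << y >> = << fmmul x y >> :> free by rewrite malgM_def fgmulUU mulr1.
by rewrite free_imageU /word_image fmmulE big_cat.
Qed.

Lemma free_image_gen g : defined_gen k g -> free_image (free_gen K k g) = em (ud k) (gen_diag g).
Proof.
by move=> h; rewrite /free_gen insubT free_imageU /word_image fmU big_seq1.
Qed.

Lemma free_image_expr s : defined_expr k s -> free_image (eval_expr K k s) = ev K k s.
Proof.
elim: s => [g|||s IHs t IHt|s IHs t IHt|s IHs t IHt] /=.
- exact: free_image_gen.
- by rewrite free_image0.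
- by rewrite free_image1.
- by case/andP => /IHs <- /IHt <-; rewrite free_imageD.
- by case/andP => /IHs <- /IHt <-; rewrite free_imageB.
- by case/andP => /IHs <- /IHt <-; rewrite free_imageM.
Qed.

Lemma free_image_ideal u : spanned (in_ideal_gen (@aff_relator K k)) u -> free_image u = 0.
Proof.
elim=> [v [a r b [s t h ds dt]]||c v w _ IHv _ IHw]; last 2 first.
- exact: free_image0.
- by rewrite free_imageP IHv IHw scaler0 addr0.
rewrite !free_imageM free_imageB !free_image_expr // (aff_rel_sound K h ds dt) subrr.
by rewrite mulr0 mul0r.
Qed.

Lemma APar_local m p a : (p + m <= k)%N -> run (ud m) a = Some (ud m) ->
  APar (mor (ud m) (ud m) a) -> APar (em (ud k) (shift (2 * p) a)).
Proof.
move=> le r h; have e : ud k = ud p ++ (ud m ++ ud (k - (p + m))).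
  by rewrite -!ud_add; congr ud; lia.
have := APar_tensor (APar_ud K p) (APar_tensor h (APar_ud K (k - (p + m)))).
rewrite /idm tensor_mor // cats0 tensor_mor //; last exact: run_frame0.
by rewrite size_ud /= -e.
Qed.

(** The generating morphisms of the category come with a summand [E] or an identity, which lies in
    the category and can be subtracted. *)
Lemma APar_addK a b (f g : Heis a b) : APar (f + g) -> APar g -> APar f.
Proof. by move=> h h'; rewrite -(addrK g f) addrC -scaleN1r; apply: APar_lin. Qed.

Lemma APar_gen g : defined_gen k g -> APar (em (ud k) (gen_diag g)).
Proof.
(* Merging followed by splitting is [E]. *)
have AE : APar (mor (ud 2) (ud 2) E_diag).
  by have := APar_comp (APar_merge K) (APar_split K); rewrite comp_mor.
have sh m p g0 : local_expr m (Gen g0) -> (p + m <= k)%N -> APar (mor (ud m) (ud m) (gen_diag g0))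
  ->
    APar (em (ud k) (gen_diag (shift_gen p g0))).
  move=> lg le h; rewrite (gen_diag_shift p lg); apply: (APar_local le) => //.
  by apply: run_gen_diag; case: (g0) lg.
have par i : exists p, i = (2 * p)%N \/ i = (2 * p).+1.
  by exists i./2; have := odd_double_half i; case: (odd _) => /=; lia.
case: g => [i|j|r|l] /= h.
- have [p [e|e]] := par i.-2.
  + have -> : i = (2 * p + 2)%N by lia.
    apply: (sh 2 p (g_tau 2)) => //; first by lia.
    exact: APar_addK (APar_T K) AE.
  + have -> : i = (2 * p + 3)%N by lia.
    apply: (sh 2 p (g_tau 3)) => //; first by lia.
    exact: APar_addK (APar_T' K) AE.
- have [p [e|e]] := par j.-1.
  + have -> : j = (2 * p + 1)%N by lia.
    apply: (sh 1 p (g_e 1)) => //; first by lia.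
    by have := APar_comp (APar_cup K) (APar_cap K); rewrite comp_mor.
  + have -> : j = (2 * p + 2)%N by lia.
    by apply: (sh 2 p (g_e 2)) => //; lia.
- have [p [e|e]] := par r.-1.
  + have -> : r = (2 * p + 1)%N by lia.
    apply: (sh 1 p (g_x 1)) => //; first by lia.
    exact: APar_addK (APar_dot_up K) (APar_ud K 1).
  + have -> : r = (2 * p + 2)%N by lia.
    apply: (sh 1 p (g_x 2)) => //; first by lia.
    exact: APar_addK (APar_dot_down K) (APar_ud K 1).
- have dots : APar (mor (ud 1) (ud 1) (dot Up 0)) by exact: APar_addK (APar_dot_up K) (APar_ud K 1).
  have rd : run (ud 1) (dot Up 0) = Some (ud 1) by [].
  have pow n : APar (em (ud 1) (flatten (nseq n (dot Up 0)))).
    elim: n => [|n IH]; first exact: (APar_ud K 1).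
    by have := APar_comp dots IH; rewrite comp_mor // run_pow.
  have := APar_comp (APar_comp (APar_cap K) (pow l)) (APar_cup K).
  rewrite /endmor comp_mor ?run_pow // comp_mor //; last by rewrite run_cat /= run_pow.
  have := @APar_local 0 0 (z_diag l); rewrite !muln0 shift0; apply=> //.
  exact: run_z_diag.
Qed.

Lemma APar_free_image u : free_image u \in @APar_end K k.
Proof.
have [h0 hZ] : GRing.subsemimod_closed (@APar_end K k) by exact: APar_end_subsemimod.
elim/malg_ind_lin: u => [|c w u IH]; first by rewrite free_image0 rpred0.
rewrite free_imageP free_imageU rpredD //; apply: hZ.
rewrite /word_image; apply: rpred_prod => g _; apply/asboolP.
by apply: APar_gen; exact: (valP g).
Qed.

(** Evaluated on a chosen representative; [val_aff_image] shows that the choice is irrelevant, as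
    the ideal of relations is sent to zero. *)
Definition aff_image (x : affine_partition_algebra K k) : AP K k :=
  exist _ (free_image (repr x)) (APar_free_image (repr x)).

Lemma val_aff_image u : \val (aff_image (palg_proj (@aff_relator K k) u)) = free_image u.
Proof.
apply/eqP; rewrite -subr_eq0 -free_imageB; apply/eqP; apply: free_image_ideal.
by apply/spanP; exact: lproj_reprB.
Qed.

Lemma aff_image_linear : linear aff_image.
Proof.
move=> c; elim/lquotP=> u; elim/lquotP=> v; apply: val_inj.
rewrite -[lproj _ u]/(palg_proj _ u) -[lproj _ v]/(palg_proj _ v) -linearP val_aff_image.
by rewrite free_imageP -!val_aff_image.
Qed.

Lemma aff_image_monoid : GRing.monoid_morphism aff_image.
Proof.
split; first by apply: val_inj; rewrite -(rmorph1 (palg_proj (@aff_relator K k))) val_aff_image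
  free_image1.
elim/lquotP=> u; elim/lquotP=> v; apply: val_inj.
rewrite -[lproj _ u]/(palg_proj _ u) -[lproj _ v]/(palg_proj _ v) -rmorphM val_aff_image.
by rewrite free_imageM -!val_aff_image.
Qed.

Lemma aff_image_gen g : defined_gen k g -> \val (aff_image (aff K k g)) = em (ud k) (gen_diag g).
Proof. by move=> h; rewrite val_aff_image free_image_gen. Qed.

(** By [Alg_all] the underlying morphism of [y] is a combination of words in the generator diagrams,
    and each word is the image of the product of its letters. *)
Lemma aff_image_surj (y : AP K k) : exists x, aff_image x = y.
Proof.
suff h f : Alg f -> exists x, \val (aff_image x) = f.
  by have [x e] := h _ (Alg_all (\val y)); exists x; exact: val_inj.
elim=> [g [d [gs hgs ->] ->]||c u v _ [x ex] _ [y' ey]]; last 2 first.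
- by exists 0; rewrite -(linear0 (palg_proj (@aff_relator K k))) val_aff_image free_image0.
- exists (c *: x + y'); rewrite aff_image_linear -ex -ey; exact: erefl.
elim: gs hgs => [_|g' gs IH /andP[h hgs]].
  by exists 1; have [-> _] := aff_image_monoid.
have [x ex] := IH hgs; exists (aff K k g' * x); have [_ ->] := aff_image_monoid.
have rgs : run (ud k) (flatten [seq gen_diag g | g <- gs]) = Some (ud k).
  by apply: run_gword; exists gs.
transitivity (\val (aff_image (aff K k g')) * \val (aff_image x)); first by [].
by rewrite ex aff_image_gen // emM // run_gen_diag.
Qed.
End Homomorphism.

Local Open Scope complex_scope.

Theorem corollary4p3p3 (R : realType) (k : nat) (hk : (1 <= k)%N) :
  exists phi : affine_partition_algebra R[i] k -> AP R[i] k,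
    [/\ linear phi /\ GRing.monoid_morphism phi,
        [/\ forall j, (1 <= j <= 2 * k - 1)%N ->
              \val (phi (aff R[i] k (g_e j))) = mor R[i] (ud k) (ud k) (e_diag k j),
            forall j, (2 <= j <= 2 * k - 1)%N ->
              \val (phi (aff R[i] k (g_tau j))) = mor R[i] (ud k) (ud k) (tau_diag j),
            forall r, (1 <= r <= 2 * k)%N ->
              \val (phi (aff R[i] k (g_x r))) = mor R[i] (ud k) (ud k) (x_diag k r)
          & forall l,
              \val (phi (aff R[i] k (g_z l))) = mor R[i] (ud k) (ud k) (z_diag l)]
      & forall y : AP R[i] k, exists x, phi x = y].
Proof.
exists (@aff_image R[i] k); split; last exact: aff_image_surj.
  by split; [exact: aff_image_linear | exact: aff_image_monoid].
split=> [j h|j h|r h|l].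
- by rewrite (aff_image_gen _ (g := g_e j)) // (e_diag_gen h).
- by rewrite (aff_image_gen _ (g := g_tau j)).
- by rewrite (aff_image_gen _ (g := g_x r)) // (x_diag_gen h).
- by rewrite (aff_image_gen _ (g := g_z l)).
Qed.
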